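(* Let $R$ be a discrete valuation ring with uniformizing parameter $t$ and residue field $K=R/(t)$, and let $\phi:\mathbb{R}\to\mathbb{R}$ be a homeomorphism such that $\phi(x+2\pi)=\phi(x)+2\pi$ and $x\le\phi(x)<x+\pi$ for all $x\in\mathbb{R}$. The stable category of the Frobenius category $\mathcal{F}_\phi$ is equivalent to the category $\mathcal{C}_\phi$ over $K$.
   Context: $S^1=\mathbb{R}/2\pi\mathbb{Z}$, and for $x\in\mathbb{R}$ the class of $x$ in $S^1$ is $[x]$. A representation $V$ of $S^1$ over $R$ consists of an $R$-module $V[x]$ for every $[x]\in S^1$ and an $R$-linear map $V^{(x,\alpha)}:V[x]\to V[x-\alpha]$ for every $[x]\in S^1$ and real $\alpha\ge 0$ (depending only on $[x]$ and $\alpha$), such that $V^{(x-\beta,\alpha)}\circ V^{(x,\beta)}=V^{(x,\alpha+\beta)}$ for all $\alpha,\beta\ge 0$, and $V^{(x,2\pi n)}:V[x]\to V[x]$ is multiplication by $t^n$ for all $n\in\mathbb{N}$. A morphism $f:V\to W$ is a family of $R$-linear maps $f_{[x]}:V[x]\to W[x]$ with $W^{(x,\alpha)}f_{[x]}=f_{[x-\alpha]}V^{(x,\alpha)}$. Monomorphisms, epimorphisms, exactness and direct sums are taken pointwise; a representation is projective if morphisms from it lift through all epimorphisms. $P_{[x]}$ is the representation with $P_{[x]}[x-\alpha]=Re_x^\alpha$ free on one generator $e_x^\alpha$ for $0\le\alpha<2\pi$; for $n\in\mathbb{N}$ put $e_x^{\gamma+2\pi n}:=t^ne_x^\gamma$;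 write $e_x=e_x^0$; the structure maps are $P_{[x]}^{(x-\alpha,\beta)}(e_x^\alpha)=e_x^{\alpha+\beta}$. A representation is finitely generated if it is a quotient of a finite direct sum of representations $P_{[x_i]}$. $\mathcal{P}_{S^1}$ is the category of all finitely generated projective representations of $S^1$ over $R$; every object of it is isomorphic to a finite direct sum $\bigoplus P_{[x_i]}$. The category $\mathcal{F}_\pi$: objects are pairs $(V,d)$ with $V\in\mathcal{P}_{S^1}$ and $d:V\to V$ an endomorphism with $d^2=t$ (multiplication by $t$); morphisms $(V,d)\to(W,d)$ are morphisms $f:V\to W$ with $fd=df$. Exact sequences in $\mathcal{F}_\pi$ are the sequences $(X,d)\xrightarrow{f}(Y,d)\xrightarrow{g}(Z,d)$ such that $0\to X\xrightarrow{f}Y\xrightarrow{g}Z\to 0$ is exact (hence split exact) in $\mathcal{P}_{S^1}$. Depth: for nonzero $f:P_{[x]}\to P_{[y]}$, the depth $\delta(f)$ is the unique real $\alpha\ge0$ with $f(e_x)=ue_y^\alpha$ for a unit $u\in R$; $\delta(0)=\infty$. Support intervals: a closed interval in $S^1$ is the image $[x,y]$ of a real interval with $x\le y<x+2\pi$. Let $f:P\to Q$ be a morphism in $\mathcal{P}_{S^1}$ with decompositions $P=\bigoplus P_{[x_i]}$, $Q=\bigoplus P_{[y_j]}$ and components $f_{ji}:P_{[x_i]}\to P_{[y_j]}$. Consider all closed intervals $[x_i,y_j]\subsetneq S^1$ (representatives chosen with $x_i\le y_j<x_i+2\pi$) such that $\delta(f_{ji})=y_j-x_i$. The minimal elements of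 this collection under inclusion are the support intervals of $f$ (they do not depend on the decompositions). $\mathcal{F}_\phi$ is the full subcategory of $\mathcal{F}_\pi$ consisting of all $(V,d)$ such that every support interval $[x,y]$ of $d$ contains an interval of the form $[z,\phi(z)]$; its exact sequences are those of $\mathcal{F}_\pi$ with all terms in $\mathcal{F}_\phi$. It is a Frobenius category. Its stable category has the same objects, with morphism sets taken modulo morphisms factoring through projective-injective objects of $\mathcal{F}_\phi$. $\mathcal{C}_\phi$ is the additive category (formal finite direct sums, matrices of morphisms) generated by the $K$-category $\widetilde{Ind}\,\mathcal{C}_\phi$ defined as follows. Objects: ordered pairs of points $(x_0,x_1)$ in $S^1$ such that (for suitable real representatives) $x_0\le\phi(x_0)\le x_1\le\phi^{-1}(x_0+2\pi)$. Morphisms: for $X=(x_0,x_1)$, $Y=(y_0,y_1)$, $\mathcal{C}_\phi(X,Y)$ is the one-dimensional space $Kb_+^{XY}$ if the elements of $X,Y$ lift to real numbers with $x_0\le y_0<\phi^{-1}(x_1)\le x_1\le y_1<\phi^{-1}(x_0+2\pi)$; it is the one-dimensional space $Kb_-^{XY}$ if they lift to real numbers with $x_0\le y_1<\phi^{-1}(x_1)\le x_1\le y_0+2\pi<\phi^{-1}(x_0+2\pi)$; it is $0$ if the elements of $X,Y$ do not lift to such real numbers. Composition: $rb_\epsilon^{YZ}\circ sb_{\epsilon'}^{XY}=rs\,b_{\epsilon\epsilon'}^{XZ}$ if $\mathcal{C}_\phi(X,Z)=Kb_{\epsilon\epsilon'}^{XZ}$, and $0$ otherwise ($r,s\in K$,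 $\epsilon,\epsilon'\in\{+,-\}$). *)

(* Defs.v *)
From HB Require Import structures.
From mathcomp Require Import all_boot all_order all_algebra.
From mathcomp Require Import all_classical all_reals all_analysis.
From mathcomp Require Import lra.

Set Implicit Arguments.
Unset Strict Implicit.
Unset Printing Implicit Defensive.

Import Order.TTheory GRing.Theory Num.Theory numFieldNormedType.Exports.

Local Open Scope classical_set_scope.
Local Open Scope ring_scope.

Section DependentProduct.
Variables (k : nzRingType) (I : Type) (V : I -> lmodType k).

Definition dprod := forall i, V i.

HB.instance Definition _ := gen_eqMixin dprod.
HB.instance Definition _ := gen_choiceMixin dprod.

Definition dadd (f g : dprod) : dprod := fun i => f i + g i.
Definition dopp (f : dprod) : dprod := fun i => - f i.
Definition dzero : dprod := fun i => 0.
Definition dscale (a : k) (f : dprod) : dprod := fun i => a *: f i.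

Fact daddA : associative dadd.
Proof. by move=> f g h; apply: functional_extensionality_dep => i; exact: addrA. Qed.
Fact daddC : commutative dadd.
Proof. by move=> f g; apply: functional_extensionality_dep => i; exact: addrC. Qed.
Fact dadd0 : left_id dzero dadd.
Proof. by move=> f; apply: functional_extensionality_dep => i; exact: add0r. Qed.
Fact daddN : left_inverse dzero dopp dadd.
Proof. by move=> f; apply: functional_extensionality_dep => i; exact: addNr. Qed.

HB.instance Definition _ :=
  GRing.isZmodule.Build dprod daddA daddC dadd0 daddN.

Fact dscaleA a b f : dscale a (dscale b f) = dscale (a * b) f.
Proof. by apply: functional_extensionality_dep => i; exact: scalerA. Qed.
Fact dscale1 : left_id 1 dscale.
Proof. by move=> f; apply: functional_extensionality_dep => i; exact: scale1r. Qed.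
Fact dscaleDr : right_distributive dscale +%R.
Proof. by move=> a f g; apply: functional_extensionality_dep => i; exact: scalerDr. Qed.
Fact dscaleDl f : {morph dscale^~ f : a b / a + b}.
Proof. by move=> a b; apply: functional_extensionality_dep => i; exact: scalerDl. Qed.

HB.instance Definition _ :=
  GRing.Zmodule_isLmodule.Build k dprod dscaleA dscale1 dscaleDr dscaleDl.

Lemma dprodP (f g : dprod) : (forall i, f i = g i) -> f = g.
Proof. exact: functional_extensionality_dep. Qed.

Lemma dprod_sumE (J : Type) (r : seq J) (P : pred J) (F : J -> dprod) i :
  (\sum_(j <- r | P j) F j) i = \sum_(j <- r | P j) F j i.
Proof. by elim/big_rec2: _ => // j y f _ <-. Qed.

End DependentProduct.

Record linCat (k : comNzRingType) := LinCat {
  obj :> Type;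
  mor : obj -> obj -> lmodType k;
  idm : forall x, mor x x;
  mcomp : forall x y z, mor y z -> mor x y -> mor x z;
  mcompA : forall x y z w (h : mor z w) (g : mor y z) (f : mor x y),
    mcomp h (mcomp g f) = mcomp (mcomp h g) f;
  mcomp1m : forall x y (f : mor x y), mcomp (idm y) f = f;
  mcompm1 : forall x y (f : mor x y), mcomp f (idm x) = f;
  mcomp_linear_l : forall x y z (f : mor x y), linear (fun g : mor y z => mcomp g f);
  mcomp_linear_r : forall x y z (g : mor y z), linear (fun f : mor x y => mcomp g f)
}.
Arguments mor {k l} x y : rename.
Arguments idm {k l} x : rename.
Arguments mcomp {k l x y z} g f : rename.

Section LinCatTheory.
Variables (k : comNzRingType) (C : linCat k).
Implicit Types x y z : C.

Lemma mcompDl x y z (g g' : mor y z) (f : mor x y) :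
  mcomp (g + g') f = mcomp g f + mcomp g' f.
Proof. by have := mcomp_linear_l f 1 g g'; rewrite !scale1r. Qed.

Lemma mcompDr x y z (g : mor y z) (f f' : mor x y) :
  mcomp g (f + f') = mcomp g f + mcomp g f'.
Proof. by have := mcomp_linear_r g 1 f f'; rewrite !scale1r. Qed.

Lemma mcomp0l x y z (f : mor x y) : mcomp (0 : mor y z) f = 0.
Proof. by apply: (addrI (mcomp 0 f)); rewrite -mcompDl !addr0. Qed.

Lemma mcomp0r x y z (g : mor y z) : mcomp g (0 : mor x y) = 0.
Proof. by apply: (addrI (mcomp g 0)); rewrite -mcompDr !addr0. Qed.

Lemma mcompZl x y z a (g : mor y z) (f : mor x y) :
  mcomp (a *: g) f = a *: mcomp g f.
Proof. by have := mcomp_linear_l f a g 0; rewrite mcomp0l !addr0. Qed.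

Lemma mcompZr x y z a (g : mor y z) (f : mor x y) :
  mcomp g (a *: f) = a *: mcomp g f.
Proof. by have := mcomp_linear_r g a f 0; rewrite mcomp0r !addr0. Qed.

Lemma mcompBl x y z (g g' : mor y z) (f : mor x y) :
  mcomp (g - g') f = mcomp g f - mcomp g' f.
Proof. by rewrite mcompDl -scaleN1r mcompZl scaleN1r. Qed.

Lemma mcompBr x y z (g : mor y z) (f f' : mor x y) :
  mcomp g (f - f') = mcomp g f - mcomp g f'.
Proof. by rewrite mcompDr -scaleN1r mcompZr scaleN1r. Qed.

Lemma mcomp_suml (J : Type) (r : seq J) (P : pred J) x y z
    (G : J -> mor y z) (f : mor x y) :
  mcomp (\sum_(j <- r | P j) G j) f = \sum_(j <- r | P j) mcomp (G j) f.
Proof.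
by elim/big_rec2: _ => [|j u v _ <-]; [exact: mcomp0l|exact: mcompDl].
Qed.

Lemma mcomp_sumr (J : Type) (r : seq J) (P : pred J) x y z
    (g : mor y z) (F : J -> mor x y) :
  mcomp g (\sum_(j <- r | P j) F j) = \sum_(j <- r | P j) mcomp g (F j).
Proof.
by elim/big_rec2: _ => [|j u v _ <-]; [exact: mcomp0r|exact: mcompDr].
Qed.

Definition is_iso x y (f : mor x y) :=
  exists g : mor y x, mcomp g f = idm x /\ mcomp f g = idm y.

Definition factors_through (Q : C -> Prop) x y (f : mor x y) :=
  exists2 z, Q z & exists g : mor z y, exists h : mor x z, f = mcomp g h.

End LinCatTheory.

Record functor (k l : comNzRingType) (C : linCat k) (D : linCat l) := Functor {
  fobj :> C -> D;
  fhom : forall x y, mor x y -> mor (fobj x) (fobj y);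
  fhom1 : forall x, fhom (idm x) = idm (fobj x);
  fhomM : forall x y z (g : mor y z) (f : mor x y),
    fhom (mcomp g f) = mcomp (fhom g) (fhom f)
}.
Arguments fhom {k l C D} f [x y] g : rename.

Definition functor_id (k : comNzRingType) (C : linCat k) : functor C C :=
  @Functor k k C C id (fun x y f => f) (fun x => erefl) (fun x y z g f => erefl).

Section FunctorComp.
Variables (k l m : comNzRingType).
Variables (C : linCat k) (D : linCat l) (E : linCat m).
Variables (G : functor D E) (F : functor C D).

Fact functor_comp1 x : fhom G (fhom F (idm x)) = idm (G (F x)).
Proof. by rewrite !fhom1. Qed.
Fact functor_compM x y z (g : mor y z) (f : mor x y) :
  fhom G (fhom F (mcomp g f)) =
  mcomp (fhom G (fhom F g)) (fhom G (fhom F f)).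
Proof. by rewrite !fhomM. Qed.

Definition functor_comp : functor C E :=
  @Functor k m C E (fun x => G (F x)) (fun x y f => fhom G (fhom F f))
    functor_comp1 functor_compM.
End FunctorComp.

Definition naturally_isomorphic (k l : comNzRingType) (C : linCat k)
    (D : linCat l) (F G : functor C D) :=
  exists a : forall x, mor (F x) (G x),
    (forall x, is_iso (a x)) /\
    (forall x y (f : mor x y), mcomp (fhom G f) (a x) = mcomp (a y) (fhom F f)).

Definition functor_linear (k l : comNzRingType) (rho : k -> l)
    (C : linCat k) (D : linCat l) (F : functor C D) :=
  forall x y (a : k) (f g : mor x y),
    fhom F (a *: f + g) = rho a *: fhom F f + fhom F g.

(* Linearity of the quasi-inverse G need not be required: it follows from
   that of F. *)
Definition linearly_equivalent (k l : comNzRingType) (rho : k -> l)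
    (C : linCat k) (D : linCat l) :=
  exists (F : functor C D) (G : functor D C),
    [/\ functor_linear rho F,
        naturally_isomorphic (functor_id C) (functor_comp G F)
      & naturally_isomorphic (functor_comp F G) (functor_id D)].

Definition fullCat (k : comNzRingType) (C : linCat k) (P : C -> Prop) : linCat k :=
  @LinCat k {x : C | P x} (fun x y => mor (sval x) (sval y))
    (fun x => idm (sval x)) (fun x y z g f => mcomp g f)
    (fun x y z w h g f => mcompA h g f)
    (fun x y f => mcomp1m f) (fun x y f => mcompm1 f)
    (fun x y z f => mcomp_linear_l f) (fun x y z g => mcomp_linear_r g).

(* The category of pairs (x, d) with d an endomorphism of x; morphisms are
   those commuting with the endomorphisms. *)
Section EndoCat.
Variables (k : comNzRingType) (C : linCat k).

Definition endoObj := {x : C & mor x x}.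
Definition eobj (X : endoObj) : C := projT1 X.
Definition edif (X : endoObj) : mor (eobj X) (eobj X) := projT2 X.

Section Hom.
Variables X Y : endoObj.

Definition ecommute : {pred mor (eobj X) (eobj Y)} :=
  fun f => mcomp f (edif X) == mcomp (edif Y) f.

Fact ecommute_closed : GRing.subsemimod_closed ecommute.
Proof.
split; first split.
- by apply/eqP; rewrite mcomp0l mcomp0r.
- by move=> f g /eqP fd /eqP gd; apply/eqP; rewrite mcompDl mcompDr fd gd.
- by move=> a f /eqP fd; apply/eqP; rewrite mcompZl mcompZr fd.
Qed.

HB.instance Definition _ :=
  GRing.isSubmodClosed.Build k (mor (eobj X) (eobj Y)) ecommute ecommute_closed.

Record ehom := EHom {
  ehom_val :> mor (eobj X) (eobj Y);
  ehomP : ehom_val \in ecommute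
}.

HB.instance Definition _ := [isSub for ehom_val].
HB.instance Definition _ := [Choice of ehom by <:].
HB.instance Definition _ := [SubChoice_isSubLmodule of ehom by <:].
End Hom.
Arguments ecommute : clear implicits.

Fact eidP X : idm (eobj X) \in ecommute X X.
Proof. by apply/eqP; rewrite mcomp1m mcompm1. Qed.

Fact ecompP X Y Z (g : ehom Y Z) (f : ehom X Y) :
  mcomp (g : mor _ _) (f : mor _ _) \in ecommute X Z.
Proof.
apply/eqP; rewrite -mcompA (eqP (ehomP f)) mcompA (eqP (ehomP g)).
by rewrite -mcompA.
Qed.

Definition eid X := EHom (eidP X).
Definition ecomp X Y Z (g : ehom Y Z) (f : ehom X Y) := EHom (ecompP g f).

Fact ecompA X Y Z W (h : ehom Z W) (g : ehom Y Z) (f : ehom X Y) :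
  ecomp h (ecomp g f) = ecomp (ecomp h g) f.
Proof. by apply: val_inj; exact: mcompA. Qed.
Fact ecomp1m X Y (f : ehom X Y) : ecomp (eid Y) f = f.
Proof. by apply: val_inj; exact: mcomp1m. Qed.
Fact ecompm1 X Y (f : ehom X Y) : ecomp f (eid X) = f.
Proof. by apply: val_inj; exact: mcompm1. Qed.
Fact ecomp_linear_l X Y Z (f : ehom X Y) : linear (fun g : ehom Y Z => ecomp g f).
Proof. by move=> a g g'; apply: val_inj; exact: mcomp_linear_l. Qed.
Fact ecomp_linear_r X Y Z (g : ehom Y Z) : linear (fun f : ehom X Y => ecomp g f).
Proof. by move=> a f f'; apply: val_inj; exact: mcomp_linear_r. Qed.

Definition endoCat : linCat k :=
  @LinCat k endoObj ehom eid ecomp ecompA ecomp1m ecompm1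
    ecomp_linear_l ecomp_linear_r.
End EndoCat.

Section QuotientCat.
Variables (k : comNzRingType) (C : linCat k).

Record homIdeal := HomIdeal {
  in_ideal : forall x y : C, mor x y -> Prop;
  ideal0 : forall x y, in_ideal (0 : mor x y);
  ideal_lin : forall x y a (f g : mor x y),
    in_ideal f -> in_ideal g -> in_ideal (a *: f + g);
  idealMl : forall x y z (g : mor y z) (f : mor x y),
    in_ideal f -> in_ideal (mcomp g f);
  idealMr : forall x y z (g : mor y z) (f : mor x y),
    in_ideal g -> in_ideal (mcomp g f)
}.

Variable I : homIdeal.

Section Hom.
Variables x y : C.

Definition ideal_pred : {pred mor x y} := fun f => `[< in_ideal I f >].

Fact ideal_pred_closed : zmod_closed ideal_pred.
Proof.
split; first exact/asboolP/ideal0.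
move=> f g /asboolP fI /asboolP gI; apply/asboolP.
by rewrite addrC -scaleN1r; exact: ideal_lin.
Qed.

HB.instance Definition _ :=
  GRing.isZmodClosed.Build (mor x y) ideal_pred ideal_pred_closed.

Definition qhom := {ideal_quot ideal_pred}.

HB.instance Definition _ := GRing.Zmodule.on qhom.
HB.instance Definition _ := EqQuotient.on qhom.

Definition qpi (f : mor x y) : qhom := (\pi_qhom f)%qT.

Lemma qpiP f g : qpi f = qpi g <-> in_ideal I (f - g).
Proof.
rewrite /qpi; split=> [/eqmodP|fg].
  by rewrite /= /Quotient.equiv => /asboolP.
by apply/eqmodP; rewrite /= /Quotient.equiv; exact/asboolP.
Qed.

Lemma qpi_surj (q : qhom) : exists f, q = qpi f.
Proof. by exists (repr q)%qT; rewrite /qpi reprK. Qed.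

Lemma qpiD f g : qpi (f + g) = qpi f + qpi g.
Proof. exact: (Quotient.pi_add (ideal_pred : zmodClosed _) f g). Qed.

Definition qscale (a : k) (q : qhom) : qhom := qpi (a *: repr q)%qT.

Lemma qpi_repr f : in_ideal I (repr (qpi f) - f)%qT.
Proof. by apply/qpiP; rewrite /qpi reprK. Qed.

Lemma qpiZ a f : qscale a (qpi f) = qpi (a *: f).
Proof.
apply/qpiP; rewrite -scalerBr -[_ *: _]addr0.
by apply: ideal_lin (ideal0 _ _ _); exact: qpi_repr.
Qed.

Fact qscaleA a b q : qscale a (qscale b q) = qscale (a * b) q.
Proof. by have [f ->] := qpi_surj q; rewrite !qpiZ scalerA. Qed.
Fact qscale1 : left_id 1 qscale.
Proof. by move=> q; have [f ->] := qpi_surj q; rewrite qpiZ scale1r. Qed.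
Fact qscaleDr : right_distributive qscale +%R.
Proof.
move=> a q r; have [f ->] := qpi_surj q; have [g ->] := qpi_surj r.
by rewrite -qpiD !qpiZ scalerDr qpiD.
Qed.
Fact qscaleDl q : {morph qscale^~ q : a b / a + b}.
Proof.
by move=> a b; have [f ->] := qpi_surj q; rewrite !qpiZ scalerDl qpiD.
Qed.

HB.instance Definition _ :=
  GRing.Zmodule_isLmodule.Build k qhom qscaleA qscale1 qscaleDr qscaleDl.

End Hom.

Definition qcomp x y z (g : qhom y z) (f : qhom x y) : qhom x z :=
  qpi (mcomp (repr g) (repr f))%qT.

Lemma qpi_comp x y z (g : mor y z) (f : mor x y) :
  qcomp (qpi g) (qpi f) = qpi (mcomp g f).
Proof.
apply/qpiP; set g' := repr _; set f' := repr _.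
have -> : mcomp g' f' - mcomp g f = 1 *: mcomp g' (f' - f) + mcomp (g' - g) f.
  by rewrite scale1r mcompBr mcompBl addrA subrK.
by apply: ideal_lin; [apply: idealMl|apply: idealMr]; exact: qpi_repr.
Qed.

Fact qcompA x y z w (h : qhom z w) (g : qhom y z) (f : qhom x y) :
  qcomp h (qcomp g f) = qcomp (qcomp h g) f.
Proof.
have [h' ->] := qpi_surj h; have [g' ->] := qpi_surj g.
by have [f' ->] := qpi_surj f; rewrite !qpi_comp mcompA.
Qed.
Fact qcomp1m x y (f : qhom x y) : qcomp (qpi (idm y)) f = f.
Proof. by have [f' ->] := qpi_surj f; rewrite qpi_comp mcomp1m. Qed.
Fact qcompm1 x y (f : qhom x y) : qcomp f (qpi (idm x)) = f.
Proof. by have [f' ->] := qpi_surj f; rewrite qpi_comp mcompm1. Qed.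
Fact qcomp_linear_l x y z (f : qhom x y) : linear (fun g : qhom y z => qcomp g f).
Proof.
move=> a g h; have [f' ->] := qpi_surj f; have [g' ->] := qpi_surj g.
have [h' ->] := qpi_surj h.
by rewrite [a *: qpi _]qpiZ -qpiD !qpi_comp mcompDl mcompZl qpiD [RHS]/= -qpiZ.
Qed.
Fact qcomp_linear_r x y z (g : qhom y z) : linear (fun f : qhom x y => qcomp g f).
Proof.
move=> a f h; have [f' ->] := qpi_surj f; have [g' ->] := qpi_surj g.
have [h' ->] := qpi_surj h.
by rewrite [a *: qpi _]qpiZ -qpiD !qpi_comp mcompDr mcompZr qpiD [RHS]/= -qpiZ.
Qed.

Definition quotCat : linCat k :=
  @LinCat k C qhom (fun x => qpi (idm x)) qcomp qcompA qcomp1m qcompm1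
    qcomp_linear_l qcomp_linear_r.
End QuotientCat.

(* Finite sums of morphisms factoring through objects in Q: the ideal
   generated by the latter, and equal to the set of the latter as soon as Q is
   closed under direct sums. *)
Section FactorIdeal.
Variables (k : comNzRingType) (C : linCat k) (Q : C -> Prop).

Definition in_factor_ideal (x y : C) (f : mor x y) :=
  exists2 s : seq (mor x y),
    (forall g, g \in s -> factors_through Q g) & f = \sum_(g <- s) g.

Fact factor_ideal0 x y : in_factor_ideal (0 : mor x y).
Proof. by exists [::]; rewrite ?big_nil. Qed.

Fact factor_ideal_lin x y a (f g : mor x y) :
  in_factor_ideal f -> in_factor_ideal g -> in_factor_ideal (a *: f + g).
Proof.
move=> [s sQ ->] [r rQ ->]; exists ([seq a *: h | h <- s] ++ r).
  move=> h; rewrite mem_cat => /orP[/mapP[h' /sQ[z Qz [u [v ->]]] ->]|/rQ//].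
  by exists z => //; exists (a *: u), v; rewrite mcompZl.
by rewrite big_cat big_map scaler_sumr.
Qed.

Fact factor_idealMl x y z (g : mor y z) (f : mor x y) :
  in_factor_ideal f -> in_factor_ideal (mcomp g f).
Proof.
move=> [s sQ ->]; exists [seq mcomp g h | h <- s].
  move=> _ /mapP[h /sQ[w Qw [u [v ->]]] ->].
  by exists w => //; exists (mcomp g u), v; rewrite mcompA.
by rewrite big_map mcomp_sumr.
Qed.

Fact factor_idealMr x y z (g : mor y z) (f : mor x y) :
  in_factor_ideal g -> in_factor_ideal (mcomp g f).
Proof.
move=> [s sQ ->]; exists [seq mcomp h f | h <- s].
  move=> _ /mapP[h /sQ[w Qw [u [v ->]]] ->].
  by exists w => //; exists u, (mcomp v f); rewrite mcompA.
by rewrite big_map mcomp_suml.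
Qed.

Definition factor_ideal : homIdeal C :=
  HomIdeal factor_ideal0 factor_ideal_lin factor_idealMl factor_idealMr.
End FactorIdeal.

Section Stable.
Variables (k : comNzRingType) (C : linCat k).
Variable exact : forall x y z : C, mor x y -> mor y z -> Prop.

Definition exact_projective (p : C) :=
  forall x y z (f : mor x y) (g : mor y z), exact f g ->
  forall h : mor p z, exists h' : mor p y, mcomp g h' = h.

Definition exact_injective (i : C) :=
  forall x y z (f : mor x y) (g : mor y z), exact f g ->
  forall h : mor x i, exists h' : mor y i, mcomp h' f = h.

Definition projective_injective (p : C) :=
  exact_projective p /\ exact_injective p.

Definition stableCat : linCat k := quotCat (factor_ideal projective_injective).
End Stable.

(* Formal finite direct sums of objects of C, and matrices of morphisms; the
   (j, i) entry of a morphism goes from the i-th to the j-th summand. *)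
Section AdditiveClosure.
Variables (k : comNzRingType) (C : linCat k).

Definition addObj := {n : nat & 'I_n -> C}.
Definition asize (X : addObj) : nat := projT1 X.
Definition asummand (X : addObj) : 'I_(asize X) -> C := projT2 X.

Definition ahom (X Y : addObj) : lmodType k :=
  dprod (fun j : 'I_(asize Y) =>
    dprod (fun i : 'I_(asize X) => mor (asummand i) (asummand j))).

Definition aid (X : addObj) : ahom X X := fun j i =>
  if eqVneq i j is EqNotNeq e
  then ecast j (mor (asummand i) (asummand j)) e (idm (asummand i)) else 0.
Arguments aid : clear implicits.

Definition acomp (X Y Z : addObj) (g : ahom Y Z) (f : ahom X Y) : ahom X Z :=
  fun l i => \sum_j mcomp (g l j) (f j i).

Fact acompA X Y Z W (h : ahom Z W) (g : ahom Y Z) (f : ahom X Y) :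
  acomp h (acomp g f) = acomp (acomp h g) f.
Proof.
apply: dprodP => l; apply: dprodP => i; rewrite /acomp.
under eq_bigr do rewrite mcomp_sumr.
rewrite exchange_big; apply: eq_bigr => j _; rewrite mcomp_suml.
by apply: eq_bigr => m _; rewrite mcompA.
Qed.

Lemma aid_diag X (i : 'I_(asize X)) : aid X i i = idm (asummand i).
Proof. by rewrite /aid; case: eqVneq => [e|/eqP//]; rewrite eq_axiomK. Qed.

Lemma aid_off X (i j : 'I_(asize X)) : i != j -> aid X j i = 0.
Proof. by rewrite /aid; case: eqVneq. Qed.

Fact acomp1m X Y (f : ahom X Y) : acomp (aid Y) f = f.
Proof.
apply: dprodP => l; apply: dprodP => i; rewrite /acomp (bigD1 l) //=.
rewrite aid_diag mcomp1m big1 ?addr0 // => j jl.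
by rewrite aid_off // mcomp0l.
Qed.

Fact acompm1 X Y (f : ahom X Y) : acomp f (aid X) = f.
Proof.
apply: dprodP => l; apply: dprodP => i; rewrite /acomp (bigD1 i) //=.
rewrite aid_diag mcompm1 big1 ?addr0 // => j ji.
by rewrite aid_off 1?eq_sym // mcomp0r.
Qed.

Fact acomp_linear_l X Y Z (f : ahom X Y) : linear (fun g : ahom Y Z => acomp g f).
Proof.
move=> a g h; apply: dprodP => l; apply: dprodP => i.
rewrite [RHS]/= /acomp.
transitivity (a *: (\sum_j mcomp (g l j) (f j i)) + \sum_j mcomp (h l j) (f j i)); last by [].
rewrite scaler_sumr -big_split; apply: eq_bigr => j _.
exact: mcomp_linear_l.
Qed.

Fact acomp_linear_r X Y Z (g : ahom Y Z) : linear (fun f : ahom X Y => acomp g f).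
Proof.
move=> a f h; apply: dprodP => l; apply: dprodP => i.
transitivity (a *: (\sum_j mcomp (g l j) (f j i)) + \sum_j mcomp (g l j) (h j i)); last by [].
rewrite scaler_sumr -big_split; apply: eq_bigr => j _.
exact: mcomp_linear_r.
Qed.

Definition addCat : linCat k :=
  @LinCat k addObj ahom aid acomp acompA acomp1m acompm1
    acomp_linear_l acomp_linear_r.
End AdditiveClosure.

Section DiscreteValuationRing.
Variable R : idomainType.

(* The library's idealr_closed describes proper ideals. *)
Definition principal_ideal_domain :=
  forall I : {pred R}, idealr_closed I ->
    exists a, forall x, (x \in I) <-> exists y, x = y * a.

Definition local_ring :=
  idealr_closed ((fun x => x \isn't a GRing.unit) : {pred R}).

Definition discrete_valuation_ring :=
  [/\ principal_ideal_domain, local_ring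
    & exists2 x : R, x != 0 & x \isn't a GRing.unit].

Definition uniformizer (t : R) :=
  forall x : R, (x \isn't a GRing.unit) <-> exists y, x = y * t.

(* rho exhibits K as R / (t). *)
Definition is_residue_field (t : R) (K : fieldType) (rho : {rmorphism R -> K}) :=
  (forall c, exists x, rho x = c) /\
  (forall x, rho x = 0 <-> exists y, x = y * t).
End DiscreteValuationRing.


Section Circle.
Variable RR : realType.

Definition twopi : RR := 2 * pi.

Lemma twopi_gt0 : 0 < twopi.
Proof. by rewrite mulr_gt0 ?ltr0n ?pi_gt0. Qed.

Definition two_pi_Z : {pred RR} := fun x => x / twopi \is a Num.int.

Fact two_pi_Z_closed : zmod_closed two_pi_Z.
Proof.
split; first by rewrite unfold_in mul0r rpred0.
by move=> x y; rewrite !unfold_in mulrBl => xZ yZ; exact: rpredB.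
Qed.

HB.instance Definition _ := GRing.isZmodClosed.Build RR two_pi_Z two_pi_Z_closed.

Definition S1 := {ideal_quot two_pi_Z}.

HB.instance Definition _ := GRing.Zmodule.on S1.
HB.instance Definition _ := EqQuotient.on S1.

Definition cls (x : RR) : S1 := (\pi_S1 x)%qT.

Lemma clsP x y : cls x = cls y <-> exists n : int, x = y + twopi * n%:~R.
Proof.
have t0 : twopi != 0 by rewrite gt_eqF ?twopi_gt0.
have E : (cls x = cls y) <-> ((x - y) / twopi \is a Num.int).
  by rewrite /cls; split=> [/eqmodP//|xy]; exact/eqmodP.
rewrite E; split=> [/intrP[n nE]|[n ->]].
  by exists n; rewrite -nE mulrC divfK// addrC subrK.
by rewrite addrAC subrr add0r mulrAC divff// mul1r intr_int.
Qed.

Lemma clsD x y : cls (x + y) = cls x + cls y.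
Proof. exact: (Quotient.pi_add (two_pi_Z : zmodClosed _) x y). Qed.

Lemma clsN x : cls (- x) = - cls x.
Proof. exact: (Quotient.pi_opp (two_pi_Z : zmodClosed _) x). Qed.

Lemma cls0 : cls 0 = 0.
Proof. by apply: (addrI (cls 0)); rewrite -clsD !addr0. Qed.

Lemma clsB x y : cls (x - y) = cls x - cls y.
Proof. by rewrite clsD clsN. Qed.

Lemma cls_surj (p : S1) : exists x, p = cls x.
Proof. by exists (repr p)%qT; rewrite /cls reprK. Qed.

(* The representative of p in [0, 2 pi). *)
Definition angle (p : S1) : RR :=
  let x := (repr p)%qT in x - twopi * (Num.floor (x / twopi))%:~R.

Lemma angleK p : cls (angle p) = p.
Proof.
rewrite -[RHS](reprK p); apply/clsP.
by exists (- Num.floor ((repr p)%qT / twopi)); rewrite mulrNz mulrN.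
Qed.

Lemma angle_itv p : 0 <= angle p < twopi.
Proof.
rewrite /angle; set x := (repr p)%qT; have t0 := twopi_gt0.
have /andP[] := Num.Theory.floor_itv (x / twopi).
rewrite ler_pdivlMr // ltr_pdivrMr // => xl xu.
rewrite subr_ge0 mulrC xl /= ltrBlDr -[X in _ < X + _]mul1r -mulrDl.
by move: xu; rewrite intrD addrC.
Qed.

Lemma angle_unique p x : cls x = p -> 0 <= x < twopi -> angle p = x.
Proof.
move=> xp /andP[x0 xt]; have /andP[a0 at_] := angle_itv p; have t0 := twopi_gt0.
have /clsP[n nE] : cls (angle p) = cls x by rewrite angleK.
have n1 : (n < 1)%R.
  rewrite -(ltr_int RR) -(ltr_pM2l t0) mulr1 (le_lt_trans _ at_)//.
  by rewrite nE lerDr.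
have n2 : (-1 < n)%R.
  rewrite -(ltr_int RR) -(ltr_pM2l t0) mulrN1 ltrNl (le_lt_trans _ xt)//.
  by rewrite -subr_ge0 opprK -nE.
have n0 : n = 0 by case: n n1 n2 {nE} => [[|n]|[|n]].
by rewrite nE n0 mulr0 addr0.
Qed.

(* arrow p q indexes the structure maps V^(x, alpha) : V[x] -> V[x - alpha]
   with p = [x], q = [x - alpha] and alpha >= 0; carrying the target q avoids
   transporting along equalities between points of the circle. *)
Record arrow (p q : S1) := Arrow {
  len : RR;
  len_ge0 : 0 <= len;
  arrow_target : q = p - cls len
}.

Section ArrowAdd.
Variables (p q r : S1) (a : arrow p q) (b : arrow q r).
Fact arrow_add_ge0 : 0 <= len b + len a.
Proof. by rewrite addr_ge0 // len_ge0. Qed.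
Fact arrow_add_target : r = p - cls (len b + len a).
Proof.
rewrite clsD opprD addrA addrAC -(arrow_target a).
exact: arrow_target b.
Qed.
Definition arrow_add : arrow p r := Arrow arrow_add_ge0 arrow_add_target.
End ArrowAdd.

(* The closed interval [x, y] in the circle. *)
Definition arc (x y : RR) : set S1 := cls @` `[x, y].

End Circle.
Arguments twopi {RR}.

Section Representations.
Variables (RR : realType) (R : idomainType) (t : R).
Notation S1 := (S1 RR).

Record rep := Rep {
  fib :> S1 -> lmodType R;
  rmap : forall p q, arrow p q -> {linear fib p -> fib q};
  rmap_comp : forall p q r (a : arrow p q) (b : arrow q r) v,
    rmap b (rmap a v) = rmap (arrow_add a b) v;
  rmap_turn : forall p (a : arrow p p) (n : nat), len a = twopi * n%:R ->
    forall v, rmap a v = t ^+ n *: v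
}.
Arguments rmap : clear implicits.
Arguments rmap V [p q] a : rename.

Section Hom.
Variables V W : rep.

Definition hom_family := dprod (fun p : S1 => V p -> W p).

Definition is_rep_hom (f : hom_family) :=
  (forall p, linear (f p)) /\
  (forall p q (a : arrow p q) v, rmap W a (f p v) = f q (rmap V a v)).

Definition rep_hom_pred : {pred hom_family} := fun f => `[< is_rep_hom f >].

Fact rep_hom_closed : GRing.subsemimod_closed rep_hom_pred.
Proof.
split; first split.
- apply/asboolP; split=> [p a u v|p q a v]; first by rewrite scaler0 addr0.
  exact: linear0.
- move=> f g /asboolP[fl fn] /asboolP[gl gn]; apply/asboolP.
  split=> [p a u v|p q a v].
    transitivity (f p (a *: u + v) + g p (a *: u + v)); first by [].
    by rewrite fl gl addrACA -scalerDr.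
  transitivity (rmap W a (f p v + g p v)); first by [].
  by rewrite linearD fn gn.
- move=> a f /asboolP[fl fn]; apply/asboolP.
  split=> [p b u v|p q c v].
    transitivity (a *: f p (b *: u + v)); first by [].
    by rewrite fl scalerDr !scalerA mulrC -scalerA.
  transitivity (rmap W c (a *: f p v)); first by [].
  by rewrite linearZ_LR fn.
Qed.

HB.instance Definition _ :=
  GRing.isSubmodClosed.Build R hom_family rep_hom_pred rep_hom_closed.

Record rhom := RHom {
  rhom_val : hom_family;
  rhomP : rhom_val \in rep_hom_pred
}.

HB.instance Definition _ := [isSub for rhom_val].
HB.instance Definition _ := [Choice of rhom by <:].
HB.instance Definition _ := [SubChoice_isSubLmodule of rhom by <:].

Definition rhom_fun (f : rhom) : forall p : S1, V p -> W p := rhom_val f.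
Coercion rhom_fun : rhom >-> Funclass.

Lemma rhom_linear (f : rhom) p : linear (f p).
Proof. by have /asboolP[] := rhomP f. Qed.

Lemma rhom_natural (f : rhom) p q (a : arrow p q) v :
  rmap W a (f p v) = f q (rmap V a v).
Proof. by have /asboolP[] := rhomP f. Qed.
End Hom.

Lemma rhom_eq (V W : rep) (f g : rhom V W) : (forall p v, f p v = g p v) -> f = g.
Proof.
move=> fg; apply: val_inj; apply: dprodP => p.
by apply: functional_extensionality_dep => v; exact: fg.
Qed.

Fact rid_subproof (V : rep) : is_rep_hom ((fun p => id) : hom_family V V).
Proof. by []. Qed.
Definition rid (V : rep) : rhom V V := RHom (introT (asboolP _) (@rid_subproof V)).

Fact rcomp_subproof (U V W : rep) (g : rhom V W) (f : rhom U V) :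
  is_rep_hom ((fun p => g p \o f p) : hom_family U W).
Proof.
split=> [p a u v|p q a v] /=; first by rewrite !rhom_linear.
by rewrite !rhom_natural.
Qed.
Definition rcomp U V W (g : rhom V W) (f : rhom U V) : rhom U W :=
  RHom (introT (asboolP _) (rcomp_subproof g f)).

Fact rcompA U V W X (h : rhom W X) (g : rhom V W) (f : rhom U V) :
  rcomp h (rcomp g f) = rcomp (rcomp h g) f.
Proof. exact: rhom_eq. Qed.
Fact rcomp1m V W (f : rhom V W) : rcomp (rid W) f = f.
Proof. exact: rhom_eq. Qed.
Fact rcompm1 V W (f : rhom V W) : rcomp f (rid V) = f.
Proof. exact: rhom_eq. Qed.
Fact rcomp_linear_l U V W (f : rhom U V) : linear (fun g : rhom V W => rcomp g f).
Proof. by move=> a g h; apply: rhom_eq. Qed.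
Fact rcomp_linear_r U V W (g : rhom V W) : linear (fun f : rhom U V => rcomp g f).
Proof.
move=> a f h; apply: rhom_eq => p v.
exact: (rhom_linear g a (f p v) (h p v)).
Qed.

Definition repCat : linCat R :=
  @LinCat R rep rhom rid rcomp rcompA rcomp1m rcompm1
    rcomp_linear_l rcomp_linear_r.

Definition rep_mono V W (f : rhom V W) := forall p, injective (f p).
Definition rep_epi V W (f : rhom V W) := forall p w, exists v, f p v = w.
Definition rep_exact U V W (f : rhom U V) (g : rhom V W) :=
  forall p v, g p v = 0 <-> exists u, f p u = v.

Definition short_exact U V W (f : rhom U V) (g : rhom V W) :=
  [/\ rep_mono f, rep_exact f g & rep_epi g].

Definition rep_projective (P : rep) :=
  forall V W (g : rhom V W), rep_epi g ->
  forall h : rhom P W, exists h' : rhom P V, rcomp g h' = h.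

Section DirectSum.
Variables (n : nat) (V : 'I_n -> rep).

Definition dsum_fib (p : S1) : lmodType R := dprod (fun i => V i p).
Definition dsum_map p q (a : arrow p q) (v : dsum_fib p) : dsum_fib q :=
  fun i => rmap (V i) a (v i).
Fact dsum_map_linear p q (a : arrow p q) : linear (dsum_map a).
Proof. by move=> c u v; apply: dprodP => i; exact: linearP. Qed.
HB.instance Definition _ p q (a : arrow p q) :=
  GRing.isLinear.Build R (dsum_fib p) (dsum_fib q) _ (dsum_map a)
    (dsum_map_linear a).
Fact dsum_comp p q r (a : arrow p q) (b : arrow q r) v :
  dsum_map b (dsum_map a v) = dsum_map (arrow_add a b) v.
Proof. by apply: dprodP => i; exact: rmap_comp. Qed.
Fact dsum_turn p (a : arrow p p) (m : nat) : len a = twopi * m%:R ->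
  forall v, dsum_map a v = t ^+ m *: v.
Proof. by move=> am v; apply: dprodP => i; exact: rmap_turn. Qed.
Definition dsum : rep :=
  @Rep dsum_fib (fun p q a => dsum_map a) dsum_comp dsum_turn.
End DirectSum.

(* P_[x]: the fibre over x - alpha is free on e_x^alpha, where alpha is the
   representative of x - q in [0, 2 pi); since alpha + beta = gamma + 2 pi n
   with 0 <= gamma < 2 pi, the map of length beta sends e_x^alpha to
   e_x^(alpha + beta) = t^n e_x^gamma. *)
Section FreeRep.
Variable x : S1.

Definition turns (q r : S1) (b : arrow q r) : nat :=
  Num.truncn ((angle (x - q) + len b) / twopi).

Lemma turnsE q r (b : arrow q r) :
  angle (x - q) + len b = angle (x - r) + twopi * (turns b)%:R.
Proof.
set y := _ + _.
have t0 : 0 < twopi :> RR := twopi_gt0 RR.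
have y0 : 0 <= y.
  by rewrite addr_ge0 ?len_ge0 //; case/andP: (angle_itv (x - q)).
have /Num.Theory.truncn_itv : 0 <= y / twopi by rewrite divr_ge0 // ltW.
rewrite -/(turns b) ler_pdivlMr // ltr_pdivrMr // => /andP[yl yu].
apply/eqP; rewrite -subr_eq; apply/eqP; apply/esym/angle_unique.
  have turn0 : cls (twopi * (turns b)%:R) = 0 :> S1.
    by rewrite -(cls0 RR); apply/clsP; exists (Posz (turns b)); rewrite add0r.
  by rewrite clsB turn0 subr0 clsD angleK [in RHS](arrow_target b) opprB addrCA addrC.
rewrite subr_ge0 mulrC yl /= ltrBlDr (lt_le_trans yu) //.
by rewrite -natr1 mulrDl mul1r addrC mulrC.
Qed.

Definition free_map q r (b : arrow q r) (c : R^o) : R^o := t ^+ turns b *: c.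
Fact free_map_linear q r (b : arrow q r) : linear (free_map b).
Proof. by move=> a u v; rewrite /free_map scalerDr !scalerA mulrC. Qed.
HB.instance Definition _ q r (b : arrow q r) :=
  GRing.isLinear.Build R R^o R^o _ (free_map b) (free_map_linear b).

Fact free_comp p q r (a : arrow p q) (b : arrow q r) v :
  free_map b (free_map a v) = free_map (arrow_add a b) v.
Proof.
rewrite /free_map scalerA -exprD; congr (_ ^+ _ *: _).
have t0 : twopi != 0 :> RR by rewrite gt_eqF ?twopi_gt0.
apply/eqP; rewrite -(eqr_nat RR) -(inj_eq (mulfI t0)); apply/eqP.
apply: (addrI (angle (x - r))); rewrite -turnsE natrD mulrDr addrA -turnsE.
by rewrite addrAC -turnsE /= addrA addrAC -addrA.
Qed.

Fact free_turn p (a : arrow p p) (n : nat) : len a = twopi * n%:R ->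
  forall v, free_map a v = t ^+ n *: v.
Proof.
move=> an v; congr (_ ^+ _ *: _).
have t0 : twopi != 0 :> RR by rewrite gt_eqF ?twopi_gt0.
apply/eqP; rewrite -(eqr_nat RR) -(inj_eq (mulfI t0)) -an; apply/eqP.
by apply: (addrI (angle (x - p))); rewrite -turnsE.
Qed.

Definition freeRep : rep :=
  @Rep (fun=> R^o) (fun q r b => free_map b) free_comp free_turn.

Definition freeGen : freeRep x := 1 : R^o.

(* e_x^alpha for alpha >= 0, alpha being the length of a. *)
Definition freeGenAt q (a : arrow x q) : freeRep q := rmap freeRep a freeGen.
End FreeRep.

Definition freeSum n (x : 'I_n -> S1) : rep := dsum (fun i => freeRep (x i)).

Definition finitely_generated (V : rep) :=
  exists n (x : 'I_n -> S1) (f : rhom (freeSum x) V), rep_epi f.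

(* The morphism P_[x_i] -> P_[y_j] given by the (j, i) entry of f. *)
Section Component.
Variables (m n : nat) (x : 'I_m -> S1) (y : 'I_n -> S1).

Definition sum_incl (i : 'I_m) (q : S1) (c : freeRep (x i) q) : freeSum x q :=
  fun i' => if i' == i then (c : R^o) else 0.
Definition sum_proj (j : 'I_n) (q : S1) (v : freeSum y q) : freeRep (y j) q :=
  v j.

Fact component_subproof (f : rhom (freeSum x) (freeSum y)) i j :
  is_rep_hom ((fun q c => sum_proj j (f q (sum_incl c))) :
    hom_family (freeRep (x i)) (freeRep (y j))).
Proof.
split=> [q a u v|q r b c].
  rewrite (_ : sum_incl _ = a *: sum_incl u + sum_incl v).
    by rewrite rhom_linear.
  apply: dprodP => i'.
  transitivity (a *: sum_incl u i' + sum_incl v i'); last by [].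
  by rewrite /sum_incl; case: eqP => // _; rewrite scaler0 addr0.
rewrite /sum_proj.
transitivity (rmap (freeSum y) b (f q (sum_incl c)) j); first by [].
rewrite rhom_natural; congr (f r _ j); apply: dprodP => i'.
transitivity (rmap (freeRep (x i')) b (sum_incl c i')); first by [].
by rewrite /sum_incl; case: eqP => [->//|_]; rewrite linear0.
Qed.

Definition component (f : rhom (freeSum x) (freeSum y)) j i :
    rhom (freeRep (x i)) (freeRep (y j)) :=
  RHom (introT (asboolP _) (component_subproof f i j)).
End Component.

Definition depth (x y : S1) (f : rhom (freeRep x) (freeRep y)) : \bar RR :=
  if f == 0 then +oo%E
  else (xget 0 [set alpha | exists (u : R) (a : arrow y x),
          [/\ u \is a GRing.unit, len a = alpha
            & f x (freeGen x) = u *: freeGenAt a]])%:E.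

Definition support_candidate m n (x : 'I_m -> S1) (y : 'I_n -> S1)
    (f : rhom (freeSum x) (freeSum y)) (a b : RR) :=
  exists i j, [/\ cls a = x i, cls b = y j, a <= b < a + twopi
                & depth (component f j i) = (b - a)%:E].

(* The closed interval [a, b] in the circle is a support interval of f, as
   computed from some decompositions of V and W. *)
Definition support_interval V W (f : rhom V W) (a b : RR) :=
  exists (m n : nat) (x : 'I_m -> S1) (y : 'I_n -> S1)
         (iV : rhom (freeSum x) V) (iW : rhom W (freeSum y)),
    [/\ @is_iso R repCat _ _ iV, @is_iso R repCat _ _ iW,
        support_candidate (rcomp iW (rcomp f iV)) a b
      & forall a' b', support_candidate (rcomp iW (rcomp f iV)) a' b' ->
          arc a' b' `<=` arc a b -> arc a' b' = arc a b].

Definition F_pi : linCat R := fullCat (C := endoCat repCat) (fun Vd =>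
  [/\ finitely_generated (eobj Vd), rep_projective (eobj Vd)
    & mcomp (edif Vd) (edif Vd) = t *: idm (eobj Vd)]).

Definition F_phi (phi : RR -> RR) : linCat R := fullCat (C := F_pi) (fun Vd =>
  forall a b, support_interval (edif (sval Vd)) a b ->
    exists z, arc z (phi z) `<=` arc a b).

Definition F_phi_exact (phi : RR -> RR) (X Y Z : F_phi phi)
    (f : mor X Y) (g : mor Y Z) :=
  short_exact (ehom_val f) (ehom_val g).

Definition stable_F_phi (phi : RR -> RR) : linCat R :=
  stableCat (@F_phi_exact phi).

End Representations.


Record lineHomeo (RR : realType) := LineHomeo {
  homeo_fun :> RR -> RR;
  homeo_inv : RR -> RR;
  homeo_funK : cancel homeo_fun homeo_inv;
  homeo_invK : cancel homeo_inv homeo_fun;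
  homeo_cont : continuous homeo_fun;
  homeo_inv_cont : continuous homeo_inv;
  homeo_turn : forall x, homeo_fun (x + twopi) = homeo_fun x + twopi;
  homeo_bound : forall x, x <= homeo_fun x < x + pi
}.

Section HomeoTheory.
Variables (RR : realType) (phi : lineHomeo RR).
Notation psi := (homeo_inv phi).

Lemma homeo_inv_turn x : psi (x + twopi) = psi x + twopi.
Proof.
apply: (can_inj (homeo_funK phi)).
by rewrite homeo_turn !homeo_invK.
Qed.

Lemma homeo_inv_mono x y : x <= y -> psi x <= psi y.
Proof.
have pinj : {in `]-oo, +oo[ &, injective psi}.
  by move=> u v _ _ /(can_inj (homeo_invK phi)).
have pc : {within [set` `]-oo, +oo[ : interval RR], continuous psi}.
  by apply: continuous_subspaceT => u; exact: homeo_inv_cont.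
case: (itv_continuous_inj_mono pc pinj) => H.
  by rewrite le_eqVlt => /predU1P[->//|xy]; apply/ltW/H; rewrite ?in_itv.
have t0 := twopi_gt0 RR.
have : psi (0 + twopi) < psi 0 by apply: H; rewrite ?in_itv //= add0r.
by rewrite homeo_inv_turn; move: (psi 0) => z; lra.
Qed.

Lemma homeo_inv_le x : psi x <= x.
Proof. by have /andP[+ _] := homeo_bound phi (psi x); rewrite homeo_invK. Qed.

End HomeoTheory.

Section IndC.
Variables (RR : realType) (K : fieldType) (phi : lineHomeo RR).
Notation S1 := (S1 RR).
Notation psi := (homeo_inv phi).

Record indObj := IndObj {
  pt0 : S1;
  pt1 : S1;
  indObjP : exists x0 x1, [/\ cls x0 = pt0, cls x1 = pt1 &
    x0 <= phi x0 <= x1 /\ x1 <= psi (x0 + twopi)]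
}.

Definition positive_hom (X Y : indObj) := exists x0 x1 y0 y1,
  [/\ cls x0 = pt0 X, cls x1 = pt1 X, cls y0 = pt0 Y, cls y1 = pt1 Y &
      [/\ x0 <= y0, y0 < psi x1, psi x1 <= x1, x1 <= y1
        & y1 < psi (x0 + twopi)]].

Definition negative_hom (X Y : indObj) := exists x0 x1 y0 y1,
  [/\ cls x0 = pt0 X, cls x1 = pt1 X, cls y0 = pt0 Y, cls y1 = pt1 Y &
      [/\ x0 <= y1, y1 < psi x1, psi x1 <= x1, x1 <= y0 + twopi
        & y0 + twopi < psi (x0 + twopi)]].

(* Some e if the space of morphisms X -> Y is K b_e, None if it is 0; the sign
   + is false and - is true, so that signs multiply by (+). *)
Definition hom_sign (X Y : indObj) : option bool :=
  if `[< positive_hom X Y >] then Some false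
  else if `[< negative_hom X Y >] then Some true
  else None.

(* [below x y] expresses both conditions, with y = (y0, y1) or
   y = (y1, y0 + 2 pi). *)
Definition below (x0 x1 y0 y1 : RR) :=
  [/\ x0 <= y0, y0 < psi x1, x1 <= y1 & y1 < psi (x0 + twopi)].
Definition lifts (e : bool) (X : indObj) (x0 x1 : RR) :=
  cls x0 = (if e then pt1 X else pt0 X) /\ cls x1 = (if e then pt0 X else pt1 X).
Definition linked (e : bool) (X Y : indObj) := exists x0 x1 y0 y1,
  [/\ lifts false X x0 x1, lifts e Y y0 y1 & below x0 x1 y0 y1].

Lemma cls_turn (x : RR) : cls (x + twopi) = cls x.
Proof. by apply/clsP; exists 1; rewrite mulr1. Qed.

Lemma positiveP X Y : positive_hom X Y <-> linked false X Y.
Proof.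
split=> -[x0 [x1 [y0 [y1]]]].
  by case=> ? ? ? ? [? ? ? ? ?]; exists x0, x1, y0, y1.
case=> -[? ?] [? ?] [? ? ? ?]; exists x0, x1, y0, y1; split=> //; split=> //.
exact: homeo_inv_le.
Qed.

Lemma negativeP X Y : negative_hom X Y <-> linked true X Y.
Proof.
split=> -[x0 [x1 [y0 [y1]]]].
  case=> ? ? ? ? [? ? ? ? ?]; exists x0, x1, y1, (y0 + twopi); split=> //.
  by split=> //; rewrite cls_turn.
case=> -[? ?] [/= Y0 Y1] [? ? ? ?]; exists x0, x1, (y1 - twopi), y0.
by rewrite -[X in [/\ _, _, X = _, _ & _]]cls_turn subrK; split=> //; split=> //;
  exact: homeo_inv_le.
Qed.

Lemma below_lt x0 x1 y0 y1 : below x0 x1 y0 y1 ->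
  [/\ x0 < x1, x1 < x0 + twopi, y0 < y1 & y1 < y0 + twopi].
Proof.
case=> h1 h2 h3 h4; have := homeo_inv_le phi x1.
have := homeo_inv_le phi (x0 + twopi); split; lra.
Qed.

Lemma below_swap x0 x1 y0 y1 :
  below x0 x1 y0 y1 -> below x1 (x0 + twopi) y1 (y0 + twopi).
Proof.
case=> h1 h2 h3 h4; split=> //; first by lra.
by rewrite homeo_inv_turn; lra.
Qed.

Lemma psi_shift (x : RR) (n : int) : psi (x + twopi * n%:~R) = psi x + twopi * n%:~R.
Proof.
have N (m : nat) y : psi (y + twopi * m%:R) = psi y + twopi * m%:R.
  elim: m => [|m IH]; first by rewrite mulr0 !addr0.
  by rewrite -natr1 mulrDr mulr1 !addrA homeo_inv_turn IH.
case: n => n; first exact: N.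
rewrite NegzE mulrNz mulrN; apply: (addIr (twopi * n.+1%:R)).
by rewrite -N !subrK.
Qed.

Lemma below_shift (n : int) x0 x1 y0 y1 : below x0 x1 y0 y1 ->
  below (x0 + twopi * n%:~R) (x1 + twopi * n%:~R)
        (y0 + twopi * n%:~R) (y1 + twopi * n%:~R).
Proof.
case=> h1 h2 h3 h4; split; rewrite ?lerD2r ?psi_shift ?ltrD2r //.
by rewrite addrAC psi_shift ltrD2r.
Qed.

Lemma cls_shift (n : int) (x : RR) : cls (x + twopi * n%:~R) = cls x.
Proof. by apply/clsP; exists n. Qed.

Lemma int_between (n : int) : -1 < n%:~R :> RR -> n%:~R < 1 :> RR -> n = 0.
Proof.
rewrite -[1]/(1%:~R) -mulrNz !ltr_int.
by case: n => [[|n]|[|n]].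
Qed.

Lemma lifts_shift e X x0 x1 x0' x1' : lifts e X x0 x1 -> lifts e X x0' x1' ->
  x0 < x1 -> x1 < x0 + twopi -> x0' < x1' -> x1' < x0' + twopi ->
  exists n : int, x0' = x0 + twopi * n%:~R /\ x1' = x1 + twopi * n%:~R.
Proof.
move=> [e0 e1] [e0' e1'] h1 h2 h3 h4; have t0 := twopi_gt0 RR.
have /clsP[m mE] : cls x0' = cls x0 by rewrite e0 e0'.
have /clsP[n nE] : cls x1' = cls x1 by rewrite e1 e1'.
exists m; split=> //; rewrite nE; congr (_ + _ * _%:~R).
apply/eqP; rewrite -subr_eq0; apply/eqP.
apply: int_between; rewrite -(ltr_pM2l t0) rmorphB /= mulrBr ?mulrN ?mulr1.
  by move: h1 h2 h3 h4; rewrite mE nE; lra.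
by move: h1 h2 h3 h4; rewrite mE nE; lra.
Qed.

(* A link can be based at any lift of its source. *)
Lemma linked_from d e X Y x0 x1 : linked e X Y -> lifts d X x0 x1 ->
  x0 < x1 -> x1 < x0 + twopi ->
  exists y0 y1, lifts (d (+) e) Y y0 y1 /\ below x0 x1 y0 y1.
Proof.
move=> [u0 [u1 [v0 [v1 [Xu Yv uv]]]]] Xx h1 h2.
have [w0 [w1 [z0 [z1 [Xw Yz wz]]]]] : exists w0 w1 z0 z1,
    [/\ lifts d X w0 w1, lifts (d (+) e) Y z0 z1 & below w0 w1 z0 z1].
  case: d Xx => Xx; last by exists u0, u1, v0, v1.
  exists u1, (u0 + twopi), v1, (v0 + twopi); split; last exact: below_swap.
    by case: Xu => ? ?; split; rewrite ?cls_turn.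
  by case: Yv; case: (e) => ? ?; split; rewrite ?cls_turn.
have [a1 a2 _ _] := below_lt wz.
have [n [-> ->]] := lifts_shift Xw Xx a1 a2 h1 h2.
exists (z0 + twopi * n%:~R), (z1 + twopi * n%:~R); split.
  by case: Yz => ? ?; split; rewrite cls_shift.
exact: below_shift.
Qed.

Lemma linked_chain e X Z x0 x1 y0 y1 z0 z1 :
  linked e X Z -> lifts false X x0 x1 -> lifts e Z z0 z1 ->
  below x0 x1 y0 y1 -> below y0 y1 z0 z1 -> below x0 x1 z0 z1.
Proof.
move=> XZ Xx Zz xy yz.
have [a1 a2 a3 a4] := below_lt xy; have [_ _ b3 b4] := below_lt yz.
have [w0 [w1 [Zw xw]]] := linked_from XZ Xx a1 a2.
have [_ _ c3 c4] := below_lt xw.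
have [n [n0 n1]] := lifts_shift Zw Zz c3 c4 b3 b4.
have t0 := twopi_gt0 RR.
have q0 := homeo_inv_le phi x1; have q1 := homeo_inv_le phi y1.
have q2 := homeo_inv_le phi (x0 + twopi).
case: (xy) (yz) (xw) => p1 p2 p3 p4 [r1 r2 r3 r4] [s1 s2 s3 s4].
suff nz : n = 0 by rewrite n0 n1 nz !mulr0 !addr0.
apply: int_between; rewrite -(ltr_pM2l t0) ?mulrN1 ?mulr1; lra.
Qed.

Lemma linked_excl X Y : linked false X Y -> linked true X Y -> False.
Proof.
move=> [x0 [x1 [y0 [y1 [Xx Yy xy]]]]] XY.
have [a1 a2 a3 a4] := below_lt xy.
have [w0 [w1 [Yw xw]]] := linked_from XY Xx a1 a2.
have [_ _ c3 c4] := below_lt xw; have t0 := twopi_gt0 RR.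
case: (Yy) (Yw) => y0E _ [_ w1E].
have /clsP[n nE] : cls w1 = cls y0 by rewrite w1E y0E.
case: (xy) (xw) => p1 p2 p3 p4 [r1 r2 r3 r4].
have q0 := homeo_inv_le phi x1.
have q2 := homeo_inv_le phi (x0 + twopi).
have n0 : n = 0.
  by apply: int_between; rewrite -(ltr_pM2l t0) ?mulrN1 ?mulr1; lra.
by move: nE; rewrite n0 mulr0; lra.
Qed.

Lemma hom_signP X Y e : hom_sign X Y = Some e <-> linked e X Y.
Proof.
rewrite /hom_sign; case: asboolP => [/positiveP p|np].
  by case: e; split=> // n; case: (linked_excl p n).
case: asboolP => [/negativeP n|nn].
  by case: e; split=> // /positiveP.
by case: e; split=> //; [move/negativeP|move/positiveP].
Qed.

Lemma hom_sign_plus X Y : hom_sign X Y = Some false <-> positive_hom X Y.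
Proof. by rewrite hom_signP positiveP. Qed.

Lemma hom_sign_minus X Y : hom_sign X Y = Some true <-> negative_hom X Y.
Proof. by rewrite hom_signP negativeP. Qed.

Lemma hom_sign_id X Y e : hom_sign X Y = Some e ->
  hom_sign X X = Some false /\ hom_sign Y Y = Some false.
Proof.
move=> /hom_signP[x0 [x1 [y0 [y1 [Xx Yy xy]]]]].
have t0 := twopi_gt0 RR.
case: (xy) => p1 p2 p3 p4.
have m1 := homeo_inv_mono phi p3.
have m2 : psi (x0 + twopi) <= psi (y0 + twopi).
  by apply: homeo_inv_mono; rewrite lerD2r.
split; apply/hom_signP.
  by exists x0, x1, x0, x1; split=> //; split=> //; lra.
have yy : below y0 y1 y0 y1 by split=> //; lra.
case: e Yy => -[c0 c1]; last by exists y0, y1, y0, y1.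
have := below_shift (-1) (below_swap yy); rewrite mulrN1z mulrN1.
move=> yy'; exists (y1 - twopi), (y0 + twopi - twopi).
exists (y1 - twopi), (y0 + twopi - twopi); split=> //.
  by split; rewrite ?addrK // -c1 -(cls_turn (y1 - twopi)) subrK.
by split; rewrite ?addrK // -c1 -(cls_turn (y1 - twopi)) subrK.
Qed.

Lemma hom_sign_assoc X Y Z W e1 e2 e3 :
  hom_sign X Y = Some e1 -> hom_sign Y Z = Some e2 -> hom_sign Z W = Some e3 ->
  hom_sign X W = Some (e1 (+) e2 (+) e3) ->
  (hom_sign X Z == Some (e1 (+) e2)) = (hom_sign Y W == Some (e2 (+) e3)).
Proof.
move=> /hom_signP[x0 [x1 [y0 [y1 [Xx Yy xy]]]]] /hom_signP YZ /hom_signP ZW.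
move=> /hom_signP XW.
have [_ _ a3 a4] := below_lt xy.
have [z0 [z1 [Zz yz]]] := linked_from YZ Yy a3 a4.
have [_ _ b3 b4] := below_lt yz.
have [w0 [w1 [Ww zw]]] := linked_from ZW Zz b3 b4.
case: (xy) (yz) (zw) => p1 p2 p3 p4 [q1 q2 q3 q4] [r1 r2 r3 r4].
have my1 := homeo_inv_mono phi p3.
have my0 : psi (x0 + twopi) <= psi (y0 + twopi).
  by apply: homeo_inv_mono; rewrite lerD2r.
apply/eqP/eqP => /hom_signP H; apply/hom_signP.
- have xz := linked_chain H Xx Zz xy yz.
  have [s1 s2 s3 s4] := linked_chain XW Xx Ww xz zw.
  have yw : below y0 y1 w0 w1 by split; lra.
  case: e1 {XW H} Yy Zz Ww => Yy Zz Ww; last by exists y0, y1, w0, w1.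
  have := below_shift (-1) (below_swap yw); rewrite mulrN1z mulrN1.
  move=> yw'; exists (y1 - twopi), (y0 + twopi - twopi).
  exists (w1 - twopi), (w0 + twopi - twopi); split=> //.
    case: Yy => c0 c1.
    by split; rewrite ?addrK // -c1 -(cls_turn (y1 - twopi)) subrK.
  case: Ww => c0 c1.
  have wE : cls (w1 - twopi) = cls w1 by rewrite -(cls_turn (w1 - twopi)) subrK.
  rewrite /lifts addrK wE c0 c1 {c0 c1}.
  by case: e2 e3 {YZ ZW Zz} => [] [].
- have yw : below y0 y1 w0 w1.
    have [v0 [v1 [Wv yv]]] := linked_from H Yy a3 a4.
    have [_ _ c3 c4] := below_lt yv; have [_ _ d3 d4] := below_lt zw.
    rewrite addbA in Wv.
    have [n [n0 n1]] := lifts_shift Wv Ww c3 c4 d3 d4.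
    have t0 := twopi_gt0 RR.
    have k0 := homeo_inv_le phi y1; have k1 := homeo_inv_le phi z1.
    have k2 := homeo_inv_le phi (y0 + twopi).
    case: (yv) => v1' v2 v3 v4.
    suff nz : n = 0 by rewrite n0 n1 nz !mulr0 !addr0.
    by apply: int_between; rewrite -(ltr_pM2l t0) ?mulrN1 ?mulr1; lra.
  have [s1 s2 s3 s4] := linked_chain XW Xx Ww xy yw.
  exists x0, x1, z0, z1; split=> //; split; lra.
Qed.

(* A morphism X -> Y is its coordinate on b_e when the space of morphisms is
   K b_e, and 0 otherwise. *)
Section Hom.
Variables X Y : indObj.

Definition ind_pred : {pred K^o} := fun c => (hom_sign X Y == None) ==> (c == 0).

Fact ind_pred_closed : GRing.subsemimod_closed ind_pred.
Proof.
split; first split.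
- exact/implyP.
- move=> a b; rewrite !unfold_in; case: eqP => //= _ /eqP-> /eqP->.
  by rewrite addr0.
- move=> a b; rewrite !unfold_in; case: eqP => //= _ /eqP->.
  by rewrite scaler0.
Qed.

HB.instance Definition _ :=
  GRing.isSubmodClosed.Build K K^o ind_pred ind_pred_closed.

Record indHom := IndHom {
  coef : K^o;
  coefP : coef \in ind_pred
}.

HB.instance Definition _ := [isSub for coef].
HB.instance Definition _ := [Choice of indHom by <:].
HB.instance Definition _ := [SubChoice_isSubLmodule of indHom by <:].

Lemma coef_eq0 (f : indHom) : hom_sign X Y = None -> coef f = 0.
Proof.
by move=> XY; have := coefP f; rewrite unfold_in XY eqxx => /eqP.
Qed.
End Hom.
Arguments ind_pred : clear implicits.

Definition signs_compose (X Y Z : indObj) : bool :=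
  if (hom_sign X Y, hom_sign Y Z) is (Some e1, Some e2)
  then hom_sign X Z == Some (e1 (+) e2) else false.

Fact ind_comp_subproof X Y Z (g : indHom Y Z) (f : indHom X Y) :
  (if signs_compose X Y Z then (coef g : K) * coef f else 0) \in ind_pred X Z.
Proof.
rewrite unfold_in /signs_compose; case: eqP => //= ->.
by case: (hom_sign X Y) => [?|]; case: (hom_sign Y Z).
Qed.

Definition ind_comp X Y Z (g : indHom Y Z) (f : indHom X Y) : indHom X Z :=
  IndHom (ind_comp_subproof g f).

(* The identity is b_+ when it exists; otherwise X is a zero object. *)
Fact ind_id_subproof X :
  (if hom_sign X X == None then 0 else 1 : K^o) \in ind_pred X X.
Proof. by rewrite unfold_in; case: eqP => //= _. Qed.

Definition ind_id X : indHom X X := IndHom (ind_id_subproof X).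

Fact ind_compA X Y Z W (h : indHom Z W) (g : indHom Y Z) (f : indHom X Y) :
  ind_comp h (ind_comp g f) = ind_comp (ind_comp h g) f.
Proof.
apply: val_inj => /=; rewrite /signs_compose.
case XY: (hom_sign X Y) => [e1|] /=; last by rewrite mulr0 if_same.
case YZ: (hom_sign Y Z) => [e2|] /=; last first.
  by rewrite mul0r mulr0 !if_same.
case ZW: (hom_sign Z W) => [e3|] /=; last first.
  by rewrite mul0r if_same; case: (hom_sign X Z).
transitivity (if (hom_sign X Z == Some (e1 (+) e2)) &&
    (hom_sign X W == Some (e1 (+) e2 (+) e3)) then (coef h : K) * coef g * coef f else 0).
  case: eqP => [->|_]; last by rewrite mulr0 if_same.
  by rewrite mulrA.
transitivity (if (hom_sign Y W == Some (e2 (+) e3)) &&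
    (hom_sign X W == Some (e1 (+) e2 (+) e3)) then (coef h : K) * coef g * coef f else 0).
  case: (eqVneq (hom_sign X W)) => [XW|_]; last by rewrite !andbF.
  by rewrite (hom_sign_assoc XY YZ ZW XW).
case: eqP => [->|_]; last by rewrite mul0r if_same.
by rewrite addbA.
Qed.

Fact ind_comp1m X Y (f : indHom X Y) : ind_comp (ind_id Y) f = f.
Proof.
apply: val_inj => /=; rewrite /signs_compose.
case XY: (hom_sign X Y) => [e|]; last by rewrite (coef_eq0 f XY).
by have [_ ->] := hom_sign_id XY; rewrite addbF eqxx mul1r.
Qed.

Fact ind_compm1 X Y (f : indHom X Y) : ind_comp f (ind_id X) = f.
Proof.
apply: val_inj => /=; rewrite /signs_compose.
case XY: (hom_sign X Y) => [e|]; last first.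
  by rewrite (coef_eq0 f XY); case: (hom_sign X X).
by have [-> _] := hom_sign_id XY; rewrite addFb eqxx mulr1.
Qed.

Fact ind_comp_linear_l X Y Z (f : indHom X Y) :
  linear (fun g : indHom Y Z => ind_comp g f).
Proof.
move=> a g h; apply: val_inj => /=; case: signs_compose.
  by rewrite mulrDl -[X in X + _]mulrA.
by rewrite scaler0 addr0.
Qed.

Fact ind_comp_linear_r X Y Z (g : indHom Y Z) :
  linear (fun f : indHom X Y => ind_comp g f).
Proof.
move=> a f h; apply: val_inj => /=; case: signs_compose.
  by rewrite mulrDr [X in X + _]mulrCA.
by rewrite scaler0 addr0.
Qed.

Definition indCat : linCat K :=
  @LinCat K indObj indHom ind_id ind_comp ind_compA ind_comp1m ind_compm1
    ind_comp_linear_l ind_comp_linear_r.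

Definition C_phi : linCat K := addCat indCat.

End IndC.

(* Main.v *)
Require Import Defs.
From HB Require Import structures.
From mathcomp Require Import all_boot all_order all_algebra.
From mathcomp Require Import all_classical all_reals all_analysis.
From mathcomp Require Import lra ring.

Set Implicit Arguments.
Unset Strict Implicit.
Unset Printing Implicit Defensive.

Import Order.TTheory GRing.Theory Num.Theory numFieldNormedType.Exports.

Local Open Scope classical_set_scope.
Local Open Scope ring_scope.

(** The finitely generated projectives form the additive category on the P_[p],
    where Hom(P_[p], P_[q]) is free of rank one on the slide of least depth;
    slides compose by adding depths, and a full turn is multiplication by t.

    The argument rests on three observations.

    First, the condition on support intervals can be stated without bases:
    (V, d) lies in F_phi exactly when d maps every V[x] into the image of
    V[phi x] -> V[x] (phi_deep_support, support_phi_deep). In one direction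
    this uses that V is a sum of P_[p] (dual_basis_free), since support
    intervals are defined by decompositions.

    Secondly, let E(x, y) be P_[x] + P_[y], with d sliding e_x to e_y and e_y
    on to e_x, once around the circle. If y = phi x, then a morphism
    E(x, y) -> (V, d) is the same as an element v of V[x], because d v has a
    unique preimage in V[phi x]; and a morphism (V, d) -> E(x, y) is the same
    as a morphism V -> P_[y]. As exact sequences split in the category of
    projectives, E(x, phi x) is projective and injective (hull_projinj), and
    sums of such objects cover every object (hull_cover). So the morphisms
    that vanish stably are those that factor through a sum of E(x, phi x).

    The same remark decomposes objects: let m be the least depth of an entry
    of d with unit coefficient. Then d is also deep for the map x |-> x + m
    in the place of phi, so some E(x, x + m) splits off (nonzero_split), and
    finitely many steps exhaust (V, d) (decomposition).

    Thirdly, a morphism E(X) -> E(Y) is a sum of an even and an odd part, and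
    commuting with d forces the two components of each part to be the same
    multiple c of two slides (entry_pair). In terms of real lifts with
    x0 <= y0 and x1 <= y1, such a part factors through some E(z, phi z) as
    soon as phi y0 >= x1 or phi y1 >= x0 + 2 pi (stably_zero_first,
    stably_zero_second); a multiple of t turns once more and therefore does
    too. What survives is the residue class of c in K, in the range that
    defines the morphisms of C_phi. These residues multiply according to the
    rule for the b_+ and b_- (link_coeff_comp), they vanish on morphisms that
    factor through E(z, phi z) because that object of C_phi is zero
    (hull_zero), and their vanishing suffices (link_coeff_stably_zero). Hence
    the matrices of residues identify the stable morphisms between sums of
    E(X) with the morphisms of C_phi, and the decomposition of objects turns
    this into an equivalence. *)

Arguments mcomp : simpl never.
Arguments idm : simpl never.
Arguments mor : simpl never.

Notation "g ** f" := (mcomp g f) (at level 40, left associativity).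


(** * The valuation of R *)

Section Valuation.
Variables (R : idomainType) (t : R).
Hypothesis R_dvr : discrete_valuation_ring R.
Hypothesis t_unif : uniformizer t.

Lemma unif_neq0 : t != 0.
Proof.
case: R_dvr => _ _ [x x0 /t_unif[y xE]].
by apply: contraNneq x0 => tE; rewrite xE tE mulr0.
Qed.

Lemma unif_nonunit : t \isn't a GRing.unit.
Proof. by apply/t_unif; exists 1; rewrite mul1r. Qed.

Lemma unitVdvd (c : R) : c \is a GRing.unit \/ exists y, c = y * t.
Proof. by case: (boolP (c \is a GRing.unit)) => [|/t_unif]; [left|right]. Qed.

(** If c were nonzero, the quotients c / t^n would generate an increasing chain of
    proper ideals; its union is principal, so the chain stops, which would make
    t invertible. *)
Lemma dvd_exp_eq0 (c : R) : (forall n, exists y, c = y * t ^+ n) -> c = 0.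
Proof.
move=> cn; apply/eqP/negP => /negP c0; have t0 := unif_neq0.
have [g gE] := choice cn.
have gS n : g n = g n.+1 * t.
  by apply: (mulIf (expf_neq0 n t0)); rewrite -gE -mulrA -exprS -gE.
have gnu n : g n \isn't a GRing.unit by apply/t_unif; exists (g n.+1).
(* The union of the ideals generated by the c / t^n. *)
pose I : {pred R} := fun x => `[< exists n y, x = y * g n >].
have gmono m n : exists y, g m = y * g (m + n)%N.
  elim: n => [|n [y IH]]; first by exists 1; rewrite addn0 mul1r.
  by exists (y * t); rewrite IH gS addnS -mulrA [t * _]mulrC.
have Iid : idealr_closed I.
  split.
  - by apply/asboolP; exists 0%N, 0; rewrite mul0r.
  - apply/asboolP => -[n [y yE]]; move/negP: (gnu n); apply.
    by apply/unitrPr; exists y; rewrite mulrC.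
  - move=> a x y /asboolP[m [u ->]] /asboolP[n [v ->]]; apply/asboolP.
    have [z zE] := gmono m n; have [w wE] := gmono n m.
    exists (m + n)%N, (a * u * z + v * w).
    by rewrite zE wE [(n + m)%N]addnC mulrDl !mulrA.
case: R_dvr => /(_ I Iid)[a aE] _ _.
have /asboolP[n [y ay]] : a \in I by apply/aE; exists 1; rewrite mul1r.
have /aE[z zE] : g n.+1 \in I by apply/asboolP; exists n.+1, 1; rewrite mul1r.
have gn0 : g n.+1 != 0 by apply: contraNneq c0 => g0; rewrite (gE n.+1) g0 mul0r.
have : 1 = z * y * t.
  by apply: (mulIf gn0); rewrite mul1r {1}zE ay gS; ring.
move=> E; move/negP: unif_nonunit; apply.
by apply/unitrPr; exists (z * y); rewrite mulrC.
Qed.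

Lemma unit_times_exp (c : R) : c != 0 ->
  exists (u : R) n, u \is a GRing.unit /\ c = u * t ^+ n.
Proof.
move=> c0; have [n nc] : exists n, ~ exists y, c = y * t ^+ n.
  by apply: contrapT => /forallNP H; move/eqP: c0; apply; apply: dvd_exp_eq0 => n;
    apply: contrapT; apply: H.
elim: n nc => [|n IH] nc; first by case: nc; exists c; rewrite mulr1.
have [[y yE]|] := pselect (exists y, c = y * t ^+ n); last exact: IH.
exists y, n; split=> //; case: (unitVdvd y) => // -[z zE]; case: nc; exists z.
by rewrite yE zE exprS mulrA.
Qed.

End Valuation.

(** * Morphisms between the representations P_[p] *)

Section FreeReps.
Variables (RR : realType) (R : idomainType) (t : R).
Notation S1 := (S1 RR).
Notation rC := (repCat RR t).
Notation P := (freeRep t : S1 -> rC).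
Notation hom := (@mor R rC).
Notation tau := (@twopi RR).

Lemma angle_self (p : S1) : angle (p - p) = 0.
Proof. by rewrite (subrr p); apply: angle_unique; rewrite ?cls0 // lexx twopi_gt0. Qed.

Fact arrow_to_target (p q : S1) : q = p - cls (angle (p - q)).
Proof. by rewrite angleK opprB addrC subrK. Qed.
Fact arrow_to_ge0 (p q : S1) : 0 <= angle (p - q).
Proof. by case/andP: (angle_itv (p - q)). Qed.
Definition arrow_to p q : arrow p q := Arrow (arrow_to_ge0 p q) (arrow_to_target p q).

Lemma arrow_eq (p q : S1) (a b : arrow p q) : len a = len b -> a = b.
Proof.
case: a b => [l l0 lE] [m m0 mE] /= E.
by case: _ / E in m0 mE *; congr Arrow; exact: Prop_irrelevance.
Qed.

(** A structure map depends on its length only, and a full turn is multiplication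
    by t. *)
Lemma rmap_turns (V : rC) (p q : S1) (a : arrow p q) n v :
  len a = angle (p - q) + tau * n%:R ->
  rmap V a v = t ^+ n *: rmap V (arrow_to p q) v.
Proof.
move=> aE.
have h0 : 0 <= tau * n%:R by rewrite mulr_ge0 // ltW // twopi_gt0.
have hE : q = q - cls (tau * n%:R).
  have -> : cls (tau * n%:R) = 0 by rewrite -cls0; apply/clsP; exists n; rewrite add0r.
  by rewrite subr0.
rewrite -(@rmap_turn _ _ _ V q (Arrow h0 hE)) // rmap_comp.
by congr (rmap V _ v); apply: arrow_eq => /=; rewrite aE addrC.
Qed.

Lemma rmap0 (V : rC) (p : S1) (a : arrow p p) v : len a = 0 -> rmap V a v = v.
Proof. by move=> a0; rewrite (@rmap_turn _ _ _ V p a 0) ?scale1r // mulr0. Qed.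

Lemma rhomD (V W : rep RR t) (h : rhom V W) q (u v : V q) : h q (u + v) = h q u + h q v.
Proof. by have := rhom_linear h 1 u v; rewrite !scale1r. Qed.

Lemma rhom0 (V W : rep RR t) (h : rhom V W) q : h q 0 = 0.
Proof. by apply: (addrI (h q 0)); rewrite -rhomD !addr0. Qed.

Lemma rhomZ (V W : rep RR t) (h : rhom V W) q a (u : V q) : h q (a *: u) = a *: h q u.
Proof. by have := rhom_linear h a u 0; rewrite rhom0 !addr0. Qed.

Fact yoneda_subproof (V : rC) p (v : V p) : is_rep_hom
  ((fun q (c : R^o) => c *: rmap V (arrow_to p q) v) : hom_family (P p) V).
Proof.
split=> [q a x y|q r b c] /=; first by rewrite scalerDl scalerA.
rewrite linearZ_LR rmap_comp (@rmap_turns V p r _ (turns p b)); last first.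
  by rewrite /= addrC turnsE.
by rewrite scalerA /free_map /= mulrC.
Qed.

(** Elements of V[p] are morphisms P_[p] -> V. This turns all statements about
    elements and structure maps into statements about composition. *)
Definition yoneda (V : rC) p (v : V p) : hom (P p) V :=
  RHom (introT (asboolP _) (yoneda_subproof v)).

Lemma yoneda_gen (V : rC) p (v : V p) : yoneda v p (freeGen t p) = v.
Proof.
by rewrite /= /freeGen scale1r; apply: rmap0; exact: angle_self.
Qed.

Lemma gen_span (p q : S1) (c : P p q) :
  c = (c : R^o) *: rmap (P p) (arrow_to p q) (freeGen t p).
Proof.
rewrite /= /free_map /freeGen (_ : turns _ _ = 0%N) ?scale1r ?[_ *: _]mulr1 //.
have := turnsE p (arrow_to p q).
rewrite /= angle_self add0r => E.
have /eqP : tau * (turns p (arrow_to p q))%:R = 0 by move: E; lra.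
by rewrite mulf_eq0 gt_eqF ?twopi_gt0 //= pnatr_eq0 => /eqP.
Qed.

Lemma hom_gen_eq (V : rC) p (f g : hom (P p) V) :
  f p (freeGen t p) = g p (freeGen t p) -> f = g.
Proof.
move=> fg; apply: rhom_eq => q c; rewrite (gen_span c).
have nat (h : rhom (P p) V) a : h q (a *: rmap (P p) (arrow_to p q) (freeGen t p)) =
    a *: rmap V (arrow_to p q) (h p (freeGen t p)).
  by rewrite rhomZ rhom_natural.
by rewrite (nat f) (nat g) fg.
Qed.

Definition coeff p q (f : hom (P p) (P q)) : R := f p (freeGen t p).

Lemma coeff_inj p q : injective (@coeff p q).
Proof. by move=> f g; exact: (@hom_gen_eq (P q) p f g). Qed.

(** The morphism e_p |-> e_q^alpha with the least possible alpha, a basis of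
    Hom(P_[p], P_[q]). *)
Definition base p q : hom (P p) (P q) := yoneda (1 : P q p).

Fact opaque_key : unit. Proof. exact: tt. Qed.
(** The morphism e_p |-> e_q^l, when l is a possible depth. It is locked because
    otherwise unification would see the multiple of a basis element in it. *)
Definition slide p q (l : RR) : hom (P p) (P q) :=
  locked_with opaque_key (t ^+ Num.truncn (l / tau) *: base p q).

Lemma coeffZ p q a (f : hom (P p) (P q)) : coeff (a *: f) = a * coeff f.
Proof. by []. Qed.
Lemma coeffD p q (f g : hom (P p) (P q)) : coeff (f + g) = coeff f + coeff g.
Proof. by []. Qed.
Lemma coeff0 p q : coeff (0 : hom (P p) (P q)) = 0.
Proof. by []. Qed.
Lemma coeff_sum p q (I : Type) (r : seq I) (A : pred I) (F : I -> hom (P p) (P q)) :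
  coeff (\sum_(i <- r | A i) F i) = \sum_(i <- r | A i) coeff (F i).
Proof. by elim/big_rec2: _ => // i y z _ <-. Qed.

Lemma coeff_base p q : coeff (base p q) = 1.
Proof. exact: (@yoneda_gen (P q) p (1 : R^o)). Qed.

Lemma coeff_id p : coeff (idm (P p)) = 1.
Proof. by []. Qed.

Lemma hom_base p q (f : hom (P p) (P q)) : f = coeff f *: base p q.
Proof. by apply: coeff_inj; rewrite coeffZ coeff_base mulr1. Qed.

(** The exponent of t in the composite of two basis elements: 1 if their depths
    add up to at least a full turn, and 0 otherwise. *)
Definition carry (p q r : S1) := turns r (arrow_to q p).

Lemma carryE p q r :
  angle (q - p) + angle (r - q) = angle (r - p) + tau * (carry p q r)%:R.
Proof. by have := turnsE r (arrow_to q p); rewrite /= addrC. Qed.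

Lemma coeff_comp p q r (g : hom (P q) (P r)) (f : hom (P p) (P q)) :
  coeff (g ** f) = t ^+ carry p q r * (coeff g * coeff f).
Proof.
have E : g p (f p (freeGen t p)) =
    (coeff f : R) *: rmap (P r) (arrow_to q p) (g q (freeGen t q)).
  by rewrite rhom_natural -rhomZ; congr (g p _); exact: gen_span.
rewrite [LHS]E.
transitivity ((coeff f : R) * (t ^+ carry p q r * coeff g)); first by [].
by rewrite mulrCA [coeff f * _]mulrC.
Qed.

(** The possible depths of morphisms P_[p] -> P_[q]: the lengths of the positively
    oriented paths from p to q. *)
Definition is_depth (p q : S1) (l : RR) := 0 <= l /\ cls l = q - p.

Lemma is_depth_angle p q : is_depth p q (angle (q - p)).
Proof. by split; [case/andP: (angle_itv (q - p))|exact: angleK]. Qed.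

Lemma is_depth_self p : is_depth p p 0.
Proof. by split=> //; rewrite cls0 (subrr p). Qed.

Lemma is_depth_lift (x y : RR) p q : cls x = p -> cls y = q -> x <= y -> is_depth p q (y - x).
Proof. by move=> <- <- xy; split; rewrite ?subr_ge0 // clsB. Qed.

Lemma is_depth_comp p q r l m : is_depth p q l -> is_depth q r m -> is_depth p r (l + m).
Proof.
move=> [l0 lE] [m0 mE]; split; first exact: addr_ge0.
by rewrite clsD lE mE addrC addrA subrK.
Qed.

Lemma cls_turns (n : nat) : cls (tau * n%:R) = 0 :> S1.
Proof. by rewrite -(cls0 RR); apply/clsP; exists n; rewrite add0r. Qed.

Lemma is_depth_turns p n : is_depth p p (tau * n%:R).
Proof. by split; [rewrite mulr_ge0 // ltW // twopi_gt0|rewrite cls_turns (subrr p)]. Qed.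

Lemma is_depthD p q l n : is_depth p q l -> is_depth p q (l + tau * n%:R).
Proof. by move=> lE; exact: is_depth_comp lE (is_depth_turns q n). Qed.

Lemma is_depth_decomp p q l : is_depth p q l -> exists n : nat, l = angle (q - p) + tau * n%:R.
Proof.
case=> l0 lE; have /clsP[n nE] : cls l = cls (angle (q - p)) by rewrite angleK.
have n0 : (0 <= n)%R.
  have /andP[_ a1] := angle_itv (q - p); have t0 := twopi_gt0 RR.
  have : -1 < n%:~R :> RR.
    by rewrite -(ltr_pM2l t0); move: nE l0 a1; lra.
  by rewrite -[-1]/((-1)%:~R) ltr_int; case: (n) => [|[]].
by exists `|n|%N; rewrite nE natr_absz ger0_norm.
Qed.

Lemma is_depth_small p q l : is_depth p q l -> l < tau -> l = angle (q - p).
Proof. by case=> l0 lE lt; rewrite (angle_unique lE) // l0. Qed.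

Lemma is_depth_sub p q l r m : is_depth p q l -> is_depth p r m -> l <= m -> is_depth q r (m - l).
Proof.
move=> [l0 lE] [m0 mE] lm; split; rewrite ?subr_ge0 //.
by rewrite clsB lE mE opprB addrA subrK.
Qed.

Lemma is_depth_subr p q l r m : is_depth q r l -> is_depth p r m -> l <= m -> is_depth p q (m - l).
Proof.
move=> [l0 lE] [m0 mE] lm; split; rewrite ?subr_ge0 //.
by rewrite clsB lE mE opprB addrC addrA subrK.
Qed.

Lemma is_depth_back p q l : is_depth p q l -> l <= tau -> is_depth q p (tau - l).
Proof.
by move=> lE lt; have := is_depth_turns p 1; rewrite mulr1 => aE; exact: is_depth_sub lE aE lt.
Qed.

Lemma slide_norm p q (n : nat) :
  slide p q (angle (q - p) + tau * n%:R) = t ^+ n *: base p q.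
Proof.
rewrite /slide locked_withE; congr (_ ^+ _ *: _); have t0 := twopi_gt0 RR.
have /andP[a0 a1] := angle_itv (q - p).
apply: Num.Theory.truncn_def; apply/andP; split.
  by rewrite ler_pdivlMr // mulrC; move: a0; lra.
by rewrite ltr_pdivrMr // -natr1 mulrDl [_ * tau]mulrC mul1r; move: a1; lra.
Qed.

Lemma slide_comp p q r l m : is_depth p q l -> is_depth q r m ->
  slide q r m ** slide p q l = slide p r (l + m).
Proof.
move=> /is_depth_decomp[a ->] /is_depth_decomp[b ->].
have -> : angle (q - p) + tau * a%:R + (angle (r - q) + tau * b%:R) =
    angle (r - p) + tau * (carry p q r + (b + a))%:R.
  by have := carryE p q r; rewrite !natrD; lra.
rewrite !slide_norm.
apply: coeff_inj; by rewrite coeff_comp !coeffZ !coeff_base !mulr1 !exprD.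
Qed.

Lemma slide_turns p q l n : is_depth p q l ->
  slide p q (l + tau * n%:R) = t ^+ n *: slide p q l.
Proof.
move=> /is_depth_decomp[a ->].
have -> : angle (q - p) + tau * a%:R + tau * n%:R = angle (q - p) + tau * (n + a)%:R.
  by rewrite natrD; lra.
by rewrite !slide_norm scalerA exprD.
Qed.

Lemma slide_angle p q : slide p q (angle (q - p)) = base p q.
Proof. by rewrite -[angle _]addr0 -(mulr0 tau) (slide_norm p q 0) scale1r. Qed.

Lemma slide0 p : slide p p 0 = idm (P p).
Proof.
by rewrite -(angle_self p) slide_angle; apply: coeff_inj; rewrite coeff_base.
Qed.

Lemma slide_turn p : slide p p tau = t *: idm (P p).
Proof.
by have := slide_turns 1 (is_depth_self p); rewrite mulr1 add0r slide0 expr1.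
Qed.

Lemma coeff_slide p q l : is_depth p q l -> l < tau -> coeff (slide p q l) = 1.
Proof. by move=> lE lt; rewrite (is_depth_small lE lt) slide_angle coeff_base. Qed.

Lemma hom_slide p q (f : hom (P p) (P q)) : f = coeff f *: slide p q (angle (q - p)).
Proof. by rewrite slide_angle -hom_base. Qed.

Lemma hom_slide_small p q l (f : hom (P p) (P q)) : is_depth p q l -> l < tau ->
  f = coeff f *: slide p q l.
Proof. by move=> lE lt; rewrite (is_depth_small lE lt) -hom_slide. Qed.

Section Torsion.
Hypothesis t_neq0 : t != 0.

(** Both depths are congruent modulo 2 pi, so the difference is a number of full
    turns, each of which accounts for one factor t. *)
Lemma slide_cmp p q l m a b : is_depth p q l -> is_depth p q m -> l <= m ->
  a *: slide p q l = b *: slide p q m ->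
  exists2 k : nat, m = l + tau * k%:R & a = b * t ^+ k.
Proof.
move=> lE mE lm; have t0 := twopi_gt0 RR.
have [c cE] := is_depth_decomp lE; have [d dE] := is_depth_decomp mE.
have cd : (c <= d)%N.
  by rewrite -(ler_nat RR) -(ler_pM2l t0); move: lm; rewrite cE dE; lra.
rewrite cE dE !slide_norm => /(congr1 (@coeff p q)).
rewrite !coeffZ coeff_base !mulr1 => E; exists (d - c)%N.
  by rewrite natrB // mulrBr; lra.
apply: (mulIf (expf_neq0 c t_neq0)).
by rewrite E -mulrA -exprD subnK.
Qed.

Definition torsion_free (V : rC) := forall p (v : V p), t *: v = 0 -> v = 0.

Lemma torsion_free_free p : torsion_free (P p).
Proof.
move=> q v /eqP; rewrite [_ == _]mulf_eq0 (negbTE t_neq0) /=.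
by move/eqP.
Qed.

Lemma torsion_free_exp (V W : rC) n (f g : hom W V) : torsion_free V ->
  t ^+ n *: f = t ^+ n *: g -> f = g.
Proof.
move=> tfV; elim: n f g => [f g|n IH f g]; first by rewrite !scale1r.
rewrite exprSr -!scalerA => /IH fg; apply: rhom_eq => p v.
apply/eqP; rewrite -subr_eq0; apply/eqP/tfV; rewrite scalerBr.
apply/eqP; rewrite subr_eq0; apply/eqP.
exact: (congr1 (fun h : hom W V => h p v) fg).
Qed.

(** A slide followed by a suitable slide back is a power of t. *)
Lemma slide_cancel_r (V : rC) p q l (f g : hom (P q) V) : torsion_free V ->
  is_depth p q l -> f ** slide p q l = g ** slide p q l -> f = g.
Proof.
move=> tfV /is_depth_decomp[n ->] /(congr1 (fun h => h ** base q p)).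
rewrite slide_norm !mcompZr !mcompZl -!mcompA.
have -> : base p q ** base q p = t ^+ carry q p q *: idm (P q).
  by apply: coeff_inj; rewrite coeff_comp !coeff_base coeffZ coeff_id !mulr1.
by rewrite !mcompZr !mcompm1 !scalerA -!exprD => /torsion_free_exp; exact.
Qed.

Lemma slide_cancel_l (V : rC) p q l (f g : hom V (P p)) :
  is_depth p q l -> slide p q l ** f = slide p q l ** g -> f = g.
Proof.
move=> /is_depth_decomp[n ->] /(congr1 (fun h => base q p ** h)).
rewrite slide_norm !mcompZl !mcompZr !mcompA.
have -> : base q p ** base p q = t ^+ carry p q p *: idm (P p).
  by apply: coeff_inj; rewrite coeff_comp !coeff_base coeffZ coeff_id !mulr1.
rewrite !mcompZl !mcomp1m !scalerA -!exprD => /torsion_free_exp; apply.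
exact: torsion_free_free.
Qed.

End Torsion.
End FreeReps.

(** * Finitely generated projectives and dual bases *)

Section Projectives.
Variables (RR : realType) (R : idomainType) (t : R).
Notation S1 := (S1 RR).
Notation rC := (repCat RR t).
Notation P := (freeRep t : S1 -> rC).
Notation hom := (@mor R rC).

Lemma rhom_sumE (V W : rC) (I : Type) (r : seq I) (A : pred I) (F : I -> hom V W) p v :
  (\sum_(i <- r | A i) F i : rhom V W) p v = \sum_(i <- r | A i) (F i : rhom V W) p v.
Proof. by elim/big_rec2: _ => // i y z _ <-. Qed.

(** The dual basis form of being finitely generated and projective; it is the form
    in which both properties are used. *)
Definition has_dual_basis (V : rC) := exists (T : finType) (x : T -> S1)
  (s : forall a, hom V (P (x a))) (f : forall a, hom (P (x a)) V),
  \sum_a f a ** s a = idm V.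

Lemma dual_basis_torsion_free (V : rC) : t != 0 -> has_dual_basis V -> torsion_free V.
Proof.
move=> t0 [T [x [s [f fs]]]] p v tv.
have vE : (\sum_a f a ** s a : rhom V V) p v = v.
  exact: (congr1 (fun h : hom V V => (h : rhom V V) p v) fs).
rewrite -{}vE rhom_sumE big1 // => a _.
have := rhomZ (s a) t v; rewrite tv rhom0 => /esym sv.
by rewrite /= (torsion_free_free t0 sv) rhom0.
Qed.

Lemma free_lift (V W : rC) p (g : hom V W) (h : hom (P p) W) :
  rep_epi g -> exists h', g ** h' = h.
Proof.
move=> /(_ p (h p (freeGen t p)))[v vE]; exists (yoneda v).
by apply: hom_gen_eq; rewrite -vE; congr (g p _); exact: yoneda_gen.
Qed.


Section FreeSum.
Variables (n : nat) (x : 'I_n -> S1).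

(** The generator of the i-th summand. *)
Definition insum_elt i : freeSum t x (x i) := fun j => (if j == i then 1 else 0 : R^o).
Definition insum i : hom (P (x i)) (freeSum t x) := yoneda (insum_elt i).

Fact outsum_subproof i : is_rep_hom
  ((fun q (v : freeSum t x q) => v i) : hom_family (freeSum t x) (P (x i))).
Proof. by []. Qed.
Definition outsum i : hom (freeSum t x) (P (x i)) :=
  RHom (introT (asboolP _) (outsum_subproof i)).

Lemma insumK i : outsum i ** insum i = idm (P (x i)).
Proof.
apply: coeff_inj; rewrite coeff_id; transitivity (insum_elt i i : R^o); last first.
  by rewrite /insum_elt eqxx.
by rewrite -(yoneda_gen (insum_elt i)).
Qed.

Lemma insum_neq i j : i != j -> outsum j ** insum i = 0.
Proof.
move=> ij; apply: coeff_inj; rewrite coeff0; transitivity (insum_elt i j : R^o).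
  by rewrite -(yoneda_gen (insum_elt i)).
by rewrite /insum_elt eq_sym (negbTE ij).
Qed.

Lemma outsum_inj (W : rC) (f g : hom W (freeSum t x)) :
  (forall i, outsum i ** f = outsum i ** g) -> f = g.
Proof.
move=> fg; apply: rhom_eq => p v; apply: dprodP => i.
exact: (congr1 (fun h : hom W (P (x i)) => (h : rhom _ _) p v) (fg i)).
Qed.

Lemma sum_inout : \sum_i insum i ** outsum i = idm (freeSum t x : rC).
Proof.
apply: outsum_inj => j; rewrite mcompm1 mcomp_sumr (bigD1 j) //= mcompA insumK mcomp1m.
by rewrite big1 ?addr0 // => i ij; rewrite mcompA insum_neq // mcomp0l.
Qed.

End FreeSum.

Lemma componentE m n (x : 'I_m -> S1) (y : 'I_n -> S1)
    (f : hom (freeSum t x) (freeSum t y)) i j :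
  component f j i = outsum y j ** f ** insum x i.
Proof.
apply: coeff_inj; rewrite /coeff.
transitivity ((f (x i) (insum x i (x i) (freeGen t (x i)))) j); last by [].
rewrite /insum yoneda_gen.
by transitivity (f (x i) (sum_incl (freeGen t (x i)) ) j).
Qed.

Lemma retract_dual_basis (V : rC) n (x : 'I_n -> S1) (F : hom (freeSum t x) V)
  (s : hom V (freeSum t x)) : F ** s = idm V -> has_dual_basis V.
Proof.
move=> Fs; exists 'I_n, x, (fun i => outsum x i ** s), (fun i => F ** insum x i).
under eq_bigr do rewrite mcompA -[X in X ** s]mcompA.
by rewrite -mcomp_suml -mcomp_sumr sum_inout mcompm1.
Qed.

Lemma fg_projective_dual_basis (V : rC) :
  finitely_generated V -> rep_projective V -> has_dual_basis V.
Proof.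
move=> [n [x [F Fepi]]] /(_ _ _ F Fepi (idm V))[s sE].
exact: (@retract_dual_basis V n x F s).
Qed.

Section FreeOver.
Variables (T : finType) (x : T -> S1).
Let y (i : 'I_#|T|) := x (enum_val i).

Definition freeFam : rC := freeSum t y.

Fact is_depth_rank a : is_depth (x a) (y (enum_rank a)) 0.
Proof. by rewrite /y enum_rankK; exact: is_depth_self. Qed.
Fact is_depth_rankV a : is_depth (y (enum_rank a)) (x a) 0.
Proof. by rewrite /y enum_rankK; exact: is_depth_self. Qed.

(** The i-th summand of the sum over the enumeration of T is indexed by the
    enumerated element, which equals a only propositionally; slides of depth 0
    provide the transport. The injections and projections are then hidden behind
    an existence statement, so that rewriting with associativity does not see
    that they are composites. *)
Fact freeFam_basis : exists finj_prj :
    (forall a, hom (P (x a)) freeFam) * (forall a, hom freeFam (P (x a))),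
  [/\ forall a, finj_prj.2 a ** finj_prj.1 a = idm (P (x a)),
      forall a b, a != b -> finj_prj.2 b ** finj_prj.1 a = 0
    & \sum_a finj_prj.1 a ** finj_prj.2 a = idm freeFam].
Proof.
exists (fun a => insum y (enum_rank a) ** slide t (x a) (y (enum_rank a)) 0,
        fun a => slide t (y (enum_rank a)) (x a) 0 ** outsum y (enum_rank a)) => /=.
split=> [a|a b ab|].
- rewrite !mcompA -[_ ** outsum _ _ ** _]mcompA insumK mcompm1.
  by rewrite (slide_comp _ (is_depth_rank a) (is_depth_rankV a)) addr0 slide0.
- rewrite !mcompA -[_ ** outsum _ _ ** _]mcompA insum_neq.
    by rewrite mcomp0r mcomp0l.
  by rewrite (inj_eq enum_rank_inj).
rewrite -(sum_inout y) (reindex (@enum_rank T)) /=; last first.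
  by exists enum_val => a _; rewrite ?enum_rankK ?enum_valK.
apply: eq_bigr => a _; rewrite mcompA -[_ ** _ ** slide _ _ _ _]mcompA.
by rewrite (slide_comp _ (is_depth_rankV a) (is_depth_rank a)) addr0 slide0 mcompm1.
Qed.

Definition finj := (sval (cid freeFam_basis)).1.
Definition fprj := (sval (cid freeFam_basis)).2.

Lemma injK a : fprj a ** finj a = idm (P (x a)).
Proof. by have [+ _ _] := svalP (cid freeFam_basis); exact. Qed.

Lemma inj_neq a b : a != b -> fprj b ** finj a = 0.
Proof. by have [_ + _] := svalP (cid freeFam_basis); exact. Qed.

Lemma sum_finjprj : \sum_a finj a ** fprj a = idm freeFam.
Proof. by have [_ _ +] := svalP (cid freeFam_basis); exact. Qed.

Lemma freeFam_dual_basis : has_dual_basis freeFam.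
Proof. by exists T, x, fprj, finj; exact: sum_finjprj. Qed.

Lemma sum_fprj (W : rC) (f : forall a, hom W (P (x a))) b :
  fprj b ** (\sum_a finj a ** f a) = f b.
Proof.
rewrite mcomp_sumr (bigD1 b) //= mcompA injK mcomp1m big1 ?addr0 // => a ab.
by rewrite mcompA inj_neq // mcomp0l.
Qed.

End FreeOver.

Lemma dual_basis_fg (V : rC) : has_dual_basis V -> finitely_generated V.
Proof.
move=> [T [x [s [f fs]]]].
exists #|T|, (fun i => x (enum_val i)), (\sum_a f a ** fprj x a : hom (freeFam x) V) => p v.
exists ((\sum_a finj x a ** s a : hom V (freeFam x)) p v).
have E : (\sum_a f a ** fprj x a) ** (\sum_a finj x a ** s a) = idm V.
  by rewrite -fs mcomp_suml; apply: eq_bigr => a _; rewrite -mcompA sum_fprj.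
exact: (congr1 (fun h : hom V V => (h : rhom _ _) p v) E).
Qed.

Lemma dual_basis_projective (V : rC) : has_dual_basis V -> rep_projective V.
Proof.
move=> [T [x [s [f fs]]]] U W g gepi h.
have H a : exists u : hom (P (x a)) U, (g : hom U W) ** u = (h : hom V W) ** f a.
  exact: free_lift.
exists (\sum_a (sval (cid (H a))) ** s a).
transitivity ((h : hom V W) ** (\sum_a f a ** s a)); last by rewrite fs mcompm1.
transitivity ((g : hom U W) ** (\sum_a (sval (cid (H a))) ** s a)); first by [].
rewrite !mcomp_sumr; apply: eq_bigr => a _; rewrite !mcompA.
by have /= -> := svalP (cid (H a)).
Qed.

End Projectives.

(** * Depth as divisibility by slides *)

Section Deep.
Variables (RR : realType) (R : idomainType) (t : R).
Hypothesis R_dvr : discrete_valuation_ring R.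
Hypothesis t_unif : uniformizer t.
Notation S1 := (S1 RR).
Notation rC := (repCat RR t).
Notation P := (freeRep t : S1 -> rC).
Notation hom := (@mor R rC).
Notation tau := (@twopi RR).
Let t_neq0 := unif_neq0 R_dvr t_unif.

(** The depth of f is at least l (any l if f = 0). *)
Definition deep p q (l : RR) (f : hom (P p) (P q)) :=
  exists c m, [/\ is_depth p q m, l <= m & f = c *: slide t p q m].

Lemma deep0 p q l : deep l (0 : hom (P p) (P q)).
Proof.
have [n ln] : exists n : nat, l <= tau * n%:R.
  have [t0 l0] := (twopi_gt0 RR, archimedean.Num.Theory.truncnS_gt (l / tau)).
  by eexists; rewrite mulrC -ler_pdivrMr //; exact: ltW l0.
exists 0, (angle (q - p) + tau * n%:R); split; last by rewrite scale0r.
  exact/is_depthD/is_depth_angle.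
by case: (is_depth_angle p q) => a0 _; lra.
Qed.

Lemma deepD p q l (f g : hom (P p) (P q)) : deep l f -> deep l g -> deep l (f + g).
Proof.
have H (c d : R) m n : l <= m -> is_depth p q m -> is_depth p q n -> m <= n ->
    deep l (c *: slide t p q m + d *: slide t p q n).
  move=> lm ma na mn.
  have [k nE] : exists k : nat, n = m + tau * k%:R.
    have [i iE] := is_depth_decomp ma; have [j jE] := is_depth_decomp na.
    have ij : (i <= j)%N.
      by rewrite -(ler_nat RR) -(ler_pM2l (twopi_gt0 RR)); move: mn; rewrite iE jE; lra.
    by exists (j - i)%N; rewrite natrB //; lra.
  exists (c + d * t ^+ k), m; split=> //.
  by rewrite nE slide_turns // scalerA scalerDl.
move=> [c [m [ma lm ->]]] [d [n [na ln ->]]].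
by have [mn|/ltW nm] := leP m n; [|rewrite addrC]; exact: H.
Qed.

Lemma deep_sum p q l (I : Type) (r : seq I) (A : pred I) (F : I -> hom (P p) (P q)) :
  (forall i, A i -> deep l (F i)) -> deep l (\sum_(i <- r | A i) F i).
Proof. by move=> HF; apply: big_ind; [exact: deep0|exact: deepD|]. Qed.

Lemma deep_comp p q r l m (g : hom (P q) (P r)) (f : hom (P p) (P q)) :
  deep l f -> deep m g -> deep (l + m) (g ** f).
Proof.
move=> [c [i [ia li ->]]] [d [j [ja mj ->]]]; exists (d * c), (i + j); split.
- exact: is_depth_comp ia ja.
- exact: lerD.
- by rewrite mcompZl mcompZr scalerA (slide_comp _ ia ja).
Qed.

Lemma deep_slide p q m : is_depth p q m -> deep m (slide t p q m).
Proof. by move=> ma; exists 1, m; rewrite scale1r. Qed.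

Lemma deep_any p q (f : hom (P p) (P q)) : deep 0 f.
Proof.
exists (coeff f), (angle (q - p)); split; [exact: is_depth_angle| |exact: hom_slide].
by case: (is_depth_angle p q).
Qed.

(** A multiple of t has turned around once, so its depth is at least 2 pi. *)
Lemma deep_nonunit p q (f : hom (P p) (P q)) l : coeff f \isn't a GRing.unit ->
  l <= tau -> deep l f.
Proof.
move=> /t_unif[c cE] lt; exists c, (angle (q - p) + tau * 1); split.
- exact/(is_depthD 1)/is_depth_angle.
- by case: (is_depth_angle p q) => a0 _; lra.
- by rewrite (slide_turns _ 1 (is_depth_angle p q)) scalerA -cE -hom_slide.
Qed.

(** A greater depth in the same Hom module costs at least a factor t, which a unit
    does not have. *)
Lemma deep_bound p q l m u : is_depth p q m -> u \is a GRing.unit ->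
  deep l (u *: slide t p q m) -> l <= m.
Proof.
move=> ma uU [c [n [na ln]]] E; case: (leP n m) => [|mn]; first exact: le_trans.
have [k nE uE] := slide_cmp t_neq0 ma na (ltW mn) E.
case: k nE uE => [nE|k _ uE]; first by move: mn; rewrite nE mulr0 addr0 ltxx.
have /t_unif/negP[] : exists y, u = y * t by exists (c * t ^+ k); rewrite uE exprSr mulrA.
by [].
Qed.

(** The image of the generator lies in the image of the structure map of length l
    that ends at p. *)
Definition divr (V : rC) p (l : RR) (g : hom (P p) V) :=
  exists w : hom (P (p + cls l)) V, g = w ** slide t p (p + cls l) l.
(** The dual of divr: all values lie in the part of P_[q] of depth at least l. *)
Definition divl (V : rC) q (l : RR) (g : hom V (P q)) :=
  exists w : hom V (P (q - cls l)), g = slide t (q - cls l) q l ** w.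

Lemma is_depth_end (p : S1) (l : RR) : 0 <= l -> is_depth p (p + cls l) l.
Proof. by split; rewrite // addrC addKr. Qed.
Lemma is_depth_start (q : S1) (l : RR) : 0 <= l -> is_depth (q - cls l) q l.
Proof. by split; rewrite // opprB addrC subrK. Qed.

Lemma divrP (V : rC) p q l (g : hom (P p) V) : is_depth p q l ->
  divr l g <-> exists w : hom (P q) V, g = w ** slide t p q l.
Proof.
case=> l0 lE; have -> : q = p + cls l by rewrite lE addrC subrK.
by [].
Qed.

Lemma divlP (V : rC) p q l (g : hom V (P q)) : is_depth p q l ->
  divl l g <-> exists w : hom V (P p), g = slide t p q l ** w.
Proof.
case=> l0 lE; have -> : p = q - cls l by rewrite lE opprB addrC subrK.
by [].
Qed.

Lemma divr_sum (V : rC) p l (I : Type) (r : seq I) (A : pred I)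
    (F : I -> hom (P p) V) :
  (forall i, A i -> divr l (F i)) -> divr l (\sum_(i <- r | A i) F i).
Proof.
move=> HF; apply: big_ind => //; first by exists 0; rewrite mcomp0l.
by move=> _ _ [v ->] [w ->]; exists (v + w); rewrite mcompDl.
Qed.

Lemma divl_sum (V : rC) p l (I : Type) (r : seq I) (A : pred I)
    (F : I -> hom V (P p)) :
  (forall i, A i -> divl l (F i)) -> divl l (\sum_(i <- r | A i) F i).
Proof.
move=> HF; apply: big_ind => //; first by exists 0; rewrite mcomp0r.
by move=> _ _ [v ->] [w ->]; exists (v + w); rewrite mcompDr.
Qed.

Lemma divr_compl (V W : rC) p l (h : hom V W) (g : hom (P p) V) :
  divr l g -> divr l (h ** g).
Proof. by move=> [w ->]; exists (h ** w); rewrite mcompA. Qed.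

Lemma divl_compr (V W : rC) p l (g : hom V (P p)) (h : hom W V) :
  divl l g -> divl l (g ** h).
Proof. by move=> [w ->]; exists (w ** h); rewrite mcompA. Qed.

Lemma divr_le (V : rC) p l m (g : hom (P p) V) : 0 <= m -> m <= l ->
  divr l g -> divr m g.
Proof.
move=> m0 ml; have la := is_depth_end p (le_trans m0 ml); have ma := is_depth_end p m0.
move=> [w ->]; exists (w ** slide t _ _ (l - m)).
by rewrite -mcompA (slide_comp _ ma (is_depth_sub ma la ml)) subrKC.
Qed.

Lemma divr_slide (V : rC) p q l m (g : hom (P q) V) : is_depth p q m -> 0 <= l ->
  divr l g -> divr (m + l) (g ** slide t p q m).
Proof.
move=> ma l0 [w ->]; have la := is_depth_end q l0.
apply/(divrP _ (is_depth_comp ma la)); exists w.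
by rewrite -mcompA (slide_comp _ ma la).
Qed.

Lemma divrZ (V : rC) p l c (g : hom (P p) V) : divr l g -> divr l (c *: g).
Proof. by move=> [w ->]; exists (c *: w); rewrite mcompZl. Qed.

Lemma deep_divr p q l (f : hom (P p) (P q)) : 0 <= l -> deep l f -> divr l f.
Proof.
move=> l0 [c [m [ma lm ->]]]; have la := is_depth_end p l0.
exists (c *: slide t _ _ (m - l)).
by rewrite mcompZl (slide_comp _ la (is_depth_sub la ma lm)) subrKC.
Qed.

Lemma deep_divl p q l (f : hom (P p) (P q)) : 0 <= l -> deep l f -> divl l f.
Proof.
move=> l0 [c [m [ma lm ->]]]; have la := is_depth_start q l0.
exists (c *: slide t _ _ (m - l)).
by rewrite mcompZr (slide_comp _ (is_depth_subr la ma lm) la) subrK.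
Qed.

Lemma divr_deep p q l (f : hom (P p) (P q)) : 0 <= l -> divr l f -> deep l f.
Proof.
move=> l0 [w ->]; rewrite -[l in deep l]addr0.
exact: deep_comp (deep_slide (is_depth_end p l0)) (deep_any w).
Qed.

(** Entries with nonunit coefficient have depth at least 2 pi, so the unit entry
    of least depth bounds the depths of all entries. *)
Lemma least_unit_entry (T : finType) (x : T -> S1)
    (M : forall a b, hom (P (x b)) (P (x a))) :
  (exists N : forall a b, hom (P (x b)) (P (x a)), forall a b, M a b = t *: N a b) \/
  exists a b u m, [/\ u \is a GRing.unit, is_depth (x b) (x a) m, m < tau,
    M a b = u *: slide t (x b) (x a) m & forall a' b', deep m (M a' b')].
Proof.
pose U (ab : T * T) := coeff (M ab.1 ab.2) \is a GRing.unit.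
have [[ab0 U0]|noU] := pselect (exists ab, U ab); [right|left]; last first.
  have H a b : exists c, coeff (M a b) = c * t.
    by apply/t_unif/negP => ab; apply: noU; exists (a, b).
  exists (fun a b => sval (cid (H a b)) *: base t (x b) (x a)) => a b.
  by rewrite scalerA mulrC -(svalP (cid (H a b))) -hom_base.
pose th (ab : T * T) := angle (x ab.1 - x ab.2).
case: (@arg_minP _ _ _ ab0 U th U0) => -[a b] Uab minab.
have /andP[_ lt] := angle_itv (x a - x b).
exists a, b, (coeff (M a b)), (th (a, b)).
split=> //; [exact: is_depth_angle|exact: hom_slide|] => a' b'.
case: (boolP (U (a', b'))) => [U'|U']; last by apply: deep_nonunit => //; exact: ltW.
exists (coeff (M a' b')), (th (a', b')); split; [exact: is_depth_angle| |exact: hom_slide].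
exact: (minab (a', b')).
Qed.

Lemma dual_basis_separated (V W : rC) (f : hom V W) : has_dual_basis V -> has_dual_basis W ->
  (forall n, exists h, f = t ^+ n *: h) -> f = 0.
Proof.
move=> [T [x [s [g gs]]]] [T' [x' [s' [g' gs']]]] Hf.
have E a b : s' a ** f ** g b = 0.
  apply: coeff_inj; rewrite coeff0; apply: (dvd_exp_eq0 R_dvr t_unif) => n.
  have [h ->] := Hf n; exists (coeff (s' a ** h ** g b)).
  by rewrite mcompZr mcompZl coeffZ mulrC.
have -> : f = \sum_a \sum_b g' a ** (s' a ** f ** g b) ** s b.
  rewrite -{1}[f]mcomp1m -gs' mcomp_suml; apply: eq_bigr => a _.
  rewrite -[LHS]mcompm1 -gs mcomp_sumr; apply: eq_bigr => b _.
  by rewrite !mcompA.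
by rewrite big1 // => a _; rewrite big1 // => b _; rewrite E mcomp0r mcomp0l.
Qed.

(** An idempotent divisible by t is divisible by all powers of t. *)
Lemma idempotent_divisible (V : rC) (f h : hom V V) : has_dual_basis V ->
  f ** f = f -> f = t *: h -> f = 0.
Proof.
move=> gV ff fh; apply: dual_basis_separated => // n; elim: n => [|n [k fk]].
  by exists f; rewrite scale1r.
exists (k ** h); rewrite -ff {1}fk fh mcompZl mcompZr scalerA exprSr.
by [].
Qed.

End Deep.

(** * Orthogonal families of idempotents *)

Section Exhaustion.
Variables (RR : realType) (R : idomainType) (t : R).
Notation S1 := (S1 RR).
Notation rC := (repCat RR t).
Notation P := (freeRep t : S1 -> rC).
Notation hom := (@mor R rC).

(** The action on fibres over the base point 0, each of which is R. In contrast
    to coefficients, these scalars multiply without factors t. *)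
Definition fibre_scalar p q (f : hom (P p) (P q)) : R := (f : rhom _ _) 0 (1 : R^o).

Lemma fibre_scalar_comp p q r (g : hom (P q) (P r)) (f : hom (P p) (P q)) :
  fibre_scalar (g ** f) = fibre_scalar g * fibre_scalar f.
Proof.
transitivity ((g : rhom _ _) 0 ((fibre_scalar f : R) *: (1 : R^o) : P q 0)).
  by rewrite /= [_ *: _]mulr1.
by rewrite rhomZ mulrC.
Qed.

Lemma fibre_scalar_sum p q (I : Type) (r : seq I) (A : pred I)
    (F : I -> hom (P p) (P q)) :
  fibre_scalar (\sum_(i <- r | A i) F i) = \sum_(i <- r | A i) fibre_scalar (F i).
Proof. exact: (@rhom_sumE _ _ _ (P p) (P q) I r A F 0 (1 : R^o)). Qed.

Record summand (V : rC) := Summand {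
  spt : S1;
  sinj : hom (P spt) V;
  sprj : hom V (P spt);
  sprjK : sprj ** sinj = idm (P spt)
}.

(** Over the base point, the projections to and the injections of the summands give
    matrices over R whose product is the identity of size k, and which factor
    through the basis indexed by T. *)
Lemma summands_bound (V : rC) (T : finType) (x : T -> S1)
    (s : forall a, hom V (P (x a))) (f : forall a, hom (P (x a)) V)
    k (S : 'I_k -> summand V) :
  \sum_a f a ** s a = idm V ->
  (forall i j, i != j -> sprj (S i) ** sinj (S j) = 0) -> (k <= #|T|)%N.
Proof.
move=> fs So.
pose A : 'M[R]_(k, #|T|) := \matrix_(i, a) fibre_scalar (sprj (S i) ** f (enum_val a)).
pose B : 'M[R]_(#|T|, k) := \matrix_(a, i) fibre_scalar (s (enum_val a) ** sinj (S i)).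
apply: (@mulmx1_min _ _ _ A B); apply/matrixP => i j; rewrite !mxE.
transitivity (fibre_scalar (sprj (S i) ** sinj (S j))).
  rewrite -[sprj (S i)]mcompm1 -fs mcomp_sumr mcomp_suml fibre_scalar_sum.
  rewrite (reindex (@enum_val T xpredT)) /=; last first.
    by exists enum_rank => a _; rewrite ?enum_rankK ?enum_valK.
  by apply: eq_bigr => a _; rewrite !mxE -fibre_scalar_comp !mcompA.
case: eqVneq => [<-|ij]; first by rewrite sprjK.
by rewrite So.
Qed.

(** Orthogonal families of pieces have bounded length, so one that cannot be
    extended exists; the step hypothesis forces its complement to be zero. The
    predicate Q records what the complement has to satisfy, such as commuting with
    d. *)
Lemma exhaustion (V : rC) (A : Type) (e : A -> hom V V) (S : A -> summand V)
    (Q : hom V V -> Prop) :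
  has_dual_basis V -> (forall a, sprj (S a) ** e a = sprj (S a)) ->
  (forall a, e a ** sinj (S a) = sinj (S a)) ->
  (forall a, e a ** e a = e a) ->
  Q (idm V) -> (forall f a, Q f -> Q (f - e a)) ->
  (forall f, f ** f = f -> Q f -> f != 0 ->
    exists a, f ** e a = e a /\ e a ** f = e a) ->
  exists k (F : 'I_k -> A), \sum_i e (F i) = idm V /\
    forall i j, i != j -> e (F i) ** e (F j) = 0.
Proof.
move=> [T [x [s [f fs]]]] Se eS ee Q1 QB step.
pose orth k (F : 'I_k -> A) := forall i j, i != j -> e (F i) ** e (F j) = 0.
have [//|none] := pselect (exists k (F : 'I_k -> A), \sum_i e (F i) = idm V /\ orth k F).
(* Otherwise there are orthogonal families of every length. *)
have build k : exists F : 'I_k -> A, orth k F /\ Q (idm V - \sum_i e (F i)).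
  elim: k => [|k [F [Fo FQ]]].
    have F0 : 'I_0 -> A by case.
    by exists F0; split=> [[]//|]; rewrite big_ord0 subr0.
  set g := idm V - \sum_i e (F i).
  have gF i : g ** e (F i) = 0.
    rewrite mcompBl mcomp1m mcomp_suml (bigD1 i) //= ee big1 ?addr0 ?subrr // => j ji.
    by rewrite Fo.
  have Fg i : e (F i) ** g = 0.
    rewrite mcompBr mcompm1 mcomp_sumr (bigD1 i) //= ee big1 ?addr0 ?subrr // => j ji.
    by rewrite Fo // eq_sym.
  have gg : g ** g = g.
    by rewrite {1}/g mcompBl mcomp1m mcomp_suml big1 ?subr0.
  have g0 : g != 0.
    apply/eqP => g0; apply: none; exists k, F; split=> //.
    by apply/esym/eqP; rewrite -subr_eq0; apply/eqP.
  have [a [ga ag]] := step g gg FQ g0.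
  pose F' (i : 'I_k.+1) := if unlift ord_max i is Some j then F j else a.
  have F'l i : F' (lift ord_max i) = F i by rewrite /F' liftK.
  have F'm : F' ord_max = a by rewrite /F' unlift_none.
  exists F'; split.
    move=> i j; case: (unliftP ord_max i) => [i'|] ->; case: (unliftP ord_max j) => [j'|] ->;
      rewrite ?F'l ?F'm.
    - by move=> ij; apply: Fo; apply: contraNneq ij => ->.
    - by move=> _; rewrite -ga mcompA Fg mcomp0l.
    - by move=> _; rewrite -ag -mcompA gF mcomp0r.
    - by rewrite eqxx.
  rewrite big_ord_recr /= F'm opprD addrA; apply: QB.
  rewrite (eq_bigr (fun i => e (F i))) // => i _; congr e.
  by rewrite -F'l; congr F'; apply: val_inj; rewrite /= /bump leqNgt ltn_ord.
have [F [Fo _]] := build #|T|.+1.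
suff : (#|T|.+1 <= #|T|)%N by rewrite ltnn.
apply: (summands_bound (S := fun i => S (F i)) fs) => i j ij.
by rewrite -Se -eS mcompA -[_ ** _ ** e (F j)]mcompA Fo // mcomp0r mcomp0l.
Qed.

End Exhaustion.

Section KrullSchmidt.
Variables (RR : realType) (R : idomainType) (t : R).
Hypothesis R_dvr : discrete_valuation_ring R.
Hypothesis t_unif : uniformizer t.
Notation S1 := (S1 RR).
Notation rC := (repCat RR t).
Notation P := (freeRep t : S1 -> rC).
Notation hom := (@mor R rC).

(** Let m be the least depth of a unit entry of the matrix of f. As f is
    idempotent, all its entries have depth at least 2 m; so m = 0, and the entry
    in question is an isomorphism. *)
Lemma free_summand (V : rC) (f : hom V V) : has_dual_basis V -> f ** f = f -> f != 0 ->
  exists S : summand V, f ** sinj S = sinj S /\ sprj S ** f = sprj S.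
Proof.
move=> gV ff f0; have [T [x [s [g gs]]]] := gV.
pose M a b := s a ** f ** g b.
have [[N MN]|[a [b [u [m [uU ma mt Mab deepM]]]]]] :=
  least_unit_entry t_unif M.
  case/eqP: f0; apply: (idempotent_divisible R_dvr t_unif
    (h := \sum_a \sum_b g a ** N a b ** s b)) => //.
  rewrite -{1}[f]mcomp1m -gs mcomp_suml scaler_sumr; apply: eq_bigr => a _.
  rewrite -[LHS]mcompm1 -gs mcomp_sumr scaler_sumr; apply: eq_bigr => b _.
  by rewrite -mcompZl -mcompZr -MN !mcompA.
(* Otherwise M a b, a sum of the M a c M c b, would be too deep. *)
have m0 : m = 0.
  apply/eqP; rewrite eq_le; case: (ma) => m0 _; rewrite m0 andbT.
  suff : m + m <= m by lra.
  apply: (deep_bound R_dvr t_unif ma uU); rewrite -Mab.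
  have -> : M a b = \sum_c M a c ** M c b.
    transitivity (s a ** f ** (\sum_c g c ** s c) ** (f ** g b)).
      by rewrite gs mcompm1 !mcompA -[s a ** f ** f]mcompA ff.
    by rewrite mcomp_sumr mcomp_suml; apply: eq_bigr => c _; rewrite /M !mcompA.
  by apply: deep_sum => // c _; exact: deep_comp.
(* The points x a and x b are equal; the slide of depth 0 is the transport. *)
have ma' : is_depth (x a) (x b) 0.
  by case: ma; rewrite m0 => _ E; split=> //; rewrite cls0 -opprB -E cls0 oppr0.
rewrite m0 in Mab ma.
have rv : u^-1 *: slide t (x a) (x b) 0 ** s a ** f ** (f ** g b) = idm (P (x b)).
  transitivity (u^-1 *: slide t (x a) (x b) 0 ** M a b).
    by rewrite /M -{3}ff !mcompA.
  by rewrite Mab mcompZr mcompZl scalerA divrr // scale1r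
    (slide_comp _ ma ma') addr0 slide0.
exists (Summand rv) => /=; split; first by rewrite mcompA ff.
by rewrite -!mcompA ff.
Qed.

(** The existence part of Krull-Schmidt: some P_[p] splits off as long as the
    complementary idempotent is nonzero. *)
Lemma dual_basis_free (V : rC) : has_dual_basis V -> exists n (y : 'I_n -> S1)
  (i : hom (freeSum t y) V) (j : hom V (freeSum t y)),
  i ** j = idm V /\ j ** i = idm (freeSum t y : rC).
Proof.
move=> gV.
have [||||||k [F [F1 Fo]]] := @exhaustion _ _ _ V (summand V)
    (fun S => sinj S ** sprj S) id (fun=> True) gV => //.
- by move=> S; rewrite mcompA sprjK mcomp1m.
- by move=> S; rewrite -mcompA sprjK mcompm1.
- by move=> S; rewrite mcompA -[_ ** _ ** sinj S]mcompA sprjK mcompm1.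
- move=> f ff _ f0; have [S [S1 S2]] := free_summand gV ff f0.
  by exists S; rewrite mcompA S1 -mcompA S2.
exists k, (fun i => spt (F i)), (\sum_i sinj (F i) ** outsum t _ i),
  (\sum_i insum t _ i ** sprj (F i)).
have Fo' i j : i != j -> sprj (F i) ** sinj (F j) = 0.
  move=> ij; transitivity (sprj (F i) **
      (sinj (F i) ** sprj (F i) ** (sinj (F j) ** sprj (F j))) ** sinj (F j)).
    by rewrite !mcompA sprjK mcomp1m -mcompA sprjK mcompm1.
  by rewrite Fo // mcomp0r mcomp0l.
split.
  rewrite -F1 mcomp_suml; apply: eq_bigr => i _; rewrite -mcompA mcomp_sumr (bigD1 i) //=.
  rewrite mcompA insumK mcomp1m big1 ?addr0 // => j ji.
  by rewrite mcompA insum_neq // mcomp0l.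
rewrite -sum_inout mcomp_suml; apply: eq_bigr => i _; rewrite -mcompA mcomp_sumr (bigD1 i) //=.
rewrite mcompA sprjK mcomp1m big1 ?addr0 // => j ji.
by rewrite mcompA Fo' ?mcomp0l // eq_sym.
Qed.

End KrullSchmidt.

(** * Depth, arcs and support intervals *)

Section Depth.
Variables (RR : realType) (R : idomainType) (t : R).
Hypothesis R_dvr : discrete_valuation_ring R.
Hypothesis t_unif : uniformizer t.
Notation S1 := (S1 RR).
Notation rC := (repCat RR t).
Notation P := (freeRep t : S1 -> rC).
Notation hom := (@mor R rC).
Notation tau := (@twopi RR).
Let t_neq0 := unif_neq0 R_dvr t_unif.

Lemma freeGenAtE p q (a : arrow q p) :
  (freeGenAt t a : R^o) = @coeff RR R t p q (slide t p q (len a)).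
Proof.
have aa : is_depth p q (len a).
  by split; [exact: len_ge0|rewrite [in RHS](arrow_target a) opprB addrC subrK].
have [n nE] := is_depth_decomp aa.
rewrite nE slide_norm coeffZ coeff_base mulr1 /freeGenAt (rmap_turns _ nE).
have := @gen_span RR R t q p (1 : R^o); rewrite scale1r => <-.
by rewrite [_ *: _]mulr1.
Qed.

Lemma depthP p q (f : hom (P p) (P q)) : f != 0 -> exists u l,
  [/\ u \is a GRing.unit, is_depth p q l, f = u *: slide t p q l & depth f = l%:E].
Proof.
move=> f0; rewrite /depth (negbTE f0); set A := [set _ | _]; set l := xget _ _.
have : A l.
  have c0 : coeff f != 0.
    by apply: contraNneq f0 => c0; apply/eqP/coeff_inj; rewrite coeff0.
  have [u [n [uU cE]]] := unit_times_exp R_dvr t_unif c0.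
  have la : is_depth p q (angle (q - p) + tau * n%:R) by exact/is_depthD/is_depth_angle.
  have [l0 lE] := la.
  have aE : p = q - cls (angle (q - p) + tau * n%:R).
    by rewrite lE opprB addrC subrK.
  apply: (xgetPex 0); exists (angle (q - p) + tau * n%:R), u, (Arrow l0 aE).
  split=> //; rewrite freeGenAtE [len _]/= slide_norm coeffZ coeff_base mulr1.
  exact: cE.
move=> [u [a [uU aE fE]]]; exists u, l.
have aa : is_depth p q (len a).
  by split; [exact: len_ge0|rewrite [in RHS](arrow_target a) opprB addrC subrK].
split=> //; rewrite -?aE //; apply: coeff_inj; rewrite coeffZ -freeGenAtE.
exact: fE.
Qed.

Lemma depth_fin p q (f : hom (P p) (P q)) l : depth f = l%:E ->
  exists u, [/\ u \is a GRing.unit, is_depth p q l & f = u *: slide t p q l].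
Proof.
have [->|f0] := eqVneq f 0; first by rewrite /depth eqxx.
by have [u [m [uU ma fE ->]]] := depthP f0; case=> <-; exists u.
Qed.

Lemma depth_unit p q l u : u \is a GRing.unit -> is_depth p q l ->
  depth (u *: slide t p q l : hom (P p) (P q)) = l%:E.
Proof.
move=> uU la; have f0 : u *: slide t p q l != 0.
  apply/eqP => f0; have [n nE] := is_depth_decomp la.
  have /eqP := congr1 (@coeff _ _ _ p q) f0.
  rewrite coeff0 nE slide_norm !coeffZ coeff_base mulr1 mulf_eq0 expf_eq0.
  by rewrite (negbTE t_neq0) andbF orbF => /eqP u0; move: uU; rewrite u0 unitr0.
have [v [m [vU ma fE ->]]] := depthP f0; congr (_%:E); apply/eqP; rewrite eq_le.
apply/andP; split.
  by apply: (deep_bound R_dvr t_unif la uU); rewrite fE; exists v, m.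
by apply: (deep_bound R_dvr t_unif ma vU); rewrite -fE; exists u, l.
Qed.

End Depth.

Section Arcs.
Variable RR : realType.
Notation tau := (@twopi RR).
Implicit Types a b x y : RR.

(** A lift of an arc may be shifted by full turns. *)
Lemma arc_turns a b (n : int) : Defs.arc (a + tau * n%:~R) (b + tau * n%:~R) = Defs.arc a b.
Proof.
have H (m : int) x y : Defs.arc x y `<=` Defs.arc (x + tau * m%:~R) (y + tau * m%:~R).
  move=> _ [z /= zxy <-]; exists (z + tau * m%:~R); last by apply/clsP; exists m.
  by move: zxy; rewrite /= !in_itv /= !lerD2r.
apply/seteqP; split; last exact: H.
by have := H (- n) (a + tau * n%:~R) (b + tau * n%:~R); rewrite mulrNz mulrN !addrK.
Qed.

(** The arc over [a, b] is connected, so it cannot leave one lift of the bigger arc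
    without meeting the complement of all lifts. *)
Lemma arc_sub a b a' b' : a <= b -> b' < a' + tau -> Defs.arc a b `<=` Defs.arc a' b' ->
  exists n : int, a' <= a + tau * n%:~R /\ b + tau * n%:~R <= b'.
Proof.
move=> ab bt' sub; have t0 := twopi_gt0 RR.
have [|z] := sub (cls a); first by exists a; rewrite //= in_itv /= lexx.
rewrite /= in_itv /= => /andP[z1 z2] /clsP[n nE]; exists n; split; first by rewrite -nE.
rewrite leNgt; apply/negP => gtb.
(* A point of the arc over [a, b] strictly between b' and a' + 2 pi. *)
pose c := Num.min ((b' + a' + tau) / 2) (b + tau * n%:~R).
have [c1 c2] : b' < c /\ c < a' + tau.
  rewrite /c; split; first by rewrite lt_min gtb andbT; lra.
  by rewrite gt_min; apply/orP; left; lra.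
have c3 : c <= b + tau * n%:~R by rewrite /c ge_min lexx orbT.
have [|e] := sub (cls c).
  exists (c - tau * n%:~R); last by apply/clsP; exists (- n); rewrite mulrNz mulrN.
  by rewrite /= in_itv /=; apply/andP; split; move: nE; lra.
rewrite /= in_itv /= => /andP[e1 e2] /clsP[k kE].
have k0 : k = 0.
  by apply: (@int_between RR); rewrite -(ltr_pM2l t0) ?mulrN1 ?mulr1; lra.
by move: kE; rewrite k0 mulr0 addr0; lra.
Qed.

End Arcs.

Section Gap.
Variables (RR : realType) (phi : lineHomeo RR).
Notation S1 := (S1 RR).
Notation tau := (@twopi RR).

Lemma homeo_mono (x y : RR) : x <= y -> phi x <= phi y.
Proof.
move=> xy; rewrite leNgt; apply/negP => lt; have := homeo_inv_mono phi (ltW lt).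
rewrite !homeo_funK => yx; have E : x = y by apply/le_anti; rewrite xy.
by move: lt; rewrite E ltxx.
Qed.

Lemma homeo_shift (x : RR) (n : int) : phi (x + tau * n%:~R) = phi x + tau * n%:~R.
Proof.
by apply: (can_inj (homeo_invK phi)); rewrite psi_shift !homeo_funK.
Qed.

(** The length of the interval [z, phi z] at z, a function of the class of z. *)
Definition gap (p : S1) : RR := phi (angle p) - angle p.

Lemma gap_lift x p : cls x = p -> gap p = phi x - x.
Proof.
move=> <-; rewrite /gap; have /clsP[n ->] := angleK (cls x).
by rewrite homeo_shift; lra.
Qed.

Lemma gap_itv p : 0 <= gap p < pi.
Proof. by rewrite /gap; have /andP[] := homeo_bound phi (angle p); lra. Qed.

Lemma gap_ge0 p : 0 <= gap p.
Proof. by case/andP: (gap_itv p). Qed.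

Lemma gap_lt p : gap p < tau.
Proof.
have /andP[_ g] := gap_itv p; apply: lt_trans g _.
by rewrite /twopi; have := pi_gt0 RR; lra.
Qed.

(** The homeomorphism phi preserves the order: phi x <= phi (x + l). *)
Lemma gap_depth p q l : is_depth p q l -> gap p <= l + gap q.
Proof.
move=> [l0 lE]; have [x xE] := cls_surj p.
have yE : cls (x + l) = q by rewrite clsD lE -xE addrC subrK.
rewrite (gap_lift (esym xE)) (gap_lift yE).
have : phi x <= phi (x + l) by apply: homeo_mono; lra.
lra.
Qed.

End Gap.

(** * The support condition as a depth condition *)

Section Objects.
Variables (RR : realType) (R : idomainType) (t : R) (phi : lineHomeo RR).
Hypothesis R_dvr : discrete_valuation_ring R.
Hypothesis t_unif : uniformizer t.
Notation S1 := (S1 RR).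
Notation rC := (repCat RR t).
Notation P := (freeRep t : S1 -> rC).
Notation hom := (@mor R rC).
Notation tau := (@twopi RR).
Notation gap := (gap phi).

(** The values of d on V[p] come from the point phi p. This is the condition on
    support intervals in a form that does not mention bases. *)
Definition phi_deep (V : rC) (d : hom V V) :=
  forall p (v : hom (P p) V), divr (gap p) (d ** v).

(** Moving a generator down the circle only weakens the condition, by
    monotonicity of phi. *)
Lemma phi_deep_basis (V : rC) (d : hom V V) (T : finType) (x : T -> S1)
    (s : forall a, hom V (P (x a))) (g : forall a, hom (P (x a)) V) :
  \sum_a g a ** s a = idm V -> (forall a, divr (gap (x a)) (d ** g a)) -> phi_deep d.
Proof.
move=> gs dg p v; rewrite -[v]mcomp1m -gs mcomp_suml mcomp_sumr.
apply: divr_sum => a _; rewrite -mcompA mcompA (hom_slide (s a ** v)) mcompZr.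
have aa := is_depth_angle p (x a).
apply/divrZ/(divr_le (gap_ge0 _ _) (gap_depth phi aa)).
exact: divr_slide (gap_ge0 _ _) (dg a).
Qed.

(** A candidate [a, b] comes from an entry of depth b - a, which is at least
    phi a - a; hence [a, phi a] is contained in [a, b]. *)
Lemma phi_deep_support (V : rC) (d : hom V V) : phi_deep d ->
  forall a b, support_interval d a b -> exists z, Defs.arc z (phi z) `<=` Defs.arc a b.
Proof.
move=> dgood a b [m [n [x [y [iV [iW [_ _ [i [j [aE bE /andP[ab _] dE]]] _]]]]]]].
exists a.
have : deep (gap (x i)) (component (rcomp iW (rcomp d iV)) j i).
  apply: divr_deep; first exact: gap_ge0.
  rewrite componentE.
  have -> : outsum t y j ** (rcomp iW (rcomp d iV) : hom _ _) ** insum t x i =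
    outsum t y j ** (iW : hom _ _) ** (d ** ((iV : hom _ _) ** insum t x i)).
    by rewrite !mcompA.
  exact/divr_compl/dgood.
have [u [uU aa ->]] := depth_fin R_dvr t_unif dE.
move=> /(deep_bound R_dvr t_unif aa uU); rewrite (gap_lift phi aE) lerD2r => le.
move=> _ [z /= zI <-]; exists z => //=; move: zI; rewrite !in_itv /=.
by move=> /andP[-> /le_trans]; exact.
Qed.

(** It is enough to bound the depths of the entries with unit coefficient in one
    decomposition. Each of them gives a candidate, every candidate contains a
    minimal one, and this contains some [z, phi z] by hypothesis. *)
Lemma support_phi_deep (V : rC) (d : hom V V) : has_dual_basis V ->
  (forall a b, support_interval d a b ->
    exists z, Defs.arc z (phi z) `<=` Defs.arc a b) -> phi_deep d.
Proof.
move=> gV supp; have [n [y [i [j [ij ji]]]]] := dual_basis_free R_dvr t_unif gV.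
pose D : rhom (freeSum t y) (freeSum t y) := rcomp j (rcomp d i).
have DE l k : component D l k = outsum t y l ** j ** d ** i ** insum t y k.
  by rewrite componentE !mcompA.
apply: (@phi_deep_basis V d 'I_n y (fun k => outsum t y k ** j) (fun k => i ** insum t y k)).
  under eq_bigr do rewrite mcompA -[X in X ** j]mcompA.
  by rewrite -mcomp_suml -mcomp_sumr sum_inout mcompm1.
move=> k; have -> : d ** (i ** insum t y k) =
    \sum_l i ** insum t y l ** component D l k.
  transitivity (i ** (\sum_l insum t y l ** outsum t y l) ** (j ** (d ** i ** insum t y k))).
    by rewrite sum_inout mcompm1 !mcompA ij mcomp1m.
  by rewrite mcomp_sumr mcomp_suml; apply: eq_bigr => l _; rewrite DE !mcompA.
apply: divr_sum => l _; apply/divr_compl/deep_divr; first exact: gap_ge0.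
have [U0|] := boolP (coeff (component D l k) \is a GRing.unit); last first.
  move=> nU; apply: (deep_nonunit t_unif nU); exact/ltW/gap_lt.
pose th (lk : 'I_n * 'I_n) := angle (y lk.1 - y lk.2).
pose a (lk : 'I_n * 'I_n) := angle (y lk.2).
pose b (lk : 'I_n * 'I_n) := a lk + th lk.
have bE lk : cls (b lk) = y lk.1 by rewrite /b clsD !angleK addrC subrK.
have th_itv lk : 0 <= th lk < tau by exact: angle_itv.
(* The candidates whose arc is contained in that of the (l, k) entry; a shortest
   one is minimal for inclusion. *)
pose U (lk : 'I_n * 'I_n) := (coeff (component D lk.1 lk.2) \is a GRing.unit) &&
  `[< Defs.arc (a lk) (b lk) `<=` Defs.arc (a (l, k)) (b (l, k)) >].
have U0' : U (l, k) by rewrite /U U0 /=; exact/asboolP.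
case: (@arg_minP _ _ _ (l, k) U th U0') => lk Ulk minlk.
have /andP[unit_lk /asboolP sub_lk] := Ulk.
have cand lk' : coeff (component D lk'.1 lk'.2) \is a GRing.unit ->
    support_candidate D (a lk') (b lk').
  move=> cU; exists lk'.2, lk'.1; split.
  - exact: angleK.
  - exact: bE.
  - by have := th_itv lk'; rewrite /b; lra.
  rewrite (hom_slide (component D lk'.1 lk'.2)).
  have -> : b lk' - a lk' = th lk' by rewrite /b; lra.
  exact: (depth_unit R_dvr t_unif cU (is_depth_angle _ _)).
have [z zsub] : exists z, Defs.arc z (phi z) `<=` Defs.arc (a lk) (b lk).
  apply: supp; exists n, n, y, y, i, j; split.
  - by exists j.
  - by exists i.
  - exact: cand.
  move=> a' b' [k' [l' [aE' bE' /andP[ab' ab'']]]] dE' sub'.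
  have [u [uU aa' cE']] := depth_fin R_dvr t_unif dE'.
  have thE : b' - a' = th (l', k') by apply: (is_depth_small aa'); lra.
  have [m mE] : exists m : int, a (l', k') = a' + tau * m%:~R.
    by apply/clsP; rewrite angleK.
  have mE' : b (l', k') = b' + tau * m%:~R by rewrite /b -thE mE; lra.
  have U' : U (l', k').
    apply/andP; split.
      change (coeff (component D l' k') \is a GRing.unit).
      have -> : component D l' k' = u *: slide t (y k') (y l') (b' - a') by exact: cE'.
      by rewrite coeffZ coeff_slide ?mulr1 //; lra.
    by apply/asboolP; rewrite mE mE' arc_turns; exact: subset_trans sub_lk.
  have := minlk _ U'; rewrite -thE => le.
  have tlk := th_itv lk.
  have lt : b lk < a lk + tau by rewrite /b; lra.
  have [q [q1 q2]] := arc_sub ab' lt sub'.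
  rewrite -(arc_turns a' b' q); congr (Defs.arc _ _); move: q1 q2 le; rewrite /b; lra.
have zz : z <= phi z by case/andP: (homeo_bound phi z).
have lt : b (l, k) < a (l, k) + tau by have := th_itv (l, k); rewrite /b; lra.
have [q [q1 q2]] := arc_sub zz lt (subset_trans zsub sub_lk).
have := homeo_mono phi q1; rewrite homeo_shift => q3.
exists (coeff (component D l k)), (th (l, k)); split.
- exact: is_depth_angle.
- by rewrite (gap_lift phi (angleK (y k))); move: q2 q3; rewrite /b /a /=; lra.
- exact: hom_slide.
Qed.

End Objects.

(** * Objects and morphisms of the Frobenius category *)

Section EndoHom.
Variables (k : comNzRingType) (C : linCat k) (X Y : endoObj C).
Lemma ehom_valD (f g : ehom X Y) : ehom_val (f + g) = ehom_val f + ehom_val g.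
Proof. by []. Qed.
Lemma ehom_valZ a (f : ehom X Y) : ehom_val (a *: f) = a *: ehom_val f.
Proof. by []. Qed.
Lemma ehom_val0 : ehom_val (0 : ehom X Y) = 0.
Proof. by []. Qed.
End EndoHom.

(** Stated for arbitrary categories, where it holds by computation at once; in the
    concrete one the unfolding is expensive. *)
Lemma full_ehom_comp (k : comNzRingType) (C : linCat k) (A : endoCat C -> Prop)
    (B : fullCat A -> Prop) (X Y Z : fullCat B) (g : mor Y Z) (f : mor X Y) :
  ehom_val (g ** f) = ehom_val g ** ehom_val f.
Proof. by []. Qed.
Lemma full_ehom_id (k : comNzRingType) (C : linCat k) (A : endoCat C -> Prop)
    (B : fullCat A -> Prop) (X : fullCat B) :
  ehom_val (idm X) = idm _.
Proof. by []. Qed.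

Section Category.
Variables (RR : realType) (R : idomainType) (t : R) (phi : lineHomeo RR).
Hypothesis R_dvr : discrete_valuation_ring R.
Hypothesis t_unif : uniformizer t.
Notation S1 := (S1 RR).
Notation rC := (repCat RR t).
Notation P := (freeRep t : S1 -> rC).
Notation hom := (@mor R rC).
Notation tau := (@twopi RR).
Let t_neq0 := unif_neq0 R_dvr t_unif.
Notation gap := (gap phi).
Notation FC := (F_phi t phi).

Definition carrier (A : FC) : rC := eobj (sval (sval A)).
Definition dmap (A : FC) : hom (carrier A) (carrier A) := edif (sval (sval A)).

Lemma carrier_dual_basis A : has_dual_basis (carrier A).
Proof. by case: (svalP (sval A)) => fg pr _; exact: fg_projective_dual_basis. Qed.

Lemma dmap_sq A : dmap A ** dmap A = t *: idm (carrier A).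
Proof. by case: (svalP (sval A)). Qed.

Lemma dmap_phi_deep A : phi_deep phi (dmap A).
Proof.
exact: (support_phi_deep R_dvr t_unif (carrier_dual_basis A) (svalP A)).
Qed.

Section Build.
Variables (V : rC) (d : hom V V).
Hypotheses (gV : has_dual_basis V) (dd : d ** d = t *: idm V) (pd : phi_deep phi d).

Fact build_pi : [/\ finitely_generated V, rep_projective V & d ** d = t *: idm V].
Proof. by split=> //; [exact: dual_basis_fg|exact: dual_basis_projective]. Qed.

Definition build_obj : FC :=
  exist _ (exist _ (existT (fun V : rC => hom V V) V d) build_pi)
    (phi_deep_support R_dvr t_unif pd).
End Build.

Definition fval A B (f : mor A B) : hom (carrier A) (carrier B) := ehom_val f.

Lemma fval_comm A B (f : mor A B) : fval f ** dmap A = dmap B ** fval f.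
Proof. exact: (eqP (ehomP f)). Qed.

Lemma fval_inj A B : injective (@fval A B).
Proof. by move=> f g; exact: val_inj. Qed.

Definition mkmor A B (f : hom (carrier A) (carrier B))
  (H : f ** dmap A = dmap B ** f) : mor A B := EHom (introT eqP H).

Lemma fval_comp A B C (g : mor B C) (f : mor A B) : fval (g ** f) = fval g ** fval f.
Proof. exact: (full_ehom_comp g f). Qed.
Lemma fval_id A : fval (idm A) = idm (carrier A).
Proof. exact: (full_ehom_id A). Qed.
Lemma fvalD A B (f g : mor A B) : fval (f + g) = fval f + fval g.
Proof. exact: (@ehom_valD R rC). Qed.
Lemma fvalZ A B a (f : mor A B) : fval (a *: f) = a *: fval f.
Proof. exact: (@ehom_valZ R rC). Qed.
Lemma fval0 A B : fval (0 : mor A B) = 0.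
Proof. exact: (@ehom_val0 R rC). Qed.

Lemma carrier_tf A : torsion_free (carrier A).
Proof. exact: dual_basis_torsion_free t_neq0 (carrier_dual_basis A). Qed.

(** The two points of an indecomposable, indexed by the parity that also indexes the
    signs of the morphisms b_+ (false) and b_- (true). *)
Definition pt (b : bool) (x : indObj phi) : S1 := if b then pt1 x else pt0 x.

(** The lengths of the two arcs into which the points cut the circle. If the
    points coincide, the arcs have lengths 0 and 2 pi. *)
Definition arc_len (x : indObj phi) (b : bool) : RR :=
  if b then tau - angle (pt1 x - pt0 x) else angle (pt1 x - pt0 x).

Lemma arc_len_depth x b : is_depth (pt b x) (pt (~~ b) x) (arc_len x b).
Proof.
case: b => /=; last exact: is_depth_angle.
apply: is_depth_back; first exact: is_depth_angle.
by have /andP[_ /ltW] := angle_itv (pt1 x - pt0 x).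
Qed.

Lemma arc_lenN x b : arc_len x b + arc_len x (~~ b) = tau.
Proof. by case: b => /=; lra. Qed.

(** This is the condition x0 <= phi x0 <= x1 <= phi^-1 (x0 + 2 pi). In the
    degenerate case x1 = x0 + 2 pi it forces phi x0 = x0. *)
Lemma gap_arc_len x b : gap (pt b x) <= arc_len x b.
Proof.
have [x0 [x1 [x0E x1E [/andP[h1 h2] h3]]]] := indObjP x.
set psi := homeo_inv phi in h3; have t0 := twopi_gt0 RR.
have p2 := homeo_mono phi h3; rewrite homeo_invK in p2.
have p1 : x1 <= phi x1 by case/andP: (homeo_bound phi x1).
have aa : is_depth (pt0 x) (pt1 x) (x1 - x0) by apply: is_depth_lift => //; lra.
case: (ltP (x1 - x0) tau) => lt.
  have lE := is_depth_small aa lt.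
  by case: b; rewrite /= ?(gap_lift phi x0E) ?(gap_lift phi x1E) -lE; lra.
have x1x0 : x1 = x0 + tau by lra.
have E : pt1 x = pt0 x by rewrite -x1E x1x0 -x0E cls_turn.
rewrite /arc_len E angle_self; case: b; rewrite /= ?E (gap_lift phi x0E).
  by have := gap_lt phi (pt0 x); rewrite (gap_lift phi x0E); lra.
by move: p2; rewrite x1x0 -[tau]mulr1 -[1]/(1%:~R) homeo_shift; lra.
Qed.

Section EObject.
Variables (n : nat) (X : 'I_n -> indObj phi).

Definition ept (a : 'I_n * bool) : S1 := pt a.2 (X a.1).
Definition erep : rC := freeFam t ept.
(** The generators of the sum of the E(X k), two for every k. *)
Definition ein k b : hom (P (pt b (X k))) erep := finj t ept (k, b).
Definition eout k b : hom erep (P (pt b (X k))) := fprj t ept (k, b).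

Lemma einK k b : eout k b ** ein k b = idm (P (pt b (X k))).
Proof. exact: (injK t ept (k, b)). Qed.

Lemma ein_neq k b k' b' : (k, b) != (k', b') -> eout k' b' ** ein k b = 0.
Proof. exact: inj_neq. Qed.

Lemma ein_neqb k b k' : eout k' (~~ b) ** ein k b = 0.
Proof. by apply: ein_neq; rewrite xpair_eqE; case: b; rewrite andbF. Qed.

Lemma ein_neqk k b k' b' : k != k' -> eout k' b' ** ein k b = 0.
Proof. by move=> kk; apply: ein_neq; rewrite xpair_eqE (negbTE kk). Qed.

Lemma sum_ein : \sum_k \sum_b ein k b ** eout k b = idm erep.
Proof.
rewrite -(sum_finjprj t ept) pair_bigA /=.
by apply: eq_bigr => -[k b] _.
Qed.

Lemma sum_eout_ein (V : rC) (f : forall k b, hom V (P (pt b (X k)))) k b :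
  eout k b ** (\sum_i \sum_c ein i c ** f i c) = f k b.
Proof.
rewrite mcomp_sumr (bigD1 k) //= mcomp_sumr (bigD1 b) //= mcompA einK mcomp1m.
rewrite !big1 ?addr0 // => [i ik|c cb].
  by rewrite mcomp_sumr big1 // => c _; rewrite mcompA ein_neqk // mcomp0l.
by rewrite mcompA ein_neq ?mcomp0l // xpair_eqE negb_and cb orbT.
Qed.

Lemma sum_ein_eout (V : rC) (f : forall k b, hom (P (pt b (X k))) V) k b :
  (\sum_i \sum_c f i c ** eout i c) ** ein k b = f k b.
Proof.
rewrite mcomp_suml (bigD1 k) //= mcomp_suml (bigD1 b) //= -mcompA einK mcompm1.
rewrite !big1 ?addr0 // => [i ik|c cb].
  by rewrite mcomp_suml big1 // => c _; rewrite -mcompA ein_neqk 1?eq_sym // mcomp0r.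
by rewrite -mcompA ein_neq ?mcomp0r // xpair_eqE negb_and [b == c]eq_sym cb orbT.
Qed.

Lemma ein_ext (V : rC) (f g : hom erep V) :
  (forall k b, f ** ein k b = g ** ein k b) -> f = g.
Proof.
move=> fg; rewrite -[f]mcompm1 -[g]mcompm1 -sum_ein !mcomp_sumr; apply: eq_bigr => k _.
by rewrite !mcomp_sumr; apply: eq_bigr => b _; rewrite !mcompA fg.
Qed.

Lemma eout_ext (V : rC) (f g : hom V erep) :
  (forall k b, eout k b ** f = eout k b ** g) -> f = g.
Proof.
move=> fg; rewrite -[f]mcomp1m -[g]mcomp1m -sum_ein !mcomp_suml; apply: eq_bigr => k _.
by rewrite !mcomp_suml; apply: eq_bigr => b _; rewrite -!mcompA fg.
Qed.

Definition eslide k b : hom (P (pt b (X k))) (P (pt (~~ b) (X k))) :=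
  slide t (pt b (X k)) (pt (~~ b) (X k)) (arc_len (X k) b).

(** On every summand, d moves each of the two generators to the other one, along
    the arc between them. *)
Definition ed : hom erep erep := locked_with opaque_key
  (\sum_k \sum_b (ein k (~~ b) ** eslide k b) ** eout k b).

Lemma ed_ein k b : ed ** ein k b = ein k (~~ b) ** eslide k b.
Proof.
by rewrite /ed locked_withE (sum_ein_eout (fun k b => ein k (~~ b) ** eslide k b)).
Qed.

Lemma ed_einT k : ed ** ein k true = ein k false ** eslide k true.
Proof. exact: ed_ein. Qed.
Lemma ed_einF k : ed ** ein k false = ein k true ** eslide k false.
Proof. exact: ed_ein. Qed.

Lemma eslideTF k : eslide k true ** eslide k false = t *: idm (P (pt false (X k))).
Proof.
have := slide_comp t (arc_len_depth (X k) false) (arc_len_depth (X k) true).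
by rewrite (arc_lenN (X k) false) slide_turn.
Qed.

Lemma eslideFT k : eslide k false ** eslide k true = t *: idm (P (pt true (X k))).
Proof.
have := slide_comp t (arc_len_depth (X k) true) (arc_len_depth (X k) false).
by rewrite (arc_lenN (X k) true) slide_turn.
Qed.

Lemma eout_dT k : eout k true ** ed = eslide k false ** eout k false.
Proof.
apply: ein_ext => i b; rewrite -!mcompA ed_ein mcompA.
case: (eqVneq i k) => [->|ik]; last by rewrite !ein_neqk // mcomp0l mcomp0r.
case: b; last by rewrite !einK mcomp1m mcompm1.
by rewrite (ein_neqb k false) (ein_neqb k true) mcomp0l mcomp0r.
Qed.

Lemma eout_dF k : eout k false ** ed = eslide k true ** eout k true.
Proof.
apply: ein_ext => i b; rewrite -!mcompA ed_ein mcompA.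
case: (eqVneq i k) => [->|ik]; last by rewrite !ein_neqk // mcomp0l mcomp0r.
case: b; first by rewrite !einK mcomp1m mcompm1.
by rewrite (ein_neqb k false) (ein_neqb k true) mcomp0l mcomp0r.
Qed.

Lemma ed_sq : ed ** ed = t *: idm erep.
Proof.
apply: ein_ext => k b; rewrite mcompZl mcomp1m -mcompA; case: b.
  by rewrite ed_einT mcompA ed_einF -mcompA eslideFT mcompZr mcompm1.
by rewrite ed_einF mcompA ed_einT -mcompA eslideTF mcompZr mcompm1.
Qed.

Lemma ed_phi_deep : phi_deep phi ed.
Proof.
apply: (@phi_deep_basis _ _ _ _ _ _ _ ept (fun a => eout a.1 a.2) (fun a => ein a.1 a.2)).
  by rewrite -sum_ein pair_bigA.
move=> [k b]; rewrite ed_ein; apply: divr_compl.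
apply: (divr_le (gap_ge0 _ _) (gap_arc_len (X k) b)).
by apply/(divrP _ (arc_len_depth (X k) b)); exists (idm _); rewrite mcomp1m.
Qed.

Definition eobject : FC := build_obj (freeFam_dual_basis t ept) ed_sq ed_phi_deep.

(** Compatibility with d at the first generators is enough: at the second ones
    it follows after composition with a slide, which can be cancelled. *)
Lemma map_from_E (A : FC) (v : forall k, hom (P (pt false (X k))) (carrier A))
    (w : forall k, hom (P (pt true (X k))) (carrier A)) :
  (forall k, dmap A ** v k = w k ** eslide k false) ->
  exists h : mor eobject A, forall k,
    fval h ** ein k false = v k /\ fval h ** ein k true = w k.
Proof.
move=> vw.
pose f k b : hom (P (pt b (X k))) (carrier A) :=
  match b with true => w k | false => v k end.
pose g : hom erep (carrier A) := \sum_k \sum_b f k b ** eout k b.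
have gE k b : g ** ein k b = f k b by exact: sum_ein_eout.
have gd : g ** ed = dmap A ** g.
  apply: ein_ext => k b; rewrite -[g ** ed ** _]mcompA -[dmap A ** g ** _]mcompA.
  rewrite ed_ein mcompA !gE.
  case: b => /=; last by rewrite vw.
  apply: (slide_cancel_r (@carrier_tf A) (arc_len_depth (X k) false)).
  rewrite -/(eslide k false) -!mcompA -vw mcompA.
  by rewrite -mcompA eslideTF mcompA dmap_sq mcompZl mcompZr mcomp1m mcompm1.
by exists (mkmor (gd : g ** dmap eobject = _)) => k; split; exact: gE.
Qed.

(** Dual to map_from_E. *)
Lemma map_to_E (A : FC) (r : forall k, hom (carrier A) (P (pt false (X k))))
    (s : forall k, hom (carrier A) (P (pt true (X k)))) :
  (forall k, s k ** dmap A = eslide k false ** r k) ->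
  exists h : mor A eobject, forall k,
    eout k false ** fval h = r k /\ eout k true ** fval h = s k.
Proof.
move=> rs.
pose f k b : hom (carrier A) (P (pt b (X k))) :=
  match b with true => s k | false => r k end.
pose g : hom (carrier A) erep := \sum_k \sum_b ein k b ** f k b.
have gE k b : eout k b ** g = f k b by exact: sum_eout_ein.
have gd : g ** dmap A = ed ** g.
  apply: eout_ext => k b; rewrite !mcompA !gE; case: b => /=.
    by rewrite eout_dT -mcompA gE /= rs.
  rewrite eout_dF -mcompA gE /=.
  apply: (slide_cancel_l t_neq0 (arc_len_depth (X k) false)).
  rewrite -/(eslide k false) !mcompA -rs eslideFT -mcompA dmap_sq.
  by rewrite mcompZl mcompZr mcomp1m mcompm1.
by exists (mkmor (gd : _ = dmap eobject ** g)) => k; split; exact: gE.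
Qed.

End EObject.

End Category.

(** * Projective-injective objects *)

Section Hulls.
Variables (RR : realType) (R : idomainType) (t : R) (phi : lineHomeo RR).
Hypothesis R_dvr : discrete_valuation_ring R.
Hypothesis t_unif : uniformizer t.
Notation S1 := (S1 RR).
Notation rC := (repCat RR t).
Notation P := (freeRep t : S1 -> rC).
Notation hom := (@mor R rC).
Notation tau := (@twopi RR).
Let t_neq0 := unif_neq0 R_dvr t_unif.
Notation gap := (gap phi).
Notation FC := (F_phi t phi).
Notation eobject := (eobject R_dvr t_unif).
Notation psi := (homeo_inv phi).

Fact hull_subproof (p : S1) : exists x0 x1, [/\ cls x0 = p, cls x1 = p + cls (gap p) &
  x0 <= phi x0 <= x1 /\ x1 <= psi (x0 + tau)].
Proof.
exists (angle p), (phi (angle p)); split; first exact: angleK.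
  by rewrite -{2}(angleK p) -clsD /gap addrC subrK.
split; first by case/andP: (homeo_bound phi (angle p)) => ->; rewrite lexx.
rewrite -[X in X <= _](homeo_funK phi); apply: homeo_inv_mono.
have /andP[_ h1] := homeo_bound phi (angle p).
have /andP[_ h2] := homeo_bound phi (phi (angle p)).
by rewrite /twopi; lra.
Qed.

(** The indecomposable E(p, phi p). *)
Definition hull p : indObj phi := IndObj (hull_subproof p).

Lemma hull_depth p : is_depth (pt false (hull p)) (pt true (hull p)) (gap p).
Proof. exact/is_depth_end/gap_ge0. Qed.

Lemma arc_len_hull p : arc_len (hull p) false = gap p.
Proof. by rewrite [RHS](is_depth_small (hull_depth p)) // gap_lt. Qed.

(** A morphism from a sum of hulls is a family of elements of the fibres over the
    first points: phi_deep provides the images of the second generators.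
    Elements lift along epimorphisms. *)
Lemma hull_exact_projective n (W : 'I_n -> S1) :
  exact_projective (@F_phi_exact _ _ t phi) (eobject (fun k => hull (W k))).
Proof.
move=> A B C f g [_ _ gepi] h.
have lift k : exists v : hom (P (pt false (hull (W k)))) (carrier B),
    fval g ** v = fval h ** ein t _ k false by exact: free_lift.
have turn k : exists w : hom (P (pt true (hull (W k)))) (carrier B),
    dmap B ** sval (cid (lift k)) = w ** eslide t (fun k => hull (W k)) k false.
  rewrite /eslide arc_len_hull; apply/(divrP _ (hull_depth (W k))).
  exact: dmap_phi_deep.
have [h' h'E] := map_from_E R_dvr t_unif (fun k => svalP (cid (turn k))).
have gF k : fval g ** (fval h' ** ein t _ k false) = fval h ** ein t _ k false.
  by have [-> _] := h'E k; exact: (svalP (cid (lift k))).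
exists h'; apply: fval_inj; rewrite fval_comp; apply: ein_ext => k [].
  apply: (slide_cancel_r (carrier_tf R_dvr t_unif (A := C)) (arc_len_depth (hull (W k)) false)).
  rewrite -/(eslide t (fun k => hull (W k)) k false) -!mcompA -ed_einF.
  rewrite [fval h' ** _]mcompA [fval h ** _]mcompA.
  rewrite (fval_comm h') (fval_comm h) !mcompA (fval_comm g) -!mcompA.
  by rewrite gF.
by rewrite -mcompA gF.
Qed.

(** The quotient is projective, so the sequence splits; the complementary projection
    of a splitting takes values in the kernel and lifts to U along a dual basis
    of V. *)
Lemma exact_retract (U V W : rC) (f : hom U V) (g : hom V W) :
  has_dual_basis V -> has_dual_basis W -> short_exact f g -> exists r, r ** f = idm U.
Proof.
move=> [T [x [s [e es]]]] gW [finj fg gepi].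
have [sg sgE] := dual_basis_projective gW gepi (idm W).
have {}sgE : (g : hom V W) ** (sg : hom W V) = idm W by exact: sgE.
pose c : hom V V := idm V - (sg : hom W V) ** g.
have gc : g ** c = 0 by rewrite mcompBr mcompm1 mcompA sgE mcomp1m subrr.
have gf : g ** f = 0.
  by apply: rhom_eq => p v; apply/fg; exists v.
have H a : exists u, f (x a) u = (c ** e a : rhom _ _) (x a) (freeGen t (x a)).
  apply/fg; transitivity ((g ** (c ** e a) : rhom _ _) (x a) (freeGen t (x a))) => //.
  by rewrite mcompA gc mcomp0l.
pose r : hom V U := \sum_a yoneda (sval (cid (H a))) ** s a.
have fr : f ** r = c.
  rewrite mcomp_sumr -[RHS]mcompm1 -es mcomp_sumr; apply: eq_bigr => a _.
  rewrite !mcompA; congr (_ ** _); apply: hom_gen_eq.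
  apply: etrans (svalP (cid (H a))); congr (f _ _); exact: yoneda_gen.
exists r; apply: rhom_eq => p v; apply: finj.
have : f ** (r ** f) = f.
  by rewrite mcompA fr mcompBl mcomp1m -mcompA gf mcomp0r subr0.
by move=> /(congr1 (fun h : hom U V => (h : rhom _ _) p v)).
Qed.

(** Let x lift the point of a basis element of A. The entry of g d there is a multiple
    of a slide that passes through phi x and ends at a lift phi z of q. Now
    phi x <= phi z implies x <= z, so its depth phi z - x is at least phi z - z. *)
Lemma dmap_divl (A : FC) p q (g : hom (carrier A) (P q)) : is_depth p q (gap p) ->
  divl (gap p) (g ** dmap A).
Proof.
move=> pq; have [T [x [s [f fs]]]] := carrier_dual_basis A.
rewrite -[g ** _]mcompm1 -fs mcomp_sumr; apply: divl_sum => a _.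
rewrite mcompA; apply/divl_compr/deep_divl; first exact: gap_ge0.
have [w wE] := dmap_phi_deep R_dvr t_unif (f a).
have wa := is_depth_end (x a) (gap_ge0 phi (x a)).
rewrite -mcompA wE mcompA (hom_slide (g ** w)) mcompZl (slide_comp _ wa (is_depth_angle _ _)).
set th := angle _; exists (coeff (g ** w)), (gap (x a) + th); split=> //.
  exact: is_depth_comp wa (is_depth_angle _ _).
have [xi xiE] := cls_surj (x a); have [z' z'E] := cls_surj p.
have gx := gap_lift phi (esym xiE).
have [n nE] : exists n : int, phi xi + th = phi z' + tau * n%:~R.
  apply/clsP; case: pq => _; rewrite (gap_lift phi (esym z'E)) clsB -z'E => /addIr ->.
  by rewrite clsD angleK gx clsB -xiE [x a + _]addrC subrK addrC subrK.
have th0 : 0 <= th by case/andP: (angle_itv (q - (x a + cls (gap (x a))))).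
(* The lift of p for which phi z is the end of the path of length th from phi xi. *)
pose z := z' + tau * n%:~R; have zE : cls z = p by rewrite cls_shift.
have phiz : phi z = phi xi + th by rewrite homeo_shift nE.
have : xi <= z.
  by rewrite -(homeo_funK phi xi) -(homeo_funK phi z); apply: homeo_inv_mono; lra.
by rewrite (gap_lift phi zE) gx; lra.
Qed.

(** A morphism to a sum of hulls is determined by its components to the second
    points, which can be arbitrary by dmap_divl; they extend along a retraction of
    representations, which need not commute with d. *)
Lemma hull_exact_injective n (W : 'I_n -> S1) :
  exact_injective (@F_phi_exact _ _ t phi) (eobject (fun k => hull (W k))).
Proof.
move=> A B C f g ex h; pose X k := hull (W k).
have [r rf] : exists r : hom (carrier B) (carrier A), r ** fval f = idm (carrier A).
  exact: exact_retract (carrier_dual_basis B) (carrier_dual_basis C) ex.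
have div k : exists w : hom (carrier B) (P (pt false (X k))),
    eout t X k true ** fval h ** r ** dmap B = eslide t X k false ** w.
  rewrite /eslide arc_len_hull; apply/(divlP _ (hull_depth (W k))).
  exact/dmap_divl/hull_depth.
have [h' h'E] := map_to_E R_dvr t_unif (fun k => svalP (cid (div k))).
have hT k : eout t X k true ** fval h' ** fval f = eout t X k true ** fval h.
  by have [_ ->] := h'E k; rewrite -mcompA rf mcompm1.
exists h'; apply: fval_inj; rewrite fval_comp; apply: eout_ext => k [].
  by rewrite mcompA hT.
apply: (slide_cancel_l t_neq0 (arc_len_depth (X k) false)).
rewrite -/(eslide t X k false) !mcompA -eout_dT.
rewrite -[_ ** ed _ _ ** fval h']mcompA -[_ ** ed _ _ ** fval h]mcompA.
rewrite -[ed _ _ ** _](fval_comm h') -[ed _ _ ** _](fval_comm h).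
by rewrite !mcompA -hT -!mcompA (fval_comm f).
Qed.

Lemma hull_projinj n (W : 'I_n -> S1) :
  projective_injective (@F_phi_exact _ _ t phi) (eobject (fun k => hull (W k))).
Proof. by split; [exact: hull_exact_projective|exact: hull_exact_injective]. Qed.

(** Every basis element e of A over p gives a morphism from the hull of p, and these
    form an epimorphism, split over representations by e_p. Its kernel is free on
    the second generators, corrected by the splitting. *)
Lemma hull_cover (A : FC) : exists n (W : 'I_n -> S1) (B : FC)
  (j : mor B (eobject (fun k => hull (W k)))) (p : mor (eobject (fun k => hull (W k))) A),
  F_phi_exact j p.
Proof.
have [n [y [i [i' [ii' i'i]]]]] := dual_basis_free R_dvr t_unif (carrier_dual_basis A).
pose X k := hull (y k).
pose f k : hom (P (pt false (X k))) (carrier A) := i ** insum t y k.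
pose s k : hom (carrier A) (P (pt false (X k))) := outsum t y k ** i'.
have sfE k l : s l ** f k = outsum t y l ** insum t y k.
  by rewrite /s /f mcompA -[_ ** i' ** i]mcompA i'i mcompm1.
have fs : \sum_k f k ** s k = idm (carrier A).
  rewrite /f /s; under eq_bigr do rewrite mcompA -[X in X ** i']mcompA.
  by rewrite -mcomp_suml -mcomp_sumr sum_inout mcompm1.
have turn k : exists w : hom (P (pt true (X k))) (carrier A),
    dmap A ** f k = w ** eslide t X k false.
  rewrite /eslide arc_len_hull; apply/(divrP _ (hull_depth (y k))).
  exact: dmap_phi_deep.
have [p pE] := map_from_E R_dvr t_unif (fun k => svalP (cid (turn k))).
pose E := eobject X.
pose sg : hom (carrier A) (carrier E) := \sum_k ein t X k false ** s k.
have psg : fval p ** sg = idm (carrier A).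
  rewrite -fs mcomp_sumr; apply: eq_bigr => k _; rewrite mcompA.
  by have [-> _] := pE k.
pose c : hom (carrier E) (carrier E) := idm (carrier E) - sg ** fval p.
have pc : fval p ** c = 0 by rewrite mcompBr mcompm1 mcompA psg mcomp1m subrr.
pose x k := pt true (X k).
pose j : hom (freeFam t x) (carrier E) := c ** \sum_k ein t X k true ** fprj t x k.
pose q : hom (carrier E) (freeFam t x) := \sum_k finj t x k ** eout t X k true.
have qsg : q ** sg = 0.
  rewrite mcomp_suml big1 // => k _; rewrite -mcompA mcomp_sumr big1 ?mcomp0r // => l _.
  by rewrite mcompA (ein_neq t X (_ : (l, false) != (k, true))) ?mcomp0l // xpair_eqE andbF.
have qc : q ** c = q by rewrite mcompBr mcompm1 mcompA qsg mcomp0l subr0.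
have qj : q ** j = idm (freeFam t x).
  rewrite mcompA qc -(sum_finjprj t x) mcomp_suml; apply: eq_bigr => k _.
  rewrite -mcompA; congr (_ ** _); rewrite mcomp_sumr (bigD1 k) //= mcompA.
  rewrite (einK t X k true) mcomp1m big1 ?addr0 // => l lk.
  by rewrite mcompA (ein_neqk t X true true lk) mcomp0l.
have csg : c ** sg = 0 by rewrite mcompBl mcomp1m -mcompA psg mcompm1 subrr.
have sgf k : sg ** f k = ein t X k false.
  rewrite mcomp_suml (bigD1 k) //= -mcompA sfE insumK mcompm1.
  by rewrite big1 ?addr0 // => l lk; rewrite -mcompA sfE insum_neq 1?eq_sym // mcomp0r.
have cF k : c ** ein t X k false = 0 by rewrite -sgf mcompA csg mcomp0l.
have fq k : fprj t x k ** q = eout t X k true by exact: sum_fprj.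
have jq : j ** q = c.
  rewrite -[RHS]mcompm1 -(sum_ein t X) -mcompA mcomp_suml !mcomp_sumr.
  apply: eq_bigr => k _; rewrite big_bool /= mcompDr [c ** (ein t X k false ** _)]mcompA.
  by rewrite cF mcomp0l addr0 -(mcompA (ein t X k true)) fq.
pose D := dmap E.
have pj : fval p ** j = 0 by rewrite mcompA pc mcomp0l.
(* From here on only these equations matter; the bodies would slow down rewriting. *)
have cE : c = idm (carrier E) - sg ** fval p by [].
clearbody j q c sg.
have cDj : c ** (D ** j) = D ** j.
  rewrite {1}cE mcompBl mcomp1m -mcompA [fval p ** _]mcompA (fval_comm p) -mcompA pj.
  by rewrite !mcomp0r subr0.
pose d := q ** (D ** j).
have dd : d ** d = t *: idm (freeFam t x).
  rewrite /d -!mcompA [j ** _]mcompA jq cDj [D ** (D ** _)]mcompA dmap_sq.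
  by rewrite mcompZl mcomp1m mcompZr qj.
have pd : phi_deep phi d.
  by move=> p0 v; rewrite /d -!mcompA; apply/divr_compl/dmap_phi_deep.
pose B : FC := build_obj R_dvr t_unif (freeFam_dual_basis t x) dd pd.
have jd : j ** d = D ** j by rewrite /d mcompA jq cDj.
have ap (U V : rC) (f1 f2 : hom U V) : f1 = f2 -> forall p0 v,
    (f1 : rhom U V) p0 v = (f2 : rhom U V) p0 v by move=> ->.
exists n, y, B, (@mkmor _ _ _ _ B E j jd), p; split.
- move=> p0 v1 v2 /(congr1 ((q : rhom _ _) p0)) E12.
  have := ap _ _ _ _ qj p0; move=> qjE.
  by rewrite -[v1]qjE -[v2]qjE.
- move=> p0 v; split=> [pv|[u <-]]; last exact: (ap _ _ _ _ pj p0 u).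
  exists ((q : rhom _ _) p0 v); transitivity ((c : rhom _ _) p0 v).
    exact: (ap _ _ _ _ jq p0 v).
  have cE1 : c + sg ** fval p = idm (carrier E) by rewrite cE subrK.
  have cE' : (c : rhom _ _) p0 v + (sg : rhom _ _) p0 ((fval p : rhom _ _) p0 v) = v.
    exact: (ap _ _ _ _ cE1 p0 v).
  have pv0 : (fval p : rhom _ _) p0 v = 0 := pv.
  by rewrite -[RHS]cE' pv0 rhom0 addr0.
- by move=> p0 w; exists ((sg : rhom _ _) p0 w); exact: (ap _ _ _ _ psg p0 w).
Qed.

End Hulls.

(** * Entries of morphisms between sums of E(X) *)

Section Coefficients.
Variables (RR : realType) (R : idomainType) (t : R) (phi : lineHomeo RR).
Hypothesis R_dvr : discrete_valuation_ring R.
Hypothesis t_unif : uniformizer t.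
Notation S1 := (S1 RR).
Notation rC := (repCat RR t).
Notation P := (freeRep t : S1 -> rC).
Notation hom := (@mor R rC).
Notation tau := (@twopi RR).
Let t_neq0 := unif_neq0 R_dvr t_unif.
Notation psi := (homeo_inv phi).

Lemma eout_d n (X : 'I_n -> indObj phi) k b :
  eout t X k (~~ b) ** ed t X = eslide t X k b ** eout t X k b.
Proof. by case: b; [exact: eout_dF|exact: eout_dT]. Qed.

Lemma turns_uniq (a b : RR) (i j : nat) : - tau < a - b < tau ->
  a + tau * i%:R = b + tau * j%:R -> i = j.
Proof.
move=> /andP[h1 h2] E; have t0 := twopi_gt0 RR.
by case: (ltngtP i j) => //; rewrite -(ler_nat RR) -(ler_pM2l t0) -natr1 => ij;
  exfalso; move: E ij; lra.
Qed.

Section Entries.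
Variables (n m : nat) (X : 'I_n -> indObj phi) (Y : 'I_m -> indObj phi).

Definition entry (F : hom (erep t X) (erep t Y)) l b k a :
  hom (P (pt a (X k))) (P (pt b (Y l))) := eout t Y l b ** F ** ein t X k a.

Lemma entry_comm (F : hom (erep t X) (erep t Y)) l b k a :
  F ** ed t X = ed t Y ** F ->
  eslide t Y l b ** entry F l b k a = entry F l (~~ b) k (~~ a) ** eslide t X k a.
Proof.
move=> Fd; rewrite /entry !mcompA -eout_d -[X in X ** ein _ _ _ _]mcompA -Fd.
by rewrite -!mcompA ed_ein.
Qed.

(** Commuting with d equates a slide of one entry with a slide of the opposite one;
    comparing depths, the less divisible coefficient is the common one. *)
Lemma entry_pair (F : hom (erep t X) (erep t Y)) l b k a :
  F ** ed t X = ed t Y ** F -> exists c al be,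
  [/\ is_depth (pt a (X k)) (pt b (Y l)) al, is_depth (pt (~~ a) (X k)) (pt (~~ b) (Y l)) be,
      al + arc_len (Y l) b = arc_len (X k) a + be,
      entry F l b k a = c *: slide t _ _ al
    & entry F l (~~ b) k (~~ a) = c *: slide t _ _ be].
Proof.
move=> Fd; have := entry_comm l b k a Fd.
set f := entry _ _ _ _ _; set g := entry _ _ _ _ _.
have A1 := is_depth_angle (pt a (X k)) (pt b (Y l)); set al := angle _ in A1.
have A2 := is_depth_angle (pt (~~ a) (X k)) (pt (~~ b) (Y l)); set be := angle _ in A2.
rewrite (hom_slide f) (hom_slide g) -/al -/be /eslide mcompZl mcompZr.
rewrite (slide_comp _ A1 (arc_len_depth (Y l) b)) (slide_comp _ (arc_len_depth (X k) a) A2).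
move=> E; have B1 := is_depth_comp A1 (arc_len_depth (Y l) b).
have B2 := is_depth_comp (arc_len_depth (X k) a) A2.
have [le|/ltW le] := leP (al + arc_len (Y l) b) (arc_len (X k) a + be).
  have [i iE cE] := slide_cmp t_neq0 B1 B2 le E.
  exists (coeff g), (al + tau * i%:R), be; split=> //; first exact: is_depthD.
    by move: iE; lra.
  by rewrite (slide_turns _ _ A1) scalerA cE.
have [i iE cE] := slide_cmp t_neq0 B2 B1 le (esym E).
exists (coeff f), al, (be + tau * i%:R); split=> //; first exact: is_depthD.
  by move: iE; lra.
by rewrite (slide_turns _ _ A2) scalerA cE.
Qed.

(** In terms of lifts with y0 >= x0 as small as possible, the hypothesis says
    y1 < x1. The common multiple of entry_pair then belongs to a larger y0, whose
    slide is divisible by t. *)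
Lemma entry_div (F : hom (erep t X) (erep t Y)) l b k a :
  F ** ed t X = ed t Y ** F ->
  angle (pt b (Y l) - pt a (X k)) + arc_len (Y l) b < arc_len (X k) a ->
  exists e, coeff (entry F l b k a) = e * t.
Proof.
move=> Fd; have [c [al [be [A1 [be0 _] E -> _]]]] := entry_pair l b k a Fd.
have [i iE] := is_depth_decomp A1 => lt.
case: i iE => [iE|i ->]; first by move: iE E; rewrite mulr0 addr0; lra.
exists (c * t ^+ i).
by rewrite slide_norm !coeffZ coeff_base mulr1 exprSr mulrA.
Qed.

(** In terms of lifts, x0 <= y0 < x0 + 2 pi and x1 <= y1 < x1 + 2 pi: both entries
    have their least possible depths, so the common coefficient is that of both. *)
Lemma entry_opp (F : hom (erep t X) (erep t Y)) l b k a :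
  F ** ed t X = ed t Y ** F ->
  0 <= angle (pt b (Y l) - pt a (X k)) + arc_len (Y l) b - arc_len (X k) a < tau ->
  coeff (entry F l b k a) = coeff (entry F l (~~ b) k (~~ a)).
Proof.
move=> Fd /andP[h1 h2].
have [c [al [be [A1 A2 E -> ->]]]] := entry_pair l b k a Fd.
have [i iE] := is_depth_decomp A1; have [j jE] := is_depth_decomp A2.
have /andP[b0 b1] := angle_itv (pt (~~ b) (Y l) - pt (~~ a) (X k)).
suff ij : i = j.
  by rewrite iE jE ij !slide_norm !coeffZ !coeff_base.
apply: (@turns_uniq (angle (pt b (Y l) - pt a (X k)) + arc_len (Y l) b - arc_len (X k) a)
  (angle (pt (~~ b) (Y l) - pt (~~ a) (X k)))); last by rewrite iE jE in E; lra.
by apply/andP; split; lra.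
Qed.


End Entries.

Lemma lifts_arc_len e (Y : indObj phi) y0 y1 : lifts e Y y0 y1 -> y0 < y1 ->
  y1 < y0 + tau -> arc_len Y e = y1 - y0.
Proof.
case=> c0 c1 h1 h2.
have aa : is_depth (pt e Y) (pt (~~ e) Y) (y1 - y0).
  by apply: is_depth_lift; [rewrite c0; case: (e)|rewrite c1; case: (e)|exact: ltW].
have E1 : y1 - y0 = angle (pt (~~ e) Y - pt e Y) by apply: is_depth_small aa _; lra.
case: e c0 c1 aa E1 => //= c0 c1 aa E1.
have ab : is_depth (pt0 Y) (pt1 Y) (y0 + tau - y1).
  by apply: is_depth_lift; [exact: c1|rewrite cls_turn; exact: c0|exact: ltW].
by rewrite -(is_depth_small ab); lra.
Qed.

Lemma lifts_pt e (Y : indObj phi) y0 y1 : cls y0 = pt e Y -> y1 = y0 + arc_len Y e ->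
  lifts e Y y0 y1.
Proof.
move=> y0E ->; have [_ gE] := arc_len_depth Y e.
have y1E : cls (y0 + arc_len Y e) = pt (~~ e) Y by rewrite clsD gE y0E addrC subrK.
by rewrite /lifts y1E y0E; case: (e).
Qed.

Lemma lifts_cls0 e (Y : indObj phi) y0 y1 : lifts e Y y0 y1 -> cls y0 = pt e Y.
Proof. by case=> ->; case: e. Qed.

(** A link may be read off from lifts of X in either order of its two points. *)
Lemma linked_below d e (X Y : indObj phi) x0 x1 y0 y1 : lifts d X x0 x1 ->
  lifts (d (+) e) Y y0 y1 -> below phi x0 x1 y0 y1 -> linked e X Y.
Proof.
case: d => Xx Yy xy; last by exists x0, x1, y0, y1.
exists x1, (x0 + tau), y1, (y0 + tau); split; last exact: below_swap.
  by case: Xx => ? ?; split; rewrite ?cls_turn.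
by case: Yy; case: (e) => ? ?; split; rewrite ?cls_turn.
Qed.

Lemma linked_lifts e (X Y : indObj phi) : linked e X Y -> exists x0 x1 y0 y1,
  [/\ lifts false X x0 x1, lifts e Y y0 y1, below phi x0 x1 y0 y1,
      y0 - x0 = angle (pt e Y - pt0 X) &
      [/\ arc_len X false = x1 - x0, arc_len Y e = y1 - y0 & 0 <= y1 - x1 < tau]].
Proof.
move=> [x0 [x1 [y0 [y1 [Xx Yy xy]]]]]; exists x0, x1, y0, y1.
have [a1 a2 a3 a4] := below_lt xy; case: (xy) => p1 p2 p3 p4.
have q1 := homeo_inv_le phi x1; have q2 := homeo_inv_le phi (x0 + tau).
split=> //.
  apply: is_depth_small; last by lra.
  by apply: is_depth_lift => //; [case: Xx|exact: lifts_cls0 Yy].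
by split; [exact: lifts_arc_len Xx _ _|exact: lifts_arc_len Yy _ _|apply/andP; split; lra].
Qed.

Lemma linked_arc_len e (X Y : indObj phi) : linked e X Y ->
  0 <= angle (pt e Y - pt false X) + arc_len Y e - arc_len X false < tau.
Proof.
move=> /linked_lifts[x0 [x1 [y0 [y1 [_ _ _ E [-> -> h]]]]]].
by rewrite -[pt false X]/(pt0 X) -E; lra.
Qed.


Section Composition.
Variables (K : fieldType) (rho : {rmorphism R -> K}).
Hypothesis K_res : is_residue_field t rho.

Lemma rho_mult (c : R) : rho (c * t) = 0.
Proof. by case: K_res => _ /(_ (c * t)) [_ H]; apply: H; exists c. Qed.

Lemma rho_dvd (c : R) : (exists e, c = e * t) -> rho c = 0.
Proof. by move=> [e ->]; exact: rho_mult. Qed.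

Lemma entry_linked n m (X : 'I_n -> indObj phi) (Y : 'I_m -> indObj phi)
    (F : hom (erep t X) (erep t Y)) i j e : F ** ed t X = ed t Y ** F ->
  linked e (X i) (Y j) ->
  coeff (entry F j e i false) = coeff (entry F j (~~ e) i true).
Proof. by move=> Fd /linked_arc_len h; exact: entry_opp. Qed.

Variables (n m l : nat).
Variables (X : 'I_n -> indObj phi) (Y : 'I_m -> indObj phi) (V : 'I_l -> indObj phi).
Variables (F : hom (erep t X) (erep t Y)) (G : hom (erep t Y) (erep t V)).
Hypotheses (Fd : F ** ed t X = ed t Y ** F) (Gd : G ** ed t Y = ed t V ** G).

(** The left side is nonzero only if the depths of the two entries add up without a
    full turn, that is x0 <= y0 <= z0 for suitable lifts, and if neither of them is
    divisible by t because of entry_div, that is x1 <= y1 <= z1. These inequalities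
    together with the link from X to V imply the links from X to Y and from Y
    to V. *)
Lemma entry_comp i j k b e : linked e (X i) (V k) ->
  rho (coeff (entry G k e j b ** entry F j b i false)) =
  if (hom_sign (X i) (Y j) == Some b) && (hom_sign (Y j) (V k) == Some (b (+) e))
  then rho (coeff (entry F j b i false)) * rho (coeff (entry G k (b (+) e) j false))
  else 0.
Proof.
move=> XV; rewrite coeff_comp rmorphM [in X in _ = if _ then X else _]mulrC.
have cE := carryE (pt false (X i)) (pt b (Y j)) (pt e (V k)).
set al := angle (pt b (Y j) - _) in cE; set th := angle (pt e (V k) - _) in cE.
case: ifP => [/andP[/eqP/hom_signP XY /eqP/hom_signP YV]|nlink].
  have [x0 [x1 [y0 [y1 [Xx Yy xy alE [_ _ _]]]]]] := linked_lifts XY.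
  have [a1 a2 a3 a4] := below_lt xy.
  have [z0 [z1 [Vz yz]]] := linked_from YV Yy a3 a4.
  have Vz' : lifts e (V k) z0 z1 by move: Vz; rewrite addbA addbb.
  have xz := linked_chain XV Xx Vz' xy yz.
  have q1 := homeo_inv_le phi x1; have q2 := homeo_inv_le phi y1.
  have thE : z0 - y0 = th.
    apply: is_depth_small; last by case: (yz) (xy) (xz) => ? ? ? ? [? ? ? ?] [? ? ? ?]; lra.
    apply: is_depth_lift; [exact: lifts_cls0 Yy|exact: lifts_cls0 Vz'|by case: yz].
  have zE : z0 - x0 = angle (pt e (V k) - pt false (X i)).
    apply: is_depth_small; last by case: (xz) => ? ? ? ?; lra.
    by apply: is_depth_lift; [case: Xx|exact: lifts_cls0 Vz'|case: xz].
  have -> : carry (pt false (X i)) (pt b (Y j)) (pt e (V k)) = 0%N.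
    apply/esym/(@turns_uniq (al + th) (al + th)); first by have := twopi_gt0 RR; lra.
    have alE' : y0 - x0 = al by exact: alE.
    by rewrite mulr0; move: cE; rewrite -zE -thE -alE'; lra.
  rewrite expr0 rmorph1 mul1r rmorphM; congr (_ * _).
  case: (b) YV => // YV; congr (rho _).
  have E := entry_linked Gd YV; rewrite /= in E *; rewrite E.
  by case: (e).
move: cE; case: (carry _ _ _) => [|c _]; last first.
  by rewrite exprSr rmorphM [rho t]rho_dvd ?mulr0 ?mul0r //; exists 1; rewrite mul1r.
rewrite mulr0 addr0 expr0 rmorph1 mul1r rmorphM => cE.
have [x0 [x1 [z0 [z1 [Xx Vz xz zE [glX glV h]]]]]] := linked_lifts XV.
have [a1 a2 a3 a4] := below_lt xz.
pose y0 := x0 + al; pose y1 := y0 + arc_len (Y j) b.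
have al0 : 0 <= al by case/andP: (angle_itv (pt b (Y j) - pt false (X i))).
have th0 : 0 <= th by case/andP: (angle_itv (pt e (V k) - pt b (Y j))).
have zE' : z0 = y0 + th by rewrite /y0; move: zE cE => /=; lra.
have y0E : cls y0 = pt b (Y j).
  by rewrite clsD angleK (lifts_cls0 Xx) addrC subrK.
have Yy : lifts b (Y j) y0 y1 by exact: lifts_pt.
case: (ltP y1 x1) => yx.
  rewrite [rho (coeff (entry F j b i false))]rho_dvd ?mulr0 //.
  by apply: entry_div Fd _; rewrite -/al glX; move: yx; rewrite /y1 /y0; lra.
case: (ltP z1 y1) => zy.
  rewrite [rho (coeff (entry G k e j b))]rho_dvd ?mul0r //.
  by apply: entry_div Gd _; rewrite -/th glV; move: zy zE'; rewrite /y1; lra.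
case: (xz) => p1 p2 p3 p4.
have xy : below phi x0 x1 y0 y1 by split=> //; rewrite ?/y0; lra.
have m1 := homeo_inv_mono phi yx.
have m2 : psi (x0 + tau) <= psi (y0 + tau) by apply: homeo_inv_mono; rewrite /y0; lra.
have yz : below phi y0 y1 z0 z1 by split=> //; lra.
have XY : linked b (X i) (Y j) by exact: linked_below Xx Yy xy.
have YV : linked (b (+) e) (Y j) (V k).
  by apply: linked_below Yy _ yz; rewrite addbA addbb.
by move/negP: nlink; case; apply/andP; split; apply/eqP/hom_signP.
Qed.

End Composition.
End Coefficients.

(** * Morphisms that vanish stably *)

Section Stable.
Variables (RR : realType) (R : idomainType) (t : R) (phi : lineHomeo RR).
Hypothesis R_dvr : discrete_valuation_ring R.
Hypothesis t_unif : uniformizer t.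
Notation S1 := (S1 RR).
Notation rC := (repCat RR t).
Notation hom := (@mor R rC).
Notation tau := (@twopi RR).
Notation gap := (gap phi).
Notation FC := (F_phi t phi).
Notation eobject := (eobject R_dvr t_unif).
Notation psi := (homeo_inv phi).

Definition stable_ideal : homIdeal FC :=
  factor_ideal (projective_injective (@F_phi_exact _ _ t phi)).

(** Stable vanishing as a predicate on morphisms of representations, so that it
    can be proved summand by summand. *)
Definition stably_zero n m (X : 'I_n -> indObj phi) (Y : 'I_m -> indObj phi)
    (F : hom (erep t X) (erep t Y)) :=
  exists2 f : mor (eobject X) (eobject Y), in_ideal stable_ideal f & fval f = F.

Section Homogeneous.
Variables (n m : nat) (X : 'I_n -> indObj phi) (Y : 'I_m -> indObj phi).
Implicit Types (k : 'I_n) (l : 'I_m) (e : bool).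

Lemma stably_zero_sum (I : Type) (r : seq I) (F : I -> hom (erep t X) (erep t Y)) :
  (forall i, stably_zero (F i)) -> stably_zero (\sum_(i <- r) F i).
Proof.
move=> nF; apply: big_ind => //.
  by exists 0; [exact: ideal0|exact: fval0].
move=> _ _ [f fI <-] [g gI <-]; exists (f + g); last exact: fvalD.
by rewrite -[f]scale1r; exact: ideal_lin.
Qed.

Lemma stably_zeroZ c (F : hom (erep t X) (erep t Y)) : stably_zero F -> stably_zero (c *: F).
Proof.
move=> [f fI <-]; exists (c *: f); last exact: fvalZ.
by rewrite -[_ *: _]addr0; apply: ideal_lin => //; exact: ideal0.
Qed.

(** For e = false the even and for e = true the odd homogeneous morphisms from the
    k-th to the l-th summand. *)
Definition homog k l e al be : hom (erep t X) (erep t Y) :=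
  (ein t Y l e ** slide t (pt false (X k)) (pt e (Y l)) al) ** eout t X k false +
  (ein t Y l (~~ e) ** slide t (pt true (X k)) (pt (~~ e) (Y l)) be) ** eout t X k true.

Lemma homog_einF k l e al be :
  homog k l e al be ** ein t X k false = ein t Y l e ** slide t _ _ al.
Proof.
rewrite mcompDl -!mcompA einK (ein_neqb t X k false) !mcompm1 !mcomp0r addr0.
by [].
Qed.

Lemma homog_einT k l e al be :
  homog k l e al be ** ein t X k true = ein t Y l (~~ e) ** slide t _ _ be.
Proof.
rewrite mcompDl -!mcompA einK (ein_neqb t X k true) !mcompm1 !mcomp0r add0r.
by [].
Qed.

Lemma homog_ein0 k l e al be i a : i != k -> homog k l e al be ** ein t X i a = 0.
Proof. by move=> ik; rewrite mcompDl -!mcompA !ein_neqk // !mcomp0r addr0. Qed.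

Lemma homog_comm k l e al be :
  is_depth (pt false (X k)) (pt e (Y l)) al -> is_depth (pt true (X k)) (pt (~~ e) (Y l)) be ->
  al + arc_len (Y l) e = arc_len (X k) false + be ->
  homog k l e al be ** ed t X = ed t Y ** homog k l e al be.
Proof.
move=> A1 A2 E; apply: ein_ext => i a.
rewrite -[_ ** ed t X ** _]mcompA ed_ein -[ed t Y ** _ ** _]mcompA.
rewrite [homog _ _ _ _ _ ** (_ ** _)]mcompA.
have [->|ik] := eqVneq i k; last by rewrite !homog_ein0 // mcomp0l mcomp0r.
have gX : arc_len (X k) false + arc_len (X k) true = tau := arc_lenN (X k) false.
have gY := arc_lenN (Y l) e.
case: a.
  rewrite homog_einF homog_einT mcompA ed_ein -!mcompA /eslide.
  rewrite (slide_comp t (arc_len_depth (X k) true) A1).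
  rewrite (slide_comp t A2 (arc_len_depth (Y l) (~~ e))).
  have -> : arc_len (X k) true + al = be + arc_len (Y l) (~~ e) by lra.
  by case: (e).
rewrite homog_einF homog_einT mcompA ed_ein -!mcompA /eslide.
rewrite (slide_comp t (arc_len_depth (X k) false) A2).
by rewrite (slide_comp t A1 (arc_len_depth (Y l) e)) E.
Qed.

(** The even and odd parts of all components of F. *)
Lemma homog_decomp (F : hom (erep t X) (erep t Y)) :
  F = \sum_l \sum_k \sum_e ((ein t Y l e ** entry F l e k false) ** eout t X k false +
    (ein t Y l (~~ e) ** entry F l (~~ e) k true) ** eout t X k true).
Proof.
rewrite -{1}[F]mcomp1m -(sum_ein t Y) mcomp_suml; apply: eq_bigr => l _.
rewrite -[LHS]mcompm1 -(sum_ein t X) mcomp_sumr; apply: eq_bigr => k _.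
rewrite !big_bool /= !mcompDl !mcompDr /entry -!mcompA -!addrA.
set a := ein t Y l true ** _; set b := ein t Y l true ** _.
set c := ein t Y l false ** _; set d := ein t Y l false ** _.
by rewrite addrC -!addrA.
Qed.

Lemma hull_factor_stably_zero n' (W : 'I_n' -> S1)
    (f1 : hom (erep t X) (erep t (fun i => hull phi (W i))))
    (f2 : hom (erep t (fun i => hull phi (W i))) (erep t Y)) (F : hom (erep t X) (erep t Y)) :
  f1 ** ed t X = ed t _ ** f1 -> f2 ** ed t _ = ed t Y ** f2 -> f2 ** f1 = F -> stably_zero F.
Proof.
move=> c1 c2 E; pose H := eobject (fun i => hull phi (W i)).
pose g1 : mor (eobject X) H := @mkmor _ _ _ _ (eobject X) H f1 c1.
pose g2 : mor H (eobject Y) := @mkmor _ _ _ _ H (eobject Y) f2 c2.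
exists (g2 ** g1); last by rewrite fval_comp.
exists [:: g2 ** g1]; last by rewrite big_seq1.
move=> g; rewrite inE => /eqP ->; exists H; first exact: hull_projinj.
by exists g2, g1.
Qed.

End Homogeneous.

Section Factor.
Variables (n m : nat) (X : 'I_n -> indObj phi) (Y : 'I_m -> indObj phi).
Variables (k : 'I_n) (l : 'I_m) (e : bool) (al be : RR).
Hypotheses (A1 : is_depth (pt false (X k)) (pt e (Y l)) al)
  (A2 : is_depth (pt true (X k)) (pt (~~ e) (Y l)) be)
  (E : al + arc_len (Y l) e = arc_len (X k) false + be).

(** In terms of lifts the hypothesis is x1 <= phi y0, and then
    (x0, x1) <= (y0, phi y0) <= (y0, y1) is a factorization through the hull of
    y0. *)
Lemma stably_zero_first : arc_len (X k) false <= gap (pt e (Y l)) + al ->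
  stably_zero (homog X Y k l e al be).
Proof.
move=> le; have [A1' E'] := (A1, E); set p := pt e (Y l) in A1' le *; pose W (_ : 'I_1) := p.
have gH := arc_len_hull phi p.
have le' : arc_len (X k) false <= al + gap p by rewrite addrC.
have B1 := is_depth_sub (arc_len_depth (X k) false) (is_depth_comp A1' (hull_depth phi p)) le'.
have B2 := is_depth_sub (hull_depth phi p) (arc_len_depth (Y l) e) (gap_arc_len (Y l) e).
pose f1 := homog X (fun i => hull phi (W i)) k 0 false al (al + gap p - arc_len (X k) false).
pose f2 := homog (fun i => hull phi (W i)) Y 0 l e 0 (arc_len (Y l) e - gap p).
have A0 : is_depth (pt false (hull phi p)) p 0 by exact: is_depth_self.
have c1 : f1 ** ed t X = ed t _ ** f1.
  by apply: homog_comm => //; rewrite gH; lra.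
have c2 : f2 ** ed t _ = ed t Y ** f2.
  by apply: homog_comm => //; rewrite gH; lra.
apply: (hull_factor_stably_zero c1 c2); apply: ein_ext => i a; rewrite -(mcompA f2 f1).
have [->|ik] := eqVneq i k; last by rewrite /f1 !(homog_ein0 _ _ _ _ _ _ _ ik) mcomp0r.
case: a.
  rewrite (homog_einT X (fun i => hull phi (W i))) (homog_einT X Y) mcompA.
  rewrite (homog_einT (fun i => hull phi (W i)) Y) -(mcompA (ein t Y l (~~ e))).
  rewrite (slide_comp t B1 B2); congr (_ ** slide _ _ _ _).
  by lra.
rewrite (homog_einF X (fun i => hull phi (W i))) (homog_einF X Y) mcompA.
rewrite (homog_einF (fun i => hull phi (W i)) Y) -(mcompA (ein t Y l e)).
by rewrite (slide_comp t A1' A0) addr0.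
Qed.

(** In terms of lifts the hypothesis is x0 + 2 pi <= phi y1, and then
    (x0, x1) <= (phi y1 - 2 pi, y1) <= (y0, y1) is a factorization through the
    hull of y1, whose points occur in the opposite order. *)
Lemma stably_zero_second : arc_len (X k) true <= gap (pt (~~ e) (Y l)) + be ->
  stably_zero (homog X Y k l e al be).
Proof.
move=> le; have [A2' E'] := (A2, E); set p := pt (~~ e) (Y l) in A2' le *; pose W (_ : 'I_1) := p.
have gH := arc_len_hull phi p.
have gHN : arc_len (hull phi p) false + arc_len (hull phi p) true = tau.
  exact: (arc_lenN (hull phi p) false).
have gX : arc_len (X k) false + arc_len (X k) true = tau := arc_lenN (X k) false.
have gY := arc_lenN (Y l) e.
have le' : arc_len (X k) true <= be + gap p by rewrite addrC.
have B1 := is_depth_sub (arc_len_depth (X k) true) (is_depth_comp A2' (hull_depth phi p)) le'.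
have B2 := is_depth_sub (hull_depth phi p) (arc_len_depth (Y l) (~~ e)) (gap_arc_len (Y l) (~~ e)).
pose f1 := homog X (fun i => hull phi (W i)) k 0 true (be + gap p - arc_len (X k) true) be.
pose f2 := homog (fun i => hull phi (W i)) Y 0 l (~~ e) 0 (arc_len (Y l) (~~ e) - gap p).
have A0 : is_depth (pt false (hull phi p)) p 0 by exact: is_depth_self.
have c1 : f1 ** ed t X = ed t _ ** f1.
  by apply: homog_comm => //; lra.
have c2 : f2 ** ed t _ = ed t Y ** f2.
  by apply: homog_comm => //; rewrite gH; lra.
apply: (hull_factor_stably_zero c1 c2); apply: ein_ext => i a; rewrite -(mcompA f2 f1).
have [->|ik] := eqVneq i k; last by rewrite /f1 !(homog_ein0 _ _ _ _ _ _ _ ik) mcomp0r.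
case: a.
  rewrite (homog_einT X (fun i => hull phi (W i))) (homog_einT X Y) mcompA.
  rewrite (homog_einF (fun i => hull phi (W i)) Y) -(mcompA (ein t Y l (~~ e))).
  by rewrite (slide_comp t A2' A0) addr0.
rewrite (homog_einF X (fun i => hull phi (W i))) (homog_einF X Y) mcompA.
rewrite (homog_einT (fun i => hull phi (W i)) Y) -(mcompA (ein t Y l (~~ ~~ e))).
rewrite (slide_comp t B1 B2).
have -> : be + gap p - arc_len (X k) true + (arc_len (Y l) (~~ e) - gap p) = al by lra.
by rewrite /p; case: (e).
Qed.

End Factor.

Section LinkCoefficients.
Variables (K : fieldType) (rho : {rmorphism R -> K}).
Hypothesis K_res : is_residue_field t rho.

(** The coordinate on b_e of the (l, k) component of F. By entry_linked, the
    opposite entry would give the same value. *)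
Definition link_coeff n m (X : 'I_n -> indObj phi) (Y : 'I_m -> indObj phi)
    (F : hom (erep t X) (erep t Y)) l k : K :=
  if hom_sign (X k) (Y l) is Some e then rho (coeff (entry F l e k false)) else 0.

(** Each homogeneous part c T of F factors through a hull unless its lifts satisfy the
    inequalities of a link. In this case the hypothesis makes c divisible by t,
    and c T is a multiple of the homogeneous morphism that turns once more, which
    factors. *)
Lemma link_coeff_stably_zero n m (X : 'I_n -> indObj phi) (Y : 'I_m -> indObj phi)
    (F : hom (erep t X) (erep t Y)) : F ** ed t X = ed t Y ** F ->
  (forall l k, link_coeff F l k = 0) -> stably_zero F.
Proof.
move=> Fd F0; rewrite (homog_decomp F).
apply: stably_zero_sum => l; apply: stably_zero_sum => k; apply: stably_zero_sum => e.
have := entry_pair R_dvr t_unif l e k false Fd.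
move=> [c [al [be [A1 A2 E fE gE]]]].
have -> : (ein t Y l e ** entry F l e k false) ** eout t X k false +
    (ein t Y l (~~ e) ** entry F l (~~ e) k true) ** eout t X k true =
    c *: homog X Y k l e al be.
  rewrite fE; have -> : entry F l (~~ e) k true =
    c *: slide t (pt true (X k)) (pt (~~ e) (Y l)) be by exact: gE.
  by rewrite scalerDr !mcompZr !mcompZl.
have [le|lt1] := leP (arc_len (X k) false) (gap (pt e (Y l)) + al).
  exact/stably_zeroZ/stably_zero_first.
have [le|lt2] := leP (arc_len (X k) true) (gap (pt (~~ e) (Y l)) + be).
  exact/stably_zeroZ/stably_zero_second.
have [x0 x0E] := cls_surj (pt false (X k)).
pose x1 := x0 + arc_len (X k) false; pose y0 := x0 + al; pose y1 := x1 + be.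
have Xx : lifts false (X k) x0 x1 by exact: lifts_pt.
have gX : arc_len (X k) false + arc_len (X k) true = tau := arc_lenN (X k) false.
have y0E : cls y0 = pt e (Y l).
  by case: A1 => _ aE; rewrite clsD aE -x0E addrC subrK.
have Yy : lifts e (Y l) y0 y1 by apply: lifts_pt => //; rewrite /y1 /x1 /y0; lra.
have y1E : cls y1 = pt (~~ e) (Y l) by case: Yy => _ ->; case: (e).
have g0 := gap_lift phi y0E; have g1 := gap_lift phi y1E.
have lt_psi x y : phi y < x -> y < psi x.
  by move=> lt; rewrite ltNge; apply/negP => /(homeo_mono phi); rewrite homeo_invK; lra.
have link : linked e (X k) (Y l).
  exists x0, x1, y0, y1; split=> //; split.
  - by case: A1 => a0 _; rewrite /y0; lra.
  - by apply: lt_psi; rewrite /x1 /y0 in g0 *; lra.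
  - by case: A2 => b0 _; rewrite /y1; lra.
  - by apply: lt_psi; rewrite /x1 /y1 /x1 in g1 *; lra.
have al_lt : al < tau.
  have gp := gap_ge0 phi (pt e (Y l)).
  have gt : 0 <= arc_len (X k) true by case: (arc_len_depth (X k) true).
  lra.
have := F0 l k; rewrite /link_coeff; move/hom_signP: (link) => ->.
rewrite fE coeffZ (coeff_slide t A1 al_lt) mulr1.
case: K_res => _ /(_ c) [+ _] => H /H[c1 ->].
have -> : (c1 * t) *: homog X Y k l e al be = c1 *: homog X Y k l e (al + tau) (be + tau).
  have s1 := slide_turns t 1 A1; have s2 := slide_turns t 1 A2.
  rewrite mulr1 expr1 in s1 s2.
  by rewrite /homog s1 s2 !mcompZr !mcompZl -scalerDr scalerA.
have B1 := is_depthD 1 A1; have B2 := is_depthD 1 A2; rewrite mulr1 in B1 B2.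
apply: stably_zeroZ; apply: stably_zero_first => //; first by lra.
have gp := gap_ge0 phi (pt e (Y l)).
have gt : 0 <= arc_len (X k) true by case: (arc_len_depth (X k) true).
by case: A1 => a0 _; lra.
Qed.

End LinkCoefficients.
End Stable.

(** * Matrices of link coefficients *)

Section Matrices.
Variables (RR : realType) (R : idomainType) (t : R) (phi : lineHomeo RR).
Hypothesis R_dvr : discrete_valuation_ring R.
Hypothesis t_unif : uniformizer t.
Variables (K : fieldType) (rho : {rmorphism R -> K}).
Hypothesis K_res : is_residue_field t rho.
Notation S1 := (S1 RR).
Notation rC := (repCat RR t).
Notation hom := (@mor R rC).
Notation tau := (@twopi RR).
Notation gap := (gap phi).
Notation eobject := (eobject R_dvr t_unif).
Notation stable_ideal := (@stable_ideal RR R t phi).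

Section Linearity.
Variables (n m : nat) (X : 'I_n -> indObj phi) (Y : 'I_m -> indObj phi).

Lemma entryD (F G : hom (erep t X) (erep t Y)) l b k a :
  entry (F + G) l b k a = entry F l b k a + entry G l b k a.
Proof. by rewrite /entry mcompDr mcompDl. Qed.

Lemma entryZ c (F : hom (erep t X) (erep t Y)) l b k a :
  entry (c *: F) l b k a = c *: entry F l b k a.
Proof. by rewrite /entry mcompZr mcompZl. Qed.

Lemma link_coeff_linear c (F G : hom (erep t X) (erep t Y)) l k :
  link_coeff rho (c *: F + G) l k = rho c * link_coeff rho F l k + link_coeff rho G l k.
Proof.
rewrite /link_coeff; case: hom_sign => [e|]; last by rewrite mulr0 addr0.
by rewrite entryD entryZ coeffD coeffZ rmorphD rmorphM.
Qed.

Lemma entry_homog k l e al be : entry (homog t X Y k l e al be) l e k false =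
  slide t (pt false (X k)) (pt e (Y l)) al.
Proof. by rewrite /entry -mcompA homog_einF mcompA einK mcomp1m. Qed.

Lemma entry_homog_k k l e al be l' b k' a : k' != k ->
  entry (homog t X Y k l e al be) l' b k' a = 0.
Proof. by move=> kk; rewrite /entry -mcompA homog_ein0 // mcomp0r. Qed.

Lemma entry_homog_l k l e al be l' b k' a : l' != l ->
  entry (homog t X Y k l e al be) l' b k' a = 0.
Proof.
rewrite eq_sym => ll; rewrite /entry /homog mcompDr -!(mcompA (ein t Y l _)).
by rewrite 2!(mcompA (eout t Y l' b)) !(ein_neqk t Y _ _ ll) !mcomp0l addr0 mcomp0l.
Qed.

Lemma linked_homog k l e : linked e (X k) (Y l) -> exists al be,
  [/\ is_depth (pt false (X k)) (pt e (Y l)) al, is_depth (pt true (X k)) (pt (~~ e) (Y l)) be,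
      al + arc_len (Y l) e = arc_len (X k) false + be & al < tau].
Proof.
move=> /linked_lifts[x0 [x1 [y0 [y1 [Xx Yy xy E [gX gY h]]]]]].
have A1 := is_depth_angle (pt false (X k)) (pt e (Y l)).
have /andP[_ lt] := angle_itv (pt e (Y l) - pt false (X k)).
exists (angle (pt e (Y l) - pt false (X k))), (y1 - x1); split=> //.
  apply: is_depth_lift; [by case: Xx|by case: Yy => _ ->; case: (e)|by lra].
by rewrite gX gY -[angle _]E; lra.
Qed.

(** The homogeneous morphism of least depth of a link has coefficient 1. *)
Lemma link_coeff_surj (M : 'I_m -> 'I_n -> K) :
  (forall l k, hom_sign (X k) (Y l) = None -> M l k = 0) ->
  exists F : hom (erep t X) (erep t Y),
    F ** ed t X = ed t Y ** F /\ forall l k, link_coeff rho F l k = M l k.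
Proof.
move=> M0; have lift l k : exists r, rho r = M l k by case: K_res.
have H l k : exists G : hom (erep t X) (erep t Y), [/\ G ** ed t X = ed t Y ** G,
    link_coeff rho G l k = M l k & forall l' k', (l', k') != (l, k) -> link_coeff rho G l' k' = 0].
  case hs: (hom_sign (X k) (Y l)) => [e|].
    have [r rE] := lift l k.
    have [al [be [A1 A2 E lt]]] := linked_homog (iffLR (hom_signP _ _ _) hs).
    exists (r *: homog t X Y k l e al be); split.
    - by rewrite mcompZl mcompZr homog_comm.
    - by rewrite /link_coeff hs entryZ coeffZ entry_homog coeff_slide // mulr1.
    move=> l' k'; rewrite xpair_eqE negb_and => /orP ne.
    rewrite /link_coeff; case: hom_sign => // e'; rewrite entryZ coeffZ.
    by case: ne => ne; rewrite ?(entry_homog_l _ _ _ _ _ _ _ ne)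
      ?(entry_homog_k _ _ _ _ _ _ _ ne) coeff0 mulr0 rmorph0.
  exists 0; split; first by rewrite mcomp0l mcomp0r.
    by rewrite /link_coeff hs M0.
  by move=> l' k' _; rewrite /link_coeff; case: hom_sign => // e';
    rewrite /entry mcomp0r mcomp0l coeff0 rmorph0.
pose G l k := sval (cid (H l k)).
have link_addE (F1 F2 : hom (erep t X) (erep t Y)) l k :
    link_coeff rho (F1 + F2) l k = link_coeff rho F1 l k + link_coeff rho F2 l k.
  by rewrite -{1}[F1]scale1r link_coeff_linear rmorph1 mul1r.
have link_sumE (I : Type) (r : seq I) (F : I -> hom (erep t X) (erep t Y)) l k :
    link_coeff rho (\sum_(i <- r) F i) l k = \sum_(i <- r) link_coeff rho (F i) l k.
  elim: r => [|i r IH]; last by rewrite !big_cons link_addE IH.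
  rewrite !big_nil /link_coeff; case: hom_sign => // e.
  by rewrite /entry mcomp0r mcomp0l coeff0 rmorph0.
exists (\sum_l \sum_k G l k); split.
  rewrite mcomp_suml mcomp_sumr; apply: eq_bigr => l _.
  rewrite mcomp_suml mcomp_sumr; apply: eq_bigr => k _.
  by rewrite /G; case: cid => F [].
move=> l k; rewrite link_sumE (bigD1 l) //= link_sumE (bigD1 k) //=.
have [_ -> G0] := svalP (cid (H l k)).
have Goff l' k' : (l, k) != (l', k') -> link_coeff rho (G l' k') l k = 0.
  by rewrite /G; case: cid => F [_ _] /=; exact.
rewrite !big1 ?addr0 // => [l' ll|k' kk].
  rewrite link_sumE big1 // => k' _.
  by rewrite Goff // xpair_eqE [l == _]eq_sym (negbTE ll).
by rewrite Goff // xpair_eqE [k == _]eq_sym (negbTE kk) andbF.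
Qed.

End Linearity.

Section Comp.
Variables (n m l : nat).
Variables (X : 'I_n -> indObj phi) (Y : 'I_m -> indObj phi) (V : 'I_l -> indObj phi).

Lemma link_coeff_comp (F : hom (erep t X) (erep t Y)) (G : hom (erep t Y) (erep t V)) k i :
  F ** ed t X = ed t Y ** F -> G ** ed t Y = ed t V ** G ->
  link_coeff rho (G ** F) k i =
  \sum_j if signs_compose (X i) (Y j) (V k) then link_coeff rho G k j * link_coeff rho F j i else 0.
Proof.
move=> Fd Gd; rewrite {1}/link_coeff.
case XV: (hom_sign (X i) (V k)) => [e|]; last first.
  rewrite big1 // => j _; rewrite /signs_compose XV.
  by case: hom_sign => // e1; case: hom_sign.
have -> : entry (G ** F) k e i false =
    \sum_j \sum_b entry G k e j b ** entry F j b i false.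
  transitivity (eout t V k e ** G ** (\sum_j \sum_b ein t Y j b ** eout t Y j b) **
      (F ** ein t X i false)).
    by rewrite sum_ein mcompm1 /entry !mcompA.
  rewrite mcomp_sumr mcomp_suml; apply: eq_bigr => j _.
  rewrite mcomp_sumr mcomp_suml; apply: eq_bigr => b _.
  by rewrite /entry !mcompA.
rewrite coeff_sum rmorph_sum; apply: eq_bigr => j _.
rewrite coeff_sum rmorph_sum big_bool /=.
have /hom_signP link := XV.
have comp b := entry_comp R_dvr t_unif K_res Fd Gd j b link.
rewrite (comp true) (comp false) /signs_compose /link_coeff XV.
case: (hom_sign (X i) (Y j)) => [[]|]; case: (hom_sign (Y j) (V k)) => [[]|]; case: (e) => /=;
  by rewrite ?addr0 ?add0r // mulrC.
Qed.

End Comp.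

(** A link from the hull to itself would give x0 <= y0 < phi^-1 (phi x0). *)
Lemma hull_zero (X : indObj phi) p : hom_sign X (hull phi p) = None.
Proof.
case E: (hom_sign _ _) => [e|//]; have [_ /hom_signP] := hom_sign_id E.
move=> [x0 [x1 [y0 [y1 [Xx Yy xy]]]]].
have [a1 a2 _ _] := below_lt xy; case: xy => h1 h2 _ _.
have gE := lifts_arc_len Xx a1 a2; rewrite arc_len_hull in gE.
have gl := gap_lift phi (lifts_cls0 Xx).
have x1E : x1 = phi x0 by move: gE; rewrite [gap _]gl; lra.
by exfalso; move: h2; rewrite x1E homeo_funK; lra.
Qed.

(** A morphism from a projective object to a sum of E(Y) factors through a cover by
    hulls, and all link coefficients of a morphism to a hull are zero. *)
Lemma link_coeff_ideal n m (X : 'I_n -> indObj phi) (Y : 'I_m -> indObj phi)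
    (f : mor (eobject X) (eobject Y)) l k :
  in_ideal stable_ideal f -> link_coeff rho (fval f) l k = 0.
Proof.
have link0 : link_coeff rho (0 : hom (erep t X) (erep t Y)) l k = 0.
  rewrite /link_coeff; case: hom_sign => // e.
  by rewrite /entry mcomp0r mcomp0l coeff0 rmorph0.
move=> [s sI ->]; elim: s sI => [|g s IH] sI.
  by rewrite big_nil fval0.
rewrite big_cons fvalD -{1}[fval g]scale1r link_coeff_linear IH ?addr0; last first.
  by move=> g' g's; apply: sI; rewrite inE g's orbT.
rewrite rmorph1 mul1r.
have [Q [Qproj _] [u [h ->]]] := sI g (mem_head _ _).
have [n' [W [B [j [p ex]]]]] := hull_cover R_dvr t_unif (eobject Y).
have [u' <-] := Qproj _ _ _ _ _ ex u.
rewrite -mcompA fval_comp.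
rewrite (link_coeff_comp (Y := fun i => hull phi (W i)) _ _ (fval_comm (u' ** h)) (fval_comm p)).
rewrite big1 // => i _; rewrite /signs_compose hull_zero.
by [].
Qed.

End Matrices.

(** * Decomposition of objects *)

Section Decomposition.
Variables (RR : realType) (R : idomainType) (t : R) (phi : lineHomeo RR).
Hypothesis R_dvr : discrete_valuation_ring R.
Hypothesis t_unif : uniformizer t.
Notation S1 := (S1 RR).
Notation rC := (repCat RR t).
Notation P := (freeRep t : S1 -> rC).
Notation hom := (@mor R rC).
Notation tau := (@twopi RR).
Let t_neq0 := unif_neq0 R_dvr t_unif.
Notation gap := (gap phi).
Notation FC := (F_phi t phi).
Notation eobject := (eobject R_dvr t_unif).
Notation psi := (homeo_inv phi).

Lemma ind_of_gaps p q m : is_depth p q m -> m < tau -> gap p <= m -> gap q <= tau - m ->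
  exists X : indObj phi, [/\ pt0 X = p, pt1 X = q & arc_len X false = m].
Proof.
move=> pq mt gp gq; have [x xE] := cls_surj p.
have x1E : cls (x + m) = q by case: (pq) => _ mE; rewrite clsD mE -xE addrC subrK.
have H : exists x0 x1, [/\ cls x0 = p, cls x1 = q &
    x0 <= phi x0 <= x1 /\ x1 <= psi (x0 + tau)].
  exists x, (x + m); split=> //; split.
    have /andP[-> _] /= := homeo_bound phi x.
    by move: gp; rewrite (gap_lift phi (esym xE)); lra.
  rewrite -[X in X <= _](homeo_funK phi); apply: homeo_inv_mono.
  by move: gq; rewrite (gap_lift phi x1E); lra.
exists (IndObj H); split=> //=; exact/esym/is_depth_small.
Qed.

Definition single (x : indObj phi) : FC := eobject (fun _ : 'I_1 => x).

Section Splitting.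
Variable A : FC.
Notation D := (dmap A).
Notation V := (carrier A).

Section Pivot.
Variables (f : hom V V) (p q : S1) (m : RR).
Hypotheses (fD : f ** D = D ** f) (pq : is_depth p q m) (mt : m < tau).
Variables (v0 : hom (P p) V) (v1 : hom (P q) V) (r0 : hom V (P p)) (r1 : hom V (P q)).
Hypotheses (fv0 : f ** v0 = v0) (r1f : r1 ** f = r1).
Hypotheses (Dv0 : D ** v0 = v1 ** slide t p q m) (r1D : r1 ** D = slide t p q m ** r0).
Hypothesis (r1Dv0 : r1 ** D ** v0 = slide t p q m).

Let qp : is_depth q p (tau - m). Proof. exact: is_depth_back (ltW mt). Qed.

Let back_forth : slide t q p (tau - m) ** slide t p q m = t *: idm (P p).
Proof. by rewrite (slide_comp t pq qp) subrKC slide_turn. Qed.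

Let forth_back : slide t p q m ** slide t q p (tau - m) = t *: idm (P q).
Proof. by rewrite (slide_comp t qp pq) subrK slide_turn. Qed.

(** Two elements v0 and v1 with d v0 = v1, up to a slide, define a morphism
    E(p, q) -> A, and dually r0 and r1 define one back. When r1 d v0 is the slide
    itself, the composite is 1 + c d with c the coefficient of r1 v0, so that
    composing with (1 - c d) / (1 - c^2 t) makes it the identity. *)
Lemma pivot_split : exists (x : indObj phi) (i : mor (single x) A) (j : mor A (single x)),
  [/\ j ** i = idm (single x), f ** fval i = fval i & fval j ** f = fval j].
Proof.
have tfV : torsion_free V by exact: carrier_tf.
have tf x : torsion_free (P x) by exact: torsion_free_free.
have fv1 : f ** v1 = v1.
  apply: (slide_cancel_r tfV pq).
  by rewrite -mcompA -Dv0 mcompA fD -mcompA fv0.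
have r0f : r0 ** f = r0.
  apply: (slide_cancel_l t_neq0 pq).
  by rewrite mcompA -r1D -mcompA -fD mcompA r1f.
have r1v1 : r1 ** v1 = idm (P q).
  by apply: (slide_cancel_r (@tf q) pq); rewrite -mcompA -Dv0 mcompA r1Dv0 mcomp1m.
have r0v0 : r0 ** v0 = idm (P p).
  by apply: (slide_cancel_l t_neq0 pq); rewrite mcompA -r1D r1Dv0 mcompm1.
have Dv1 : D ** v1 = v0 ** slide t q p (tau - m).
  apply: (slide_cancel_r tfV pq).
  rewrite -!mcompA back_forth -Dv0 mcompA dmap_sq.
  by rewrite mcompZl mcomp1m mcompZr mcompm1.
have r0D : r0 ** D = slide t q p (tau - m) ** r1.
  apply: (slide_cancel_l t_neq0 pq).
  rewrite !mcompA -r1D forth_back -mcompA dmap_sq.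
  by rewrite mcompZr mcompm1 mcompZl mcomp1m.
have r0Dv1 : r0 ** D ** v1 = slide t q p (tau - m).
  by rewrite r0D -mcompA r1v1 mcompm1.
have gp : gap p <= m.
  apply: (deep_bound R_dvr t_unif pq (unitr1 R)); rewrite scale1r -r1Dv0 -mcompA.
  exact/(divr_deep (gap_ge0 _ _))/divr_compl/dmap_phi_deep.
have gq : gap q <= tau - m.
  apply: (deep_bound R_dvr t_unif qp (unitr1 R)); rewrite scale1r -r0Dv1 -mcompA.
  exact/(divr_deep (gap_ge0 _ _))/divr_compl/dmap_phi_deep.
have [X [pX qX gX]] := ind_of_gaps pq mt gp gq.
pose c := coeff (r1 ** v0).
have r1v0 : r1 ** v0 = c *: slide t p q m by exact: hom_slide_small.
have r0v1 : r0 ** v1 = c *: slide t q p (tau - m).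
  apply: (slide_cancel_l t_neq0 pq); rewrite mcompA -r1D -mcompA Dv1 mcompA r1v0.
  by rewrite mcompZl mcompZr.
have wU : 1 - c * c * t \is a GRing.unit.
  have [//|[y yE]] := unitVdvd t_unif (1 - c * c * t).
  move/negP: (unif_nonunit t_unif); case; apply/unitrPr; exists (y + c * c).
  by rewrite mulrC mulrDl -yE subrK.
(* The morphisms u0, u1 are the components of the corrected morphism from E(p, q). *)
pose w := (1 - c * c * t)^-1.
pose u0 := w *: (v0 - c *: (D ** v0)).
pose u1 := w *: (v1 - c *: (D ** v1)).
have Du : D ** u0 = u1 ** slide t p q m.
  rewrite /u0 /u1 mcompZr mcompZl mcompBr mcompBl mcompZr mcompZl Dv0.
  by rewrite mcompA.
have fu0 : f ** u0 = u0 by rewrite mcompZr mcompBr mcompZr mcompA fD -mcompA fv0.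
have fu1 : f ** u1 = u1 by rewrite mcompZr mcompBr mcompZr mcompA fD -mcompA fv1.
have wE (Z : lmodType R) (z : Z) : w *: (z - c *: (c *: (t *: z))) = z.
  by rewrite !scalerA -{1}[z]scale1r -scalerBl scalerA mulVr // scale1r.
have r0u0 : r0 ** u0 = idm (P p).
  rewrite mcompZr mcompBr mcompZr mcompA r0D -mcompA r1v0 mcompZr back_forth r0v0.
  exact: wE.
have r1u1 : r1 ** u1 = idm (P q).
  rewrite mcompZr mcompBr mcompZr Dv1 mcompA r1v0 mcompZl forth_back r1v1.
  exact: wE.
have r1u0 : r1 ** u0 = 0.
  by rewrite mcompZr mcompBr mcompZr mcompA r1Dv0 r1v0 subrr scaler0.
have r0u1 : r0 ** u1 = 0.
  by rewrite mcompZr mcompBr mcompZr mcompA r0Dv1 r0v1 subrr scaler0.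
move: pX qX; clear -fu0 fu1 r0f r1f r0u0 r1u1 r1u0 r0u1 Du r1D gX.
move=> pX qX; subst p q.
pose Xf (_ : 'I_1) := X.
have Hi (k : 'I_1) : D ** u0 = u1 ** eslide t Xf k false by rewrite Du -gX.
have Hj (k : 'I_1) : r1 ** D = eslide t Xf k false ** r0 by rewrite r1D -gX.
have [i iE] := @map_from_E _ _ _ _ R_dvr t_unif 1 Xf A (fun=> u0) (fun=> u1) Hi.
have [j jE] := @map_to_E _ _ _ _ R_dvr t_unif 1 Xf A (fun=> r0) (fun=> r1) Hj.
exists X, i, j; split.
- apply: fval_inj; rewrite fval_comp fval_id.
  apply: eout_ext => k b; apply: ein_ext => l a.
  rewrite [l]ord1 [k]ord1 {k l} mcompm1 !mcompA -[_ ** fval i ** _]mcompA.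
  have [iF iT] := iE 0; have [jF jT] := jE 0.
  case: b; case: a.
  - by rewrite iT jT r1u1 einK.
  - by rewrite iF jT r1u0 (ein_neqb t Xf 0 false).
  - by rewrite iT jF r0u1 (ein_neqb t Xf 0 true).
  - by rewrite iF jF r0u0 einK.
- apply: ein_ext => k b; rewrite -mcompA; have [iF iT] := iE k.
  by case: b; rewrite ?iF ?iT.
- apply: eout_ext => k b; rewrite mcompA; have [jF jT] := jE k.
  by case: b; rewrite ?jF ?jT.
Qed.

End Pivot.

(** The matrix of f d has a unit entry, for otherwise f d = t h and
    t f = (f d)^2 = t^2 h^2, so that f would be divisible by t. Around a unit entry
    of least depth m, everything that f d reaches can be divided by the slide of
    depth m. *)
Lemma nonzero_split (f : hom V V) : f ** f = f -> f ** D = D ** f -> f != 0 ->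
  exists (x : indObj phi) (i : mor (single x) A) (j : mor A (single x)),
  [/\ j ** i = idm (single x), f ** fval i = fval i & fval j ** f = fval j].
Proof.
move=> ff fD f0; have [T [x [s [g gs]]]] := carrier_dual_basis A.
pose M a b := s a ** (f ** D) ** g b.
have fDE : f ** D = \sum_a \sum_b g a ** M a b ** s b.
  rewrite -{1}[f]mcomp1m -gs -mcompA mcomp_suml; apply: eq_bigr => a _.
  rewrite -[LHS]mcompm1 -gs mcomp_sumr; apply: eq_bigr => b _.
  by rewrite /M !mcompA.
have [[N MN]|[a [b [u [m [uU ma mt Mab deepM]]]]]] := least_unit_entry t_unif M.
  pose h := \sum_a \sum_b g a ** N a b ** s b.
  have fDh : f ** D = t *: h.
    rewrite fDE /h scaler_sumr; apply: eq_bigr => a _.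
    rewrite scaler_sumr; apply: eq_bigr => b _.
    by rewrite -mcompZl -mcompZr -MN.
  case/eqP: f0; apply: (idempotent_divisible R_dvr t_unif (h := h ** h)) => //.
    by exists T, x, s, g.
  apply: (@torsion_free_exp _ _ _ _ _ 1 f (t *: (h ** h)) (carrier_tf R_dvr t_unif (A := A))).
  rewrite expr1; transitivity ((f ** D) ** (f ** D)).
    rewrite {2}fD !mcompA -[f ** D ** D]mcompA dmap_sq mcompZr mcompm1 mcompZl.
    by rewrite ff.
  by rewrite fDh mcompZl mcompZr.
pose v0 := f ** g b; pose r1 := u^-1 *: (s a ** f).
have fv0 : f ** v0 = v0 by rewrite /v0 mcompA ff.
have r1f : r1 ** f = r1 by rewrite /r1 mcompZl -mcompA ff.
have m0 : 0 <= m by case: ma.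
have [v1 Dv0] : exists v1 : hom (P (x a)) V, D ** v0 = v1 ** slide t (x b) (x a) m.
  apply/(divrP _ ma); have -> : D ** v0 = \sum_c g c ** M c b.
    transitivity ((\sum_c g c ** s c) ** (f ** D) ** g b).
      by rewrite gs mcomp1m /v0 mcompA fD.
    by rewrite !mcomp_suml; apply: eq_bigr => c _; rewrite /M !mcompA.
  by apply: divr_sum => c _; exact/divr_compl/deep_divr.
have [r0 r1D] : exists r0 : hom V (P (x b)), r1 ** D = slide t (x b) (x a) m ** r0.
  apply/(divlP _ ma); have -> : r1 ** D = \sum_c u^-1 *: (M a c ** s c).
    transitivity (u^-1 *: (s a ** (f ** D) ** (\sum_c g c ** s c))).
      by rewrite gs mcompm1 /r1 mcompZl mcompA.
    by rewrite mcomp_sumr scaler_sumr; apply: eq_bigr => c _; rewrite /M !mcompA.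
  apply: divl_sum => c _; rewrite -mcompZr.
  exact/divl_compr/deep_divl.
have r1Dv0 : r1 ** D ** v0 = slide t (x b) (x a) m.
  transitivity (u^-1 *: M a b).
    rewrite /r1 /v0 /M !mcompZl; congr (_ *: _).
    by rewrite !mcompA -[s a ** f ** D ** f]mcompA -fD !mcompA -[s a ** f ** f]mcompA ff.
  by rewrite Mab scalerA mulVr // scale1r.
exact: (pivot_split fD ma mt fv0 r1f Dv0 r1D r1Dv0).
Qed.

Record esummand := ESummand {
  esum_ind : indObj phi;
  esum_inj : mor (single esum_ind) A;
  esum_prj : mor A (single esum_ind);
  esum_prjK : esum_prj ** esum_inj = idm (single esum_ind)
}.

(** Split off sums E(x, x + m) as long as the complementary idempotent is
    nonzero. *)
Theorem decomposition : exists n (X : 'I_n -> indObj phi) (i : mor (eobject X) A)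
  (j : mor A (eobject X)), i ** j = idm A /\ j ** i = idm (eobject X).
Proof.
pose e (a : esummand) : hom V V := fval (esum_inj a) ** fval (esum_prj a).
have fK (a : esummand) : fval (esum_prj a) ** fval (esum_inj a) =
    idm (carrier (single (esum_ind a))).
  by rewrite -fval_comp esum_prjK fval_id.
pose c (a : esummand) b := ein t (fun _ : 'I_1 => esum_ind a) 0 b.
pose c' (a : esummand) b := eout t (fun _ : 'I_1 => esum_ind a) 0 b.
have SK (a : esummand) : c' a false ** fval (esum_prj a) ** (fval (esum_inj a) ** c a false) =
    idm (P (pt false (esum_ind a))).
  by rewrite -mcompA (mcompA (fval (esum_prj a))) fK mcomp1m einK.
have [|||||| k [F [F1 Fo]]] := @exhaustion _ _ _ V esummand e (fun a => Summand (SK a))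
    (fun f => f ** D = D ** f) (carrier_dual_basis A).
- by move=> a /=; rewrite /e mcompA -[_ ** _ ** fval (esum_inj a)]mcompA fK mcompm1.
- by move=> a /=; rewrite /e -mcompA (mcompA (fval (esum_prj a))) fK mcomp1m.
- by move=> a; rewrite /e mcompA -[_ ** _ ** fval (esum_inj a)]mcompA fK mcompm1.
- by rewrite mcomp1m mcompm1.
- move=> f a fD; rewrite mcompBl mcompBr fD; congr (_ - _).
  by rewrite /e -mcompA (fval_comm (esum_prj a)) !mcompA (fval_comm (esum_inj a)).
- move=> f ff fD f0; have [x [i [j [K fi jf]]]] := nonzero_split ff fD f0.
  by exists (ESummand K); rewrite /e /= mcompA fi -mcompA jf.
pose X k' := esum_ind (F k').
have Hi k' : D ** (fval (esum_inj (F k')) ** c (F k') false) =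
    (fval (esum_inj (F k')) ** c (F k') true) ** eslide t X k' false.
  rewrite mcompA -(fval_comm (esum_inj (F k'))) -!mcompA; congr (_ ** _).
  exact: ed_einF.
have Hj k' : (c' (F k') true ** fval (esum_prj (F k'))) ** D =
    eslide t X k' false ** (c' (F k') false ** fval (esum_prj (F k'))).
  rewrite -mcompA (fval_comm (esum_prj (F k'))) !mcompA; congr (_ ** _).
  exact: eout_dT.
have [i iE] := map_from_E R_dvr t_unif Hi.
have [j jE] := map_to_E R_dvr t_unif Hj.
exists k, X, i, j.
have iE' k' b : fval i ** ein t X k' b = fval (esum_inj (F k')) ** c (F k') b.
  by case: b; case: (iE k').
have jE' k' b : eout t X k' b ** fval j = c' (F k') b ** fval (esum_prj (F k')).
  by case: b; case: (jE k').
split; apply: fval_inj; rewrite fval_comp fval_id.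
  rewrite -F1 -[fval i]mcompm1 -(sum_ein t X) mcomp_sumr mcomp_suml.
  apply: eq_bigr => k' _; rewrite mcomp_sumr mcomp_suml.
  transitivity (\sum_b fval (esum_inj (F k')) ** (c (F k') b ** c' (F k') b)
      ** fval (esum_prj (F k'))).
    by apply: eq_bigr => b _; rewrite mcompA iE' -!mcompA jE'.
  rewrite -mcomp_suml -mcomp_sumr.
  have := sum_ein t (fun _ : 'I_1 => esum_ind (F k')); rewrite big_ord1 => ->.
  by rewrite mcompm1.
apply: eout_ext => l b; apply: ein_ext => k' a.
rewrite mcompm1 mcompA jE' -mcompA iE'.
have [->|kl] := eqVneq k' l.
  rewrite -mcompA (mcompA (fval (esum_prj (F l)))) fK mcomp1m.
  case: a; case: b.
  - exact: etrans (einK t _ 0 true) (esym (einK t X l true)).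
  - exact: etrans (ein_neqb t _ 0 true _) (esym (ein_neqb t X l true l)).
  - exact: etrans (ein_neqb t _ 0 false _) (esym (ein_neqb t X l false l)).
  - exact: etrans (einK t _ 0 false) (esym (einK t X l false)).
rewrite (ein_neqk t X a b kl) -mcompA (mcompA (fval (esum_prj (F l)))).
have -> : fval (esum_prj (F l)) ** fval (esum_inj (F k')) = 0.
  transitivity (fval (esum_prj (F l)) ** (e (F l) ** e (F k')) ** fval (esum_inj (F k'))).
    by rewrite /e !mcompA fK mcomp1m -mcompA fK mcompm1.
  by rewrite Fo 1?eq_sym // mcomp0r mcomp0l.
by rewrite mcomp0l mcomp0r.
Qed.

End Splitting.
End Decomposition.

(** * The equivalence *)

Section Criterion.
Variables (k l : comNzRingType) (rho : k -> l) (D : linCat k) (C : linCat l).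
Variables (G : C -> D) (Phi : forall X Y, mor (G X) (G Y) -> mor X Y).
Hypothesis Phi_linear : forall X Y a (f g : mor (G X) (G Y)),
  Phi (a *: f + g) = rho a *: Phi f + Phi g.
Hypothesis Phi_id : forall X, Phi (idm (G X)) = idm X.
Hypothesis Phi_comp : forall X Y Z (g : mor (G Y) (G Z)) (f : mor (G X) (G Y)),
  Phi (g ** f) = Phi g ** Phi f.
Hypothesis Phi_inj : forall X Y, injective (@Phi X Y).
Hypothesis Phi_surj : forall X Y (M : mor X Y), exists f, Phi f = M.
Hypothesis G_surj : forall A : D, exists X (i : mor (G X) A) (j : mor A (G X)),
  i ** j = idm A /\ j ** i = idm (G X).

(** A fully faithful and dense correspondence from C to D, given by its inverse on
    morphisms; choosing for every object A of D an isomorphic G (X A) gives the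
    functor. *)
Lemma equivalence_criterion : linearly_equivalent rho D C.
Proof.
pose X A := sval (cid (G_surj A)).
have wit A : exists ij : mor (G (X A)) A * mor A (G (X A)),
    ij.1 ** ij.2 = idm A /\ ij.2 ** ij.1 = idm (G (X A)).
  by rewrite /X; case: cid => x /= [i [j H]]; exists (i, j).
pose i A := (sval (cid (wit A))).1; pose j A := (sval (cid (wit A))).2.
have ij A : i A ** j A = idm A by case: (svalP (cid (wit A))).
have ji A : j A ** i A = idm (G (X A)) by case: (svalP (cid (wit A))).
pose Fhom A B (f : mor A B) : mor (X A) (X B) := Phi (j B ** f ** i A).
have F1 A : Fhom A A (idm A) = idm (X A) by rewrite /Fhom mcompm1 ji Phi_id.
have FM A B E (g : mor B E) (f : mor A B) :
    Fhom A E (g ** f) = Fhom B E g ** Fhom A B f.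
  rewrite /Fhom -Phi_comp; congr Phi.
  by rewrite !mcompA -[_ ** i B ** j B]mcompA ij mcompm1.
pose Ghom Y Z (M : mor Y Z) : mor (G Y) (G Z) := sval (cid (Phi_surj M)).
have PG Y Z (M : mor Y Z) : Phi (Ghom Y Z M) = M by exact: (svalP (cid (Phi_surj M))).
have GP Y Z (f : mor (G Y) (G Z)) : Ghom Y Z (Phi f) = f by apply: Phi_inj; rewrite PG.
have G1 Y : Ghom Y Y (idm Y) = idm (G Y) by rewrite -Phi_id GP.
have GM Y Z W (N : mor Z W) (M : mor Y Z) : Ghom Y W (N ** M) = Ghom Z W N ** Ghom Y Z M.
  by apply: Phi_inj; rewrite Phi_comp !PG.
exists (Functor F1 FM), (Functor G1 GM); split.
- move=> A B a f g /=; rewrite /Fhom.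
  by rewrite mcompDr mcompDl mcompZr mcompZl Phi_linear.
- exists (fun A => j A); split=> [A|A B f].
    by exists (i A); split; [exact: ij|exact: ji].
  change (Ghom _ _ (Fhom A B f) ** j A = j B ** f).
  by rewrite GP -!mcompA ij mcompm1.
- exists (fun Y => Phi (i (G Y))); split=> [Y|Y Z M].
    exists (Phi (j (G Y))); split.
      change (Phi (j (G Y)) ** Phi (i (G Y)) = idm (X (G Y))).
      by rewrite -Phi_comp ji Phi_id.
    change (Phi (i (G Y)) ** Phi (j (G Y)) = idm Y).
    by rewrite -Phi_comp ij Phi_id.
  change (M ** Phi (i (G Y)) = Phi (i (G Z)) ** Phi (j (G Z) ** Ghom Y Z M ** i (G Y))).
  by rewrite -Phi_comp !mcompA ij mcomp1m Phi_comp PG.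
Qed.

End Criterion.

Section Equivalence.
Variables (RR : realType) (R : idomainType) (t : R) (phi : lineHomeo RR).
Hypothesis R_dvr : discrete_valuation_ring R.
Hypothesis t_unif : uniformizer t.
Variables (K : fieldType) (rho : {rmorphism R -> K}).
Hypothesis K_res : is_residue_field t rho.
Notation stable_ideal := (@stable_ideal RR R t phi).
Notation Cphi := (C_phi K phi).

Definition summands (X : Cphi) : 'I_(asize X) -> indObj phi := @asummand _ (indCat K phi) X.

Definition sum_object (X : Cphi) : F_phi t phi := eobject R_dvr t_unif (summands (X := X)).

Lemma coef_sumE (X Y : indObj phi) (I : Type) (r : seq I) (F : I -> indHom K X Y) :
  coef (\sum_(i <- r) F i) = \sum_(i <- r) coef (F i).
Proof. by elim/big_rec2: _ => // i y z _ <-. Qed.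

Fact link_coeff_pred (X Y : Cphi) (f : mor (sum_object X) (sum_object Y)) l k :
  link_coeff rho (fval f) l k \in @ind_pred RR K phi (summands k) (summands l).
Proof. by rewrite unfold_in; apply/implyP => /eqP hs; apply/eqP; rewrite /link_coeff hs. Qed.

Definition link_matrix (X Y : Cphi) (f : mor (sum_object X) (sum_object Y)) : mor X Y :=
  fun l k => IndHom (link_coeff_pred f l k).

Lemma link_matrix_linear X Y a (f g : mor (sum_object X) (sum_object Y)) :
  link_matrix (a *: f + g) = rho a *: link_matrix f + link_matrix g.
Proof.
apply: dprodP => l; apply: dprodP => k; apply: val_inj.
transitivity (link_coeff rho (fval (a *: f + g)) l k); first by [].
by rewrite fvalD fvalZ link_coeff_linear.
Qed.

Lemma link_matrix_id X : link_matrix (idm (sum_object X)) = idm X.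
Proof.
apply: dprodP => l; apply: dprodP => k; apply: val_inj.
transitivity (link_coeff rho (fval (idm (sum_object X))) l k); first by [].
rewrite fval_id.
have idE l' e : entry (idm (erep t (summands (X := X)))) l' e k false =
    eout t _ l' e ** ein t _ k false by rewrite /entry mcompm1.
have [<-|kl] := eqVneq k l.
  rewrite [idm X k k]aid_diag.
  change (link_coeff rho (idm (erep t (summands (X := X)))) k k =
    (if hom_sign (summands k) (summands k) == None then 0 else 1 : K)).
  rewrite /link_coeff; case E: (hom_sign (summands k) (summands k)) => [e|] //.
  have [E' _] := hom_sign_id E; move: (E); rewrite E' => -[<-].
  by rewrite idE einK coeff_id rmorph1.
rewrite [idm X l k](aid_off kl).
change (link_coeff rho (idm (erep t (summands (X := X)))) l k = 0 :> K); rewrite /link_coeff.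
case: (hom_sign (summands k) (summands l)) => [e|] //.
by rewrite idE (ein_neqk t _ _ _ kl) coeff0 rmorph0.
Qed.

Lemma link_matrix_comp X Y Z (g : mor (sum_object Y) (sum_object Z))
    (f : mor (sum_object X) (sum_object Y)) : link_matrix (g ** f) = link_matrix g ** link_matrix f.
Proof.
apply: dprodP => l; apply: dprodP => k; apply: val_inj.
transitivity (link_coeff rho (fval (g ** f)) l k); first by [].
rewrite fval_comp (link_coeff_comp R_dvr t_unif K_res l k (fval_comm f) (fval_comm g)).
transitivity (coef (\sum_j ind_comp (link_matrix g l j) (link_matrix f j k))); last by [].
by rewrite coef_sumE.
Qed.

Lemma link_matrix_surj X Y (M : mor X Y) : exists f, @link_matrix X Y f = M.
Proof.
have [l k hs|F [Fd FM]] := @link_coeff_surj RR R t phi K rho K_res _ _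
  (summands (X := X)) (summands (X := Y)) (fun l k => coef (M l k)).
  exact: coef_eq0.
exists (@mkmor _ _ _ _ (sum_object X) (sum_object Y) F Fd).
by apply: dprodP => l; apply: dprodP => k; apply: val_inj; exact: FM.
Qed.

Lemma link_matrix_ideal X Y (f : mor (sum_object X) (sum_object Y)) :
  in_ideal stable_ideal f <-> link_matrix f = 0.
Proof.
split=> [fI|f0].
  by apply: dprodP => l; apply: dprodP => k; apply: val_inj; exact: link_coeff_ideal.
have [|g gI gf] := link_coeff_stably_zero R_dvr t_unif K_res (fval_comm f).
  by move=> l k; exact: (congr1 (fun M : mor X Y => coef (M l k)) f0).
by have <- : g = f by exact: fval_inj.
Qed.

Notation stable_hom X Y := (qhom stable_ideal (sum_object X) (sum_object Y)).

Definition stable_matrix (X Y : Cphi) (q : stable_hom X Y) : mor X Y := link_matrix (repr q)%qT.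

Lemma stable_matrix_pi X Y (f : mor (sum_object X) (sum_object Y)) :
  @stable_matrix X Y (qpi stable_ideal f) = link_matrix f.
Proof.
have /link_matrix_ideal := qpi_repr stable_ideal f.
rewrite -[_ - f]addrC -scaleN1r link_matrix_linear rmorphN rmorph1 scaleN1r => /eqP.
by rewrite addrC subr_eq0 => /eqP.
Qed.

Lemma stable_matrix_linear X Y a (q r : stable_hom X Y) :
  stable_matrix (a *: q + r) = rho a *: stable_matrix q + stable_matrix r.
Proof.
have [f ->] := qpi_surj q; have [g ->] := qpi_surj r.
by rewrite [a *: qpi _ _]qpiZ -qpiD !stable_matrix_pi link_matrix_linear.
Qed.

Lemma stable_matrix_id X :
  stable_matrix (qpi stable_ideal (idm (sum_object X)) : stable_hom X X) = idm X.
Proof. by rewrite stable_matrix_pi link_matrix_id. Qed.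

Lemma stable_matrix_comp X Y Z (r : stable_hom Y Z) (q : stable_hom X Y) :
  stable_matrix (qcomp r q : stable_hom X Z) = stable_matrix r ** stable_matrix q.
Proof.
have [f ->] := qpi_surj q; have [g ->] := qpi_surj r.
by rewrite qpi_comp !stable_matrix_pi link_matrix_comp.
Qed.

Lemma stable_matrix_inj X Y : injective (@stable_matrix X Y).
Proof.
move=> q r; have [f ->] := qpi_surj q; have [g ->] := qpi_surj r.
rewrite !stable_matrix_pi => fg; apply/qpiP/link_matrix_ideal.
by rewrite addrC -scaleN1r link_matrix_linear fg rmorphN rmorph1 scaleN1r addNr.
Qed.

Lemma stable_matrix_surj X Y (M : mor X Y) : exists q : stable_hom X Y, stable_matrix q = M.
Proof.
have [f <-] := link_matrix_surj M.
by exists (qpi stable_ideal f); exact: stable_matrix_pi.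
Qed.

Lemma stable_decomposition (A : F_phi t phi) : exists (X : Cphi)
  (i : qhom stable_ideal (sum_object X) A) (j : qhom stable_ideal A (sum_object X)),
  qcomp i j = qpi stable_ideal (idm A) /\
  qcomp j i = qpi stable_ideal (idm (sum_object X)).
Proof.
have [n [X [i [j [ij ji]]]]] := decomposition R_dvr t_unif A.
exists (existT (fun n => 'I_n -> indCat K phi) n X), (qpi stable_ideal i), (qpi stable_ideal j).
by rewrite !qpi_comp ij ji.
Qed.

End Equivalence.

Theorem proposition3p2p2 (RR : realType) (R : idomainType) (t : R)
    (K : fieldType) (rho : {rmorphism R -> K}) (phi : lineHomeo RR)
    (R_dvr : discrete_valuation_ring R) (t_unif : uniformizer t)
    (K_res : is_residue_field t rho) :
  linearly_equivalent rho (stable_F_phi t phi) (C_phi K phi).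
Proof.
apply: (@equivalence_criterion _ _ rho (stable_F_phi t phi) (C_phi K phi)
  (sum_object R_dvr t_unif (K := K))
  (@stable_matrix RR R t phi R_dvr t_unif K rho)).
- exact: (stable_matrix_linear (R_dvr := R_dvr) (t_unif := t_unif) K_res).
- exact: (stable_matrix_id R_dvr t_unif K_res).
- exact: (stable_matrix_comp (R_dvr := R_dvr) (t_unif := t_unif) K_res).
- exact: (stable_matrix_inj (R_dvr := R_dvr) (t_unif := t_unif) K_res).
- exact: (stable_matrix_surj R_dvr t_unif K_res).
- exact: (stable_decomposition R_dvr t_unif K).
Qed.
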